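(* Let $k\ge 1$ be an integer, $\beta\in(0,1)$, and $\varphi_{\text{in}},\varphi_{\text{out}}>0$ with $\varphi_{\text{out}}\le \frac{1}{480}\varphi_{\text{in}}^2$. Then there exists a randomized algorithm which, given query access to a graph $G$ with $m$ edges (and minimum degree at least $1$), accepts with probability at least $2/3$ if $G$ is $(k,\varphi_{\text{in}})$-clusterable and rejects with probability at least $2/3$ if $G$ is $(k,\varphi_{\text{out}},\beta)$-unclusterable, and which makes $$\mathrm{poly}(1/\varphi_{\text{in}})\cdot\mathrm{poly}(k)\cdot\mathrm{poly}(1/\beta)\cdot\mathrm{poly}\log(m)\cdot m^{1/2+O(\varphi_{\text{out}}/\varphi_{\text{in}}^2)}$$ queries.
   Context: For a graph $G=(V_G,E_G)$, $\mathrm{vol}(S)=\sum_{v\in S}\deg(v)$. For $S\subseteq C\subseteq V_G$, the conductance of $S$ within $C$ is $\phi^G_C(S)=|E(S,C\setminus S)|/\mathrm{vol}(S)$. The internal conductance of $C$ is $\phi^G(C)=\min\{\phi^G_C(S): S\subseteq C,\ 0<\mathrm{vol}(S)\le \mathrm{vol}(C)/2\}$ if $|C|>1$ and $1$ otherwise; the external conductance of $C$ is $\phi^G_{V_G}(C)$. $G$ is $(k,\varphi)$-clusterable if $V_G$ can be partitioned into $C_1,\dots,C_h$, $h\le k$, with $\phi^G(C_i)\ge\varphi$ for all $i$. $G$ is $(k,\varphi,\beta)$-unclusterable if $V_G$ contains $k+1$ pairwise disjoint subsets $C_1,\dots,C_{k+1}$ with $\mathrm{vol}(C_i)\ge \beta\,\mathrm{vol}(V_G)/(k+1)$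 and $\phi^G_{V_G}(C_i)\le\varphi$ for all $i$. Query model: the algorithm may (i) obtain a uniformly random vertex, (ii) query the degree $\deg(v)$ of a vertex $v$, (iii) given $v$ and $i$, obtain the $i$-th neighbor of $v$ (or ''fail'' if $i>\deg(v)$). Complexity is the number of queries. *)

(* Defs.v *)
From Stdlib Require Import Reals Lra Lia List Arith.
Import ListNotations.
Open Scope R_scope.

(* A graph on vertex set {0,...,n-1} is given by adjacency lists [adj v];
   the i-th neighbour of v (1-based) is the i-th element of [adj v]. *)
Definition simple_graph (n : nat) (adj : nat -> list nat) : Prop :=
  (forall v, (n <= v)%nat -> adj v = []) /\
  (forall v u, In u (adj v) -> (u < n)%nat /\ u <> v /\ In v (adj u)) /\
  (forall v, NoDup (adj v)).

Definition deg (adj : nat -> list nat) (v : nat) : nat := length (adj v).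

Definition vsum (n : nat) (f : nat -> nat) : nat :=
  list_sum (map f (seq 0 n)).

Definition vol (n : nat) (adj : nat -> list nat) (S : nat -> bool) : nat :=
  vsum n (fun v => if S v then deg adj v else 0%nat).

(* |E(S,T)| for disjoint S, T : number of edges with one end in S, other in T *)
Definition cut (n : nat) (adj : nat -> list nat) (S T : nat -> bool) : nat :=
  vsum n (fun v => if S v then length (filter T (adj v)) else 0%nat).

Definition card (n : nat) (C : nat -> bool) : nat :=
  vsum n (fun v => if C v then 1%nat else 0%nat).

Definition setminus (C S : nat -> bool) : nat -> bool :=
  fun v => andb (C v) (negb (S v)).

Definition all_vertices : nat -> bool := fun _ => true.

Definition cond_within (n : nat) (adj : nat -> list nat) (C S : nat -> bool) : R :=
  INR (cut n adj S (setminus C S)) / INR (vol n adj S).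

(* "phi^G(C) >= phi", where phi^G(C) is the internal conductance:
   the minimum of phi_C(S) over S ⊆ C with 0 < vol S <= vol C / 2 if |C| > 1,
   and 1 otherwise. *)
Definition internal_conductance_ge (n : nat) (adj : nat -> list nat)
    (C : nat -> bool) (phi : R) : Prop :=
  if Nat.ltb 1 (card n C) then
    forall S : nat -> bool,
      (forall v, (v < n)%nat -> S v = true -> C v = true) ->
      (0 < vol n adj S)%nat ->
      (2 * vol n adj S <= vol n adj C)%nat ->
      phi <= cond_within n adj C S
  else phi <= 1.

Definition clusterable (n : nat) (adj : nat -> list nat) (k : nat) (phi : R) : Prop :=
  exists (h : nat) (P : nat -> nat),
    (h <= k)%nat /\
    (forall v, (v < n)%nat -> (P v < h)%nat) /\
    forall i, (i < h)%nat ->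
      internal_conductance_ge n adj (fun v => Nat.eqb (P v) i) phi.

Definition unclusterable (n : nat) (adj : nat -> list nat) (k : nat) (phi beta : R) : Prop :=
  exists Cs : nat -> nat -> bool,
    (forall i j v, (i < S k)%nat -> (j < S k)%nat -> i <> j -> (v < n)%nat ->
        andb (Cs i v) (Cs j v) = false) /\
    forall i, (i < S k)%nat ->
      INR (vol n adj (Cs i)) >= beta * INR (vol n adj all_vertices) / INR (S k) /\
      cond_within n adj all_vertices (Cs i) <= phi.

(* An algorithm is an adaptive decision tree. Queries: uniformly random vertex,
   degree of v, i-th neighbour of v (None = "fail"). Internal fair coins are free. *)
Inductive Alg : Type :=
| Accept : Alg
| Reject : Alg
| QRand : (nat -> Alg) -> Alg
| QDeg : nat -> (nat -> Alg) -> Alg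
| QNbr : nat -> nat -> (option nat -> Alg) -> Alg
| Coin : (bool -> Alg) -> Alg.

Definition nbr_answer (adj : nat -> list nat) (v i : nat) : option nat :=
  if andb (Nat.leb 1 i) (Nat.leb i (length (adj v)))
  then Some (nth (i - 1) (adj v) 0%nat) else None.

Fixpoint accept_prob (n : nat) (adj : nat -> list nat) (A : Alg) : R :=
  match A with
  | Accept => 1
  | Reject => 0
  | QRand f =>
      fold_right (fun v s => accept_prob n adj (f v) + s) 0 (seq 0 n) / INR n
  | QDeg v f => accept_prob n adj (f (length (adj v)))
  | QNbr v i f => accept_prob n adj (f (nbr_answer adj v i))
  | Coin f => (accept_prob n adj (f true) + accept_prob n adj (f false)) / 2
  end.

Fixpoint queries_le (q : nat) (A : Alg) : Prop :=
  match A with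
  | Accept | Reject => True
  | QRand f => match q with O => False | S q' => forall v, queries_le q' (f v) end
  | QDeg _ f => match q with O => False | S q' => forall d, queries_le q' (f d) end
  | QNbr _ _ f => match q with O => False | S q' => forall o, queries_le q' (f o) end
  | Coin f => queries_le q (f true) /\ queries_le q (f false)
  end.

(* Main.v *)
(* Let P be the lazy random walk operator and G_vw = M <P^t (1_v / d_v), P^t (1_w / d_w)>,
   with M = 2m and <f, g> = sum_v d_v f(v) g(v), the Gram matrix of the distributions of the
   walks of length t ~ log(m) / phi_in^2 started at about m^O(phi_out / phi_in^2) sampled
   vertices.  The tester estimates G by counting collisions between two batches of about
   m^(1/2 + O(phi_out / phi_in^2)) walks from each sample, and rejects when the estimate has a
   large diagonal entry or is large on some (k+1)-dimensional subspace.

   If the graph is (k, phi_in)-clusterable, Cheeger's inequality in every cluster bounds <f, P f> by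
   (1 - phi_in^2 / 4) <f, f> for all f orthogonal to the k cluster indicators.  Every
   (k+1)-dimensional space contains an e such that P^t e is of this kind.  As
   j |-> <e, P^j e> is log-convex, a last ratio at most 1 - phi_in^2 / 4 bounds all the
   earlier ones, so that <e, P^2t e> is tiny; no diagonalization of P is needed.

   If there are k+1 disjoint sparsely connected sets C_i, log-convexity gives in the other
   direction <y, P^2t y> >= (1 - phi_out)^2t <y, y> on the span of their indicators.  The
   functions P^t 1_{C_i} / sqrt(vol C_i) are bounded, hence their inner products are well
   approximated on the sample, and by Cauchy-Schwarz their restrictions to the sample
   span a subspace on which G is large. *)

Require Import Defs.
From Stdlib Require Import Reals Lra Lia Psatz List Arith ClassicalEpsilon Bool
  FunctionalExtensionality.
Import ListNotations.
Local Open Scope bool_scope.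
Open Scope R_scope.

(** * Finite sums *)

(** The query model offers uniform vertices, whereas the analysis wants starting vertices drawn by
    degree. A rejection scheme provides these only up to constant factors, so the proof carries
    two-sided bounds on the sampling probabilities [sigma] and reweights by them, in the analysis
    only. The variance of a collision count is governed by the diagonal entries of G. This is why a
    large diagonal entry is itself a reason to reject, and why clusterable graphs need a bound on
    the volume of the vertices where this entry is large. All probability estimates are
    second-moment bounds, combined as inequalities between expectations. With tau = exp(-4 phi_out
    t), the sample sizes are polynomial in k, 1/beta and 1/tau, and 1/tau is at most 27 m^(16
    phi_out / phi_in^2); this gives the correction to the exponent of m. The factor sqrt(m) is the
    birthday bound for collisions and also the degree cutoff of the vertex sampler. The subspace
    test is decided classically, since only queries are counted, and biased coins are approximated
    by finitely many fair ones. *)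

Definition rsum {A : Type} (l : list A) (f : A -> R) : R :=
  fold_right (fun a s => f a + s) 0 l.

Lemma rsum_cons {A} (a : A) l f : rsum (a :: l) f = f a + rsum l f.
Proof. reflexivity. Qed.

Lemma rsum_nil {A} (f : A -> R) : rsum [] f = 0.
Proof. reflexivity. Qed.

Lemma rsum_ext {A} (l : list A) f g :
  (forall a, In a l -> f a = g a) -> rsum l f = rsum l g.
Proof.
  induction l as [|a l IH]; intros H; [reflexivity|].
  rewrite !rsum_cons, H, IH; auto with datatypes.
Qed.

Lemma rsum_plus {A} (l : list A) f g :
  rsum l (fun a => f a + g a) = rsum l f + rsum l g.
Proof. induction l as [|a l IH]; simpl; [lra|]. unfold rsum in *; simpl; lra. Qed.

Lemma rsum_scal {A} (l : list A) c f :
  rsum l (fun a => c * f a) = c * rsum l f.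
Proof. induction l as [|a l IH]; [unfold rsum; simpl; lra|]. rewrite !rsum_cons, IH; lra. Qed.

Lemma rsum_scal_r {A} (l : list A) c f :
  rsum l (fun a => f a * c) = rsum l f * c.
Proof. induction l as [|a l IH]; [unfold rsum; simpl; lra|]. rewrite !rsum_cons, IH; lra. Qed.

Lemma rsum_minus {A} (l : list A) f g :
  rsum l (fun a => f a - g a) = rsum l f - rsum l g.
Proof. induction l as [|a l IH]; [unfold rsum; simpl; lra|]. rewrite !rsum_cons, IH; lra. Qed.

Lemma rsum_le {A} (l : list A) f g :
  (forall a, In a l -> f a <= g a) -> rsum l f <= rsum l g.
Proof.
  induction l as [|a l IH]; intros H; [unfold rsum; simpl; lra|].
  rewrite !rsum_cons. apply Rplus_le_compat; auto with datatypes.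
Qed.

Lemma rsum_zero {A} (l : list A) f : (forall a, In a l -> f a = 0) -> rsum l f = 0.
Proof.
  induction l as [|a l IH]; intros H; [reflexivity|].
  rewrite rsum_cons, H, IH; auto with datatypes; lra.
Qed.

Lemma rsum_nonneg {A} (l : list A) f : (forall a, In a l -> 0 <= f a) -> 0 <= rsum l f.
Proof.
  intros H. rewrite <- (rsum_zero l (fun _ => 0)) by auto. apply rsum_le; auto.
Qed.

Lemma rsum_const {A} (l : list A) c : rsum l (fun _ => c) = INR (length l) * c.
Proof.
  induction l as [|a l IH]; [unfold rsum; simpl; lra|].
  rewrite rsum_cons, IH. cbn [length]. rewrite S_INR; lra.
Qed.

Lemma rsum_app {A} (l l' : list A) f : rsum (l ++ l') f = rsum l f + rsum l' f.
Proof. induction l as [|a l IH]; [unfold rsum; simpl; lra|]. simpl app. rewrite !rsum_cons, IH; lra. Qed.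

Lemma rsum_map {A B} (h : A -> B) (l : list A) f :
  rsum (map h l) f = rsum l (fun a => f (h a)).
Proof. induction l as [|a l IH]; [reflexivity|]. simpl map. rewrite !rsum_cons, IH; lra. Qed.

Lemma rsum_swap {A B} (l : list A) (l' : list B) F :
  rsum l (fun a => rsum l' (fun b => F a b)) = rsum l' (fun b => rsum l (fun a => F a b)).
Proof.
  induction l as [|a l IH].
  - rewrite rsum_nil, rsum_zero; auto.
  - rewrite rsum_cons, IH, <- rsum_plus. reflexivity.
Qed.

Lemma rsum_ge_term {A} (l : list A) f a :
  (forall b, In b l -> 0 <= f b) -> In a l -> f a <= rsum l f.
Proof.
  induction l as [|b l IH]; intros H Ha; [destruct Ha|].
  rewrite rsum_cons. destruct Ha as [->|Ha].
  - assert (0 <= rsum l f) by (apply rsum_nonneg; auto with datatypes). lra.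
  - assert (f a <= rsum l f) by (apply IH; auto with datatypes).
    assert (0 <= f b) by auto with datatypes. lra.
Qed.

Lemma rsum_eq_zero {A} (l : list A) f a :
  (forall b, In b l -> 0 <= f b) -> rsum l f <= 0 -> In a l -> f a = 0.
Proof.
  intros H H0 Ha. apply Rle_antisym; [|auto].
  eapply Rle_trans; [apply (rsum_ge_term l f a)|]; auto.
Qed.

Lemma rsum_delta {A} (dec : forall x y : A, {x = y} + {x <> y}) (l : list A) x f :
  NoDup l -> In x l -> rsum l (fun a => if dec a x then f a else 0) = f x.
Proof.
  induction l as [|b l IH]; intros Hnd Hin; [destruct Hin|].
  inversion Hnd; subst. rewrite rsum_cons. destruct (dec b x) as [->|Hne].
  - rewrite rsum_zero; [lra|]. intros a Ha. destruct (dec a x) as [->|]; [tauto|reflexivity].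
  - destruct Hin as [->|Hin]; [tauto|]. rewrite IH by auto. lra.
Qed.

Lemma rsum_delta_nat (l : list nat) x f :
  NoDup l -> In x l -> rsum l (fun a => if Nat.eqb a x then f a else 0) = f x.
Proof.
  intros Hnd Hin. rewrite <- (rsum_delta Nat.eq_dec l x f Hnd Hin).
  apply rsum_ext. intros a _. destruct (Nat.eqb_spec a x), (Nat.eq_dec a x); tauto.
Qed.

Lemma rsum_prod {A B} (l : list A) (l' : list B) f g :
  rsum l f * rsum l' g = rsum l (fun a => rsum l' (fun b => f a * g b)).
Proof.
  rewrite <- rsum_scal_r. apply rsum_ext. intros a _. rewrite rsum_scal. reflexivity.
Qed.

Lemma rsum_nth {A} (l : list A) (x0 : A) f :
  rsum l f = rsum (seq 0 (length l)) (fun a => f (nth a l x0)).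
Proof.
  induction l as [|b l IH]; [reflexivity|].
  cbn [length seq]. rewrite !rsum_cons, <- seq_shift, rsum_map, IH. reflexivity.
Qed.

Lemma INR_list_sum (l : list nat) f : INR (list_sum (map f l)) = rsum l (fun v => INR (f v)).
Proof.
  induction l as [|a l IH]; [reflexivity|].
  rewrite rsum_cons, <- IH, <- plus_INR. reflexivity.
Qed.

Lemma INR_length_filter {A} (T : A -> bool) l :
  INR (length (filter T l)) = rsum l (fun u => if T u then 1 else 0).
Proof.
  induction l as [|a l IH]; [reflexivity|].
  rewrite rsum_cons, <- IH. simpl filter. destruct (T a); [|lra].
  cbn [length]. rewrite S_INR; lra.
Qed.

(** * Cauchy-Schwarz and underdetermined linear systems *)

Lemma quadratic_discriminant a b c :
  0 <= a -> 0 <= c -> (forall x, 0 <= a + 2 * b * x + c * (x * x)) -> b * b <= a * c.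
Proof.
  intros Ha Hc H. destruct (Req_dec c 0) as [->|Hc0].
  - destruct (Req_dec b 0) as [->|Hb]; [lra|].
    (* With [c = 0] the form is affine in [x] and takes the value -1 at this point. *)
    specialize (H (- (a + 1) / (2 * b))).
    replace (2 * b * (- (a + 1) / (2 * b))) with (- (a + 1)) in H by (field; lra). lra.
  - specialize (H (- b / c)).
    replace (a + 2 * b * (- b / c) + c * (- b / c * (- b / c))) with ((a * c - b * b) / c) in H
      by (field; lra).
    assert (0 <= (a * c - b * b) / c * c) by (apply Rmult_le_pos; lra).
    replace ((a * c - b * b) / c * c) with (a * c - b * b) in H0 by (field; lra). lra.
Qed.

Lemma rsum_cauchy_schwarz {A} (l : list A) f g :
  rsum l (fun a => f a * g a) * rsum l (fun a => f a * g a)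
  <= rsum l (fun a => f a * f a) * rsum l (fun a => g a * g a).
Proof.
  apply quadratic_discriminant; try (apply rsum_nonneg; intros; apply Rle_0_sqr).
  intros x.
  replace (rsum l (fun a => f a * f a) + 2 * rsum l (fun a => f a * g a) * x
           + rsum l (fun a => g a * g a) * (x * x))
    with (rsum l (fun a => (f a + x * g a) * (f a + x * g a))).
  - apply rsum_nonneg; intros; apply Rle_0_sqr.
  - rewrite (Rmult_comm (2 * _) x), <- Rmult_assoc, (Rmult_comm _ (x * x)), <- !rsum_scal, <- !rsum_plus.
    apply rsum_ext; intros; ring.
Qed.

Lemma rsum_sq_le {A} (l : list A) f :
  rsum l f * rsum l f <= INR (length l) * rsum l (fun a => f a * f a).
Proof.
  pose proof (rsum_cauchy_schwarz l (fun _ => 1) f) as H. simpl in H.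
  rewrite rsum_const in H.
  rewrite (rsum_ext l (fun a => 1 * f a) f) in H by (intros; ring). lra.
Qed.

(** Gaussian elimination: a nonzero pivot in the last column removes the last unknown and one
    equation; if that column vanishes, the last unit vector is a solution. This is the dimension
    count k+1 > k on which the clusterable case rests. *)
Lemma homogeneous_system (k : nat) (c : nat -> nat -> R) :
  exists a : nat -> R, (exists j, (j < S k)%nat /\ a j <> 0) /\
    forall i, (i < k)%nat -> rsum (seq 0 (S k)) (fun j => c i j * a j) = 0.
Proof.
  revert c. induction k as [|k IH]; intros c.
  - exists (fun _ => 1). split; [exists 0%nat; split; [lia|lra]|intros; lia].
  - destruct (classic (exists i, (i < S k)%nat /\ c i (S k) <> 0)) as [[p [Hp Hcp]]|Hno].
    (* Enumerates the [k] equations other than the pivot equation [p]. *)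
    + set (row := fun i => if Nat.ltb i p then i else S i).
      destruct (IH (fun i j => c (row i) j - c (row i) (S k) / c p (S k) * c p j))
        as [a [[j0 [Hj0 Ha0]] Ha]].
      set (b := fun j => if Nat.eqb j (S k)
                 then - rsum (seq 0 (S k)) (fun j => c p j * a j) / c p (S k) else a j).
      assert (Hb : forall i, rsum (seq 0 (S (S k))) (fun j => c i j * b j) =
                rsum (seq 0 (S k)) (fun j => c i j * a j)
                - c i (S k) / c p (S k) * rsum (seq 0 (S k)) (fun j => c p j * a j)).
      { intros i. rewrite seq_S, rsum_app. simpl (0 + S k)%nat.
        rewrite (rsum_ext (seq 0 (S k)) (fun j => c i j * b j) (fun j => c i j * a j)).
        - rewrite rsum_cons, rsum_nil. unfold b. rewrite Nat.eqb_refl. field. exact Hcp.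
        - intros j Hj. apply in_seq in Hj. unfold b.
          replace (Nat.eqb j (S k)) with false; [reflexivity|].
          symmetry; apply Nat.eqb_neq; lia. }
      exists b. split.
      * exists j0. split; [lia|]. unfold b.
        replace (Nat.eqb j0 (S k)) with false; [exact Ha0|].
        symmetry; apply Nat.eqb_neq; lia.
      * intros i Hi. rewrite Hb.
        destruct (Nat.eq_dec i p) as [->|Hip]; [field; exact Hcp|].
        assert (Hrow : exists i', (i' < k)%nat /\ row i' = i).
        { destruct (Nat.lt_ge_cases i p).
          - exists i. split; [lia|]. unfold row.
            destruct (Nat.ltb_spec i p); lia.
          - exists (i - 1)%nat. split; [lia|]. unfold row.
            destruct (Nat.ltb_spec (i - 1) p); lia. }
        destruct Hrow as [i' [Hi' <-]]. specialize (Ha i' Hi').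
        rewrite <- Ha at 1. rewrite <- rsum_scal, <- rsum_minus.
        rewrite (rsum_ext _ _ (fun j => (c (row i') j - c (row i') (S k) / c p (S k) * c p j) * a j))
          by (intros; ring). reflexivity.
    + exists (fun j => if Nat.eqb j (S k) then 1 else 0). split.
      * exists (S k). rewrite Nat.eqb_refl. split; [lia|lra].
      * intros i Hi. apply rsum_zero. intros j Hj.
        destruct (Nat.eqb_spec j (S k)) as [->|]; [|ring].
        destruct (Req_dec (c i (S k)) 0) as [->|Hne]; [ring|].
        exfalso; apply Hno; exists i; auto.
Qed.

(** * Log-convex sequences *)

(** Log-convexity makes the ratios of consecutive terms increase, so the bound on the first ratio
    passes to all later ones. Ratios are kept multiplied out because terms may vanish. *)
Lemma log_convex_ratio_increasing (a : nat -> R) lam :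
  (forall j, 0 <= a j) -> (forall j, a (S j) * a (S j) <= a j * a (S (S j))) ->
  0 <= lam -> lam * a 0%nat <= a 1%nat -> forall j, lam ^ j * a 0%nat <= a j.
Proof.
  intros Hpos Hlc Hlam H0.
  assert (Hstep : forall j, lam * a j <= a (S j)).
  { induction j as [|j IH]; [exact H0|].
    specialize (Hlc j). pose proof (Hpos j). pose proof (Hpos (S j)). pose proof (Hpos (S (S j))).
    destruct (Rle_lt_dec (a j) 0) as [Hz|Hz].
    - assert (a (S j) = 0) by nra. nra.
    - destruct (Rle_lt_dec (a (S j)) 0); [nra|].
      apply Rmult_le_reg_l with (a j); [exact Hz|].
      apply Rle_trans with (a (S j) * a (S j)); [|exact Hlc]. nra. }
  induction j as [|j IH]; simpl; [lra|].
  apply Rle_trans with (lam * a j); [|apply Hstep].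
  rewrite Rmult_assoc. apply Rmult_le_compat_l; auto.
Qed.

(** The same monotonicity read backwards: the ratio at [J] dominates all earlier ratios, by an
    induction that descends from [J]. *)
Lemma log_convex_ratio_bound (a : nat -> R) mu J :
  (forall j, 0 <= a j) -> (forall j, a (S j) * a (S j) <= a j * a (S (S j))) ->
  0 <= mu -> a (S J) <= mu * a J -> a J <= mu ^ J * a 0%nat.
Proof.
  intros Hpos Hlc Hmu HJ.
  assert (Hstep : forall i, (i <= J)%nat -> a (S (J - i)) <= mu * a (J - i)%nat).
  { induction i as [|i IH]; intros Hi; [rewrite Nat.sub_0_r; exact HJ|].
    specialize (IH ltac:(lia)). replace (J - i)%nat with (S (J - S i)) in IH by lia.
    set (j := (J - S i)%nat) in *. specialize (Hlc j).
    pose proof (Hpos j). pose proof (Hpos (S j)).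
    destruct (Rle_lt_dec (a (S j)) 0); [nra|].
    apply Rmult_le_reg_l with (a (S j)); [lra|]. nra. }
  assert (Hall : forall j, (j <= J)%nat -> a j <= mu ^ j * a 0%nat).
  { induction j as [|j IH]; intros Hj; [simpl; lra|].
    specialize (Hstep (J - j)%nat ltac:(lia)). replace (J - (J - j))%nat with j in Hstep by lia.
    specialize (IH ltac:(lia)). simpl. rewrite Rmult_assoc.
    eapply Rle_trans; [exact Hstep|]. apply Rmult_le_compat_l; auto. }
  apply Hall; lia.
Qed.

(** * The lazy random walk operator *)

Section Walk.
Context (n : nat) (adj : nat -> list nat).
Context (Hsg : simple_graph n adj).
Context (Hdeg : forall v, (v < n)%nat -> (1 <= deg adj v)%nat).

Definition rdeg (v : nat) : R := INR (deg adj v).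

Definition deg_ip (f g : nat -> R) : R := rsum (seq 0 n) (fun v => rdeg v * (f v * g v)).

(** Each edge is counted twice, once per orientation. *)
Definition edge_sum (F : nat -> nat -> R) : R :=
  rsum (seq 0 n) (fun v => rsum (adj v) (fun u => F v u)).

(** Acts on functions by averaging, which is the form that is self-adjoint for [deg_ip]. A
    distribution is represented by its density with respect to the degrees. *)
Definition lazy_step (f : nat -> R) (v : nat) : R :=
  (f v + rsum (adj v) f / rdeg v) / 2.

Definition lazy_iter (t : nat) (f : nat -> R) : nat -> R := Nat.iter t lazy_step f.

Lemma rdeg_ge1 v : (v < n)%nat -> 1 <= rdeg v.
Proof. intros Hv. apply (le_INR 1), Hdeg, Hv. Qed.

Lemma adj_lt v u : In u (adj v) -> (u < n)%nat.
Proof. intros H. apply (proj1 (proj2 Hsg)) in H. tauto. Qed.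

Lemma esum_ext F G :
  (forall v u, (v < n)%nat -> In u (adj v) -> F v u = G v u) -> edge_sum F = edge_sum G.
Proof.
  intros H. apply rsum_ext. intros v Hv. apply in_seq in Hv.
  apply rsum_ext. intros u Hu. apply H; auto; lia.
Qed.

Lemma esum_le F G :
  (forall v u, (v < n)%nat -> In u (adj v) -> F v u <= G v u) -> edge_sum F <= edge_sum G.
Proof.
  intros H. apply rsum_le. intros v Hv. apply in_seq in Hv.
  apply rsum_le. intros u Hu. apply H; auto; lia.
Qed.

Lemma esum_nonneg F :
  (forall v u, (v < n)%nat -> In u (adj v) -> 0 <= F v u) -> 0 <= edge_sum F.
Proof.
  intros H. apply rsum_nonneg. intros v Hv. apply in_seq in Hv.
  apply rsum_nonneg. intros u Hu. apply H; auto; lia.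
Qed.

Lemma esum_plus F G : edge_sum (fun v u => F v u + G v u) = edge_sum F + edge_sum G.
Proof.
  unfold edge_sum. rewrite <- rsum_plus. apply rsum_ext. intros v _. apply rsum_plus.
Qed.

Lemma esum_scal c F : edge_sum (fun v u => c * F v u) = c * edge_sum F.
Proof.
  unfold edge_sum. rewrite <- rsum_scal. apply rsum_ext. intros v _. apply rsum_scal.
Qed.

Lemma esum_rsum {A} (l : list A) (F : A -> nat -> nat -> R) :
  edge_sum (fun v u => rsum l (fun a => F a v u)) = rsum l (fun a => edge_sum (F a)).
Proof.
  unfold edge_sum. rewrite (rsum_swap l). apply rsum_ext. intros v _. apply rsum_swap.
Qed.

(** Both sides become sums over all pairs of vertices against the 0/1 adjacency matrix, which is
    symmetric; the absence of repeated neighbours makes this rewriting exact. *)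
Lemma esum_sym F : edge_sum F = edge_sum (fun v u => F u v).
Proof.
  assert (Hrow : forall G v, (v < n)%nat -> rsum (adj v) (fun u => G v u) =
    rsum (seq 0 n) (fun u => if in_dec Nat.eq_dec u (adj v) then G v u else 0)).
  { intros G v Hv.
    rewrite (rsum_ext (seq 0 n) _ (fun u => rsum (adj v)
              (fun w => if Nat.eq_dec w u then G v w else 0))).
    - rewrite rsum_swap. apply rsum_ext. intros w Hw.
      rewrite (rsum_ext _ _ (fun u => if Nat.eq_dec u w then G v w else 0)).
      + symmetry. apply (rsum_delta Nat.eq_dec (seq 0 n) w (fun _ => G v w)); [apply seq_NoDup|].
        apply in_seq. apply adj_lt in Hw. lia.
      + intros u _. destruct (Nat.eq_dec w u), (Nat.eq_dec u w); congruence.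
    - intros u _. destruct (in_dec Nat.eq_dec u (adj v)) as [Hin|Hout].
      + symmetry. apply (rsum_delta Nat.eq_dec (adj v) u (fun w => G v w)); [apply Hsg|exact Hin].
      + symmetry. apply rsum_zero. intros w Hw. destruct (Nat.eq_dec w u); [subst; tauto|reflexivity]. }
  unfold edge_sum.
  rewrite (rsum_ext (seq 0 n) (fun v => rsum (adj v) (fun u => F v u)) _)
    by (intros v Hv; apply in_seq in Hv; apply (Hrow F v); lia).
  rewrite (rsum_ext (seq 0 n) (fun v => rsum (adj v) (fun u => F u v)) _)
    by (intros v Hv; apply in_seq in Hv; apply (Hrow (fun v u => F u v) v); lia).
  rewrite rsum_swap. apply rsum_ext. intros v _. apply rsum_ext. intros u _.
  destruct (in_dec Nat.eq_dec v (adj u)) as [H|H], (in_dec Nat.eq_dec u (adj v)) as [H'|H'];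
    try reflexivity; exfalso; apply H' || apply H; apply (proj1 (proj2 Hsg)); assumption.
Qed.

Lemma esum_left f : edge_sum (fun v _ => f v) = rsum (seq 0 n) (fun v => rdeg v * f v).
Proof. apply rsum_ext. intros v _. rewrite rsum_const. reflexivity. Qed.

Lemma esum_right f : edge_sum (fun _ u => f u) = rsum (seq 0 n) (fun v => rdeg v * f v).
Proof. rewrite esum_sym. apply esum_left. Qed.

(** * The degree inner product and the walk operator *)

Lemma ip_sym f g : deg_ip f g = deg_ip g f.
Proof. apply rsum_ext. intros; ring. Qed.

Lemma ip_ext f f' g g' :
  (forall v, (v < n)%nat -> f v = f' v) -> (forall v, (v < n)%nat -> g v = g' v) ->
  deg_ip f g = deg_ip f' g'.
Proof.
  intros H H'. apply rsum_ext. intros v Hv. apply in_seq in Hv.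
  rewrite H, H' by lia. reflexivity.
Qed.

Lemma ip_nonneg f : 0 <= deg_ip f f.
Proof.
  apply rsum_nonneg. intros v _. apply Rmult_le_pos; [apply pos_INR|apply Rle_0_sqr].
Qed.

Lemma ip_plus_l f g h : deg_ip (fun v => f v + g v) h = deg_ip f h + deg_ip g h.
Proof. unfold deg_ip. rewrite <- rsum_plus. apply rsum_ext; intros; ring. Qed.

Lemma ip_scal_l c f h : deg_ip (fun v => c * f v) h = c * deg_ip f h.
Proof. unfold deg_ip. rewrite <- rsum_scal. apply rsum_ext; intros; ring. Qed.

Lemma ip_scal_r c f h : deg_ip h (fun v => c * f v) = c * deg_ip h f.
Proof. unfold deg_ip. rewrite <- rsum_scal. apply rsum_ext; intros; ring. Qed.

Lemma ip_rsum_l {A} (l : list A) (F : A -> nat -> R) h :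
  deg_ip (fun v => rsum l (fun a => F a v)) h = rsum l (fun a => deg_ip (F a) h).
Proof.
  unfold deg_ip. rewrite rsum_swap. apply rsum_ext. intros v _.
  rewrite rsum_scal, rsum_scal_r. reflexivity.
Qed.

Lemma ip_rsum_r {A} (l : list A) (F : A -> nat -> R) h :
  deg_ip h (fun v => rsum l (fun a => F a v)) = rsum l (fun a => deg_ip h (F a)).
Proof. rewrite ip_sym, ip_rsum_l. apply rsum_ext. intros; apply ip_sym. Qed.

(** Stated for a general positive semidefinite form because log-convexity uses it both for <f, g>
    and for <f, P g>. *)
Lemma form_cauchy_schwarz (B : (nat -> R) -> (nat -> R) -> R) :
  (forall f, 0 <= B f f) -> (forall f g, B f g = B g f) ->
  (forall f g h, B (fun v => f v + g v) h = B f h + B g h) ->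
  (forall c f h, B (fun v => c * f v) h = c * B f h) ->
  forall f g, B f g * B f g <= B f f * B g g.
Proof.
  intros Hpos Hsym Hplus Hscal f g. apply quadratic_discriminant; auto. intros x.
  assert (Heq : B f f + 2 * B f g * x + B g g * (x * x)
          = B (fun v => f v + x * g v) (fun v => f v + x * g v)).
  { set (h := fun v => f v + x * g v). unfold h at 1.
    rewrite Hplus, Hscal, (Hsym f h), (Hsym g h). unfold h.
    rewrite !Hplus, !Hscal, (Hsym g f). ring. }
  rewrite Heq. apply Hpos.
Qed.

Lemma ip_cauchy_schwarz f g : deg_ip f g * deg_ip f g <= deg_ip f f * deg_ip g g.
Proof.
  apply form_cauchy_schwarz; auto using ip_nonneg, ip_sym, ip_plus_l, ip_scal_l.
Qed.

Lemma ip_step f g : deg_ip f (lazy_step g) = (deg_ip f g + edge_sum (fun v u => f v * g u)) / 2.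
Proof.
  unfold Rdiv. rewrite Rmult_plus_distr_r. unfold deg_ip, edge_sum.
  rewrite <- !rsum_scal_r, <- rsum_plus.
  apply rsum_ext. intros v Hv. apply in_seq in Hv.
  assert (1 <= rdeg v) by (apply rdeg_ge1; lia).
  rewrite rsum_scal. unfold lazy_step. field. lra.
Qed.

Lemma ip_step_sym f g : deg_ip f (lazy_step g) = deg_ip (lazy_step f) g.
Proof.
  rewrite (ip_sym (lazy_step f)), !ip_step, (ip_sym g f), (esum_sym (fun v u => g v * f u)).
  rewrite (esum_ext (fun v u => f v * g u) (fun v u => g u * f v)) by (intros; ring).
  reflexivity.
Qed.

Lemma ip_esum f : deg_ip f f = edge_sum (fun v u => (f v * f v + f u * f u) / 2).
Proof.
  rewrite (esum_ext _ (fun v u => / 2 * (f v * f v) + / 2 * (f u * f u))) by (intros; field).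
  rewrite esum_plus, !esum_scal, (esum_left (fun v => f v * f v)), (esum_right (fun v => f v * f v)).
  unfold deg_ip. lra.
Qed.

(** Laziness contributes half of <f, f>, which completes the adjacency term to squares. Hence P is
    positive semidefinite. *)
Lemma ip_step_sum f : deg_ip f (lazy_step f) = / 4 * edge_sum (fun v u => (f v + f u) * (f v + f u)).
Proof.
  rewrite ip_step, ip_esum.
  unfold Rdiv. rewrite Rmult_comm, <- esum_plus, <- !esum_scal.
  apply esum_ext. intros; field.
Qed.

Lemma ip_step_energy f :
  deg_ip f (lazy_step f) = deg_ip f f - / 4 * edge_sum (fun v u => (f v - f u) * (f v - f u)).
Proof.
  rewrite ip_step, ip_esum.
  rewrite (esum_ext (fun v u => (f v - f u) * (f v - f u))
    (fun v u => 2 * ((f v * f v + f u * f u) / 2) + (-2) * (f v * f u))) by (intros; field).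
  rewrite esum_plus, !esum_scal. lra.
Qed.

Lemma ip_step_nonneg f : 0 <= deg_ip f (lazy_step f).
Proof.
  rewrite ip_step_sum. apply Rmult_le_pos; [lra|].
  apply esum_nonneg. intros; apply Rle_0_sqr.
Qed.

Lemma lazy_step_ext f g v :
  (v < n)%nat -> (forall u, (u < n)%nat -> f u = g u) -> lazy_step f v = lazy_step g v.
Proof.
  intros Hv H. unfold lazy_step. rewrite H by auto.
  rewrite (rsum_ext _ f g); [reflexivity|]. intros u Hu. apply H. eapply adj_lt; eauto.
Qed.

Lemma lazy_iter_ext t f g v :
  (v < n)%nat -> (forall u, (u < n)%nat -> f u = g u) -> lazy_iter t f v = lazy_iter t g v.
Proof.
  intros Hv H. revert v Hv. induction t as [|t IH]; intros v Hv; [auto|].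
  apply lazy_step_ext; auto.
Qed.

Lemma lazy_step_plus f g v :
  lazy_step (fun u => f u + g u) v = lazy_step f v + lazy_step g v.
Proof. unfold lazy_step. rewrite rsum_plus. unfold Rdiv. ring. Qed.

Lemma lazy_step_scal c f v : lazy_step (fun u => c * f u) v = c * lazy_step f v.
Proof. unfold lazy_step. rewrite rsum_scal. unfold Rdiv. ring. Qed.

Lemma lazy_iter_rsum {A} t (l : list A) (c : A -> R) (F : A -> nat -> R) v :
  lazy_iter t (fun u => rsum l (fun a => c a * F a u)) v
  = rsum l (fun a => c a * lazy_iter t (F a) v).
Proof.
  revert v. induction t as [|t IH]; intros v; [reflexivity|].
  change (lazy_step (lazy_iter t (fun u => rsum l (fun a => c a * F a u))) v =
          rsum l (fun a => c a * lazy_step (lazy_iter t (F a)) v)).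
  replace (lazy_iter t (fun u => rsum l (fun a => c a * F a u))) with
    (fun v => rsum l (fun a => c a * lazy_iter t (F a) v))
    by (apply functional_extensionality; intros; rewrite IH; reflexivity).
  clear IH. induction l as [|a l IH].
  - unfold lazy_step. rewrite (rsum_zero (adj v)) by reflexivity. rewrite !rsum_nil.
    unfold Rdiv; ring.
  - rewrite rsum_cons, <- IH, <- lazy_step_scal, <- lazy_step_plus. reflexivity.
Qed.

Lemma lazy_step_bound f c : (forall v, (v < n)%nat -> f v <= c) ->
  forall v, (v < n)%nat -> lazy_step f v <= c.
Proof.
  intros H v Hv. unfold lazy_step. pose proof (rdeg_ge1 v Hv).
  assert (rsum (adj v) f <= rdeg v * c).
  { unfold rdeg, deg. rewrite <- rsum_const. apply rsum_le. intros u Hu. apply H. eapply adj_lt; eauto. }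
  assert (rsum (adj v) f / rdeg v <= c).
  { apply Rmult_le_reg_r with (rdeg v); [lra|]. unfold Rdiv.
    rewrite Rmult_assoc, Rinv_l by lra. lra. }
  pose proof (H v Hv). lra.
Qed.

Lemma lazy_iter_le t f c : (forall v, (v < n)%nat -> f v <= c) ->
  forall v, (v < n)%nat -> lazy_iter t f v <= c.
Proof. intros H. induction t; [exact H|]. apply lazy_step_bound, IHt. Qed.

Lemma lazy_step_nonneg f : (forall v, (v < n)%nat -> 0 <= f v) ->
  forall v, (v < n)%nat -> 0 <= lazy_step f v.
Proof.
  intros H v Hv. unfold lazy_step. pose proof (rdeg_ge1 v Hv). pose proof (H v Hv).
  assert (0 <= rsum (adj v) f) by (apply rsum_nonneg; intros u Hu; apply H; eapply adj_lt; eauto).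
  assert (0 <= rsum (adj v) f / rdeg v) by (apply Rle_mult_inv_pos; lra). lra.
Qed.

Lemma lazy_iter_nonneg t f : (forall v, (v < n)%nat -> 0 <= f v) ->
  forall v, (v < n)%nat -> 0 <= lazy_iter t f v.
Proof. intros H. induction t; [exact H|]. apply lazy_step_nonneg, IHt. Qed.

Lemma lazy_iter_one t v : (v < n)%nat -> lazy_iter t (fun _ => 1) v = 1.
Proof.
  revert v. induction t as [|t IH]; intros v Hv; [reflexivity|].
  simpl. change (lazy_step (lazy_iter t (fun _ => 1)) v = 1).
  rewrite (lazy_step_ext _ (fun _ => 1)) by auto.
  unfold lazy_step. rewrite rsum_const. pose proof (rdeg_ge1 v Hv).
  change (INR (length (adj v))) with (rdeg v). field. lra.
Qed.

Lemma lazy_iter_succ_r t f : lazy_iter (S t) f = lazy_iter t (lazy_step f).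
Proof. unfold lazy_iter. apply Nat.iter_succ_r. Qed.

Lemma ip_iter_sym t f g : deg_ip f (lazy_iter t g) = deg_ip (lazy_iter t f) g.
Proof.
  revert f g. induction t as [|t IH]; intros f g; [reflexivity|].
  rewrite lazy_iter_succ_r, IH. apply ip_step_sym.
Qed.

Lemma ip_iter_add i j f g : deg_ip (lazy_iter i f) (lazy_iter j g) = deg_ip f (lazy_iter (i + j) g).
Proof.
  rewrite <- ip_iter_sym. unfold lazy_iter. rewrite Nat.iter_add. reflexivity.
Qed.

(** Moving half of the steps to the left factor leaves <g, g> for even [j] and <g, P g> for odd
    [j]. *)
Lemma ip_iter_nonneg j f : 0 <= deg_ip f (lazy_iter j f).
Proof.
  destruct (Nat.Even_or_Odd j) as [[i ->]|[i ->]].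
  - replace (2 * i)%nat with (i + i)%nat by lia. rewrite <- ip_iter_add. apply ip_nonneg.
  - replace (2 * i + 1)%nat with (i + S i)%nat by lia. rewrite <- ip_iter_add.
    apply ip_step_nonneg.
Qed.

(** Cauchy-Schwarz for P^i f and P^(i+1) f: in the inner product when j = 2i, in the form <f, P g>
    when j = 2i+1. *)
Lemma ip_iter_log_convex f j :
  deg_ip f (lazy_iter (S j) f) * deg_ip f (lazy_iter (S j) f)
  <= deg_ip f (lazy_iter j f) * deg_ip f (lazy_iter (S (S j)) f).
Proof.
  destruct (Nat.Even_or_Odd j) as [[i ->]|[i ->]].
  - replace (2 * i)%nat with (i + i)%nat by lia.
    replace (S (i + i)) with (i + S i)%nat at 1 2 by lia.
    replace (S (S (i + i))) with (S i + S i)%nat by lia. rewrite <- !ip_iter_add.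
    apply ip_cauchy_schwarz.
  - replace (2 * i + 1)%nat with (i + S i)%nat by lia.
    replace (S (i + S i)) with (i + S (S i))%nat at 1 2 by lia.
    replace (S (S (i + S i))) with (S i + S (S i))%nat by lia. rewrite <- !ip_iter_add.
    apply (form_cauchy_schwarz (fun f g => deg_ip f (lazy_step g))).
    + apply ip_step_nonneg.
    + intros f0 g0. rewrite ip_step_sym. apply ip_sym.
    + intros; apply ip_plus_l.
    + intros; apply ip_scal_l.
Qed.

(* [rdeg u * walk_density t v u] is the probability that the walk from [v] ends at [u]. *)
Definition walk_density (t v : nat) : nat -> R :=
  lazy_iter t (fun u => if Nat.eqb u v then / rdeg v else 0).

Lemma ip_delta v h : (v < n)%nat ->
  deg_ip (fun u => if Nat.eqb u v then / rdeg v else 0) h = h v.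
Proof.
  intros Hv. pose proof (rdeg_ge1 v Hv). unfold deg_ip.
  rewrite (rsum_ext _ _ (fun u => if Nat.eqb u v then h v else 0)).
  - rewrite (rsum_delta_nat (seq 0 n) v (fun _ => h v)); auto using seq_NoDup.
    apply in_seq; lia.
  - intros u _. destruct (Nat.eqb_spec u v) as [->|]; [field; lra|ring].
Qed.

(** By self-adjointness, pairing with the density gives the expectation of [h] at the end of the
    walk from [v]. *)
Lemma ip_walk_density t v h : (v < n)%nat -> deg_ip (walk_density t v) h = lazy_iter t h v.
Proof. intros Hv. unfold walk_density. rewrite <- ip_iter_sym. apply ip_delta, Hv. Qed.

Lemma walk_density_nonneg t v u : (v < n)%nat -> (u < n)%nat -> 0 <= walk_density t v u.
Proof.
  intros Hv Hu. apply lazy_iter_nonneg; auto. intros w _. pose proof (rdeg_ge1 v Hv).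
  destruct (Nat.eqb w v); [left; apply Rinv_0_lt_compat|]; lra.
Qed.

End Walk.

(** * Cheeger's inequality inside a cluster *)

Definition Rltb (x y : R) : bool := if Rlt_dec x y then true else false.

Lemma Rltb_true x y : Rltb x y = true <-> x < y.
Proof. unfold Rltb. destruct (Rlt_dec x y); split; congruence || tauto. Qed.

Lemma argmin_exists {A} (l : list A) (P : A -> Prop) (f : A -> R) :
  (exists v, In v l /\ P v) ->
  exists v0, In v0 l /\ P v0 /\ forall v, In v l -> P v -> f v0 <= f v.
Proof.
  induction l as [|b l IH]; intros [v [Hv HP]]; [destruct Hv|].
  destruct (classic (exists v, In v l /\ P v)) as [Hex|Hno].
  - destruct (IH Hex) as [v0 [H1 [H2 H3]]].
    destruct (classic (P b /\ f b <= f v0)) as [[Hb Hle]|Hb].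
    + exists b. split; [left; reflexivity|]. split; [exact Hb|].
      intros w [->|Hw] HPw; [lra|]. specialize (H3 w Hw HPw). lra.
    + exists v0. split; [right; exact H1|]. split; [exact H2|].
      intros w [->|Hw] HPw; [|auto]. apply Rnot_lt_le. intros Hlt. apply Hb. split; [auto|lra].
  - destruct Hv as [->|Hv]; [|exfalso; apply Hno; eauto].
    exists v. split; [left; reflexivity|]. split; [exact HP|].
    intros w [->|Hw] HPw; [lra|]. exfalso; apply Hno; eauto.
Qed.

Lemma list_sum_le (l : list nat) f g :
  (forall v, In v l -> (f v <= g v)%nat) -> (list_sum (map f l) <= list_sum (map g l))%nat.
Proof.
  induction l as [|b l IH]; intros H; simpl; [lia|].
  assert (f b <= g b)%nat by auto with datatypes.
  assert (list_sum (map f l) <= list_sum (map g l))%nat by auto with datatypes. unfold list_sum in *; lia.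
Qed.

Lemma list_sum_lt (l : list nat) f g w :
  (forall v, In v l -> (f v <= g v)%nat) -> In w l -> (f w < g w)%nat ->
  (list_sum (map f l) < list_sum (map g l))%nat.
Proof.
  induction l as [|b l IH]; intros H Hw Hlt; simpl; [destruct Hw|].
  assert (f b <= g b)%nat by auto with datatypes.
  assert (list_sum (map f l) <= list_sum (map g l))%nat by (apply list_sum_le; auto with datatypes).
  destruct Hw as [->|Hw]; [unfold list_sum in *; lia|].
  assert (list_sum (map f l) < list_sum (map g l))%nat by (apply IH; auto with datatypes).
  unfold list_sum in *; lia.
Qed.

Section Cheeger.
Context (n : nat) (adj : nat -> list nat).
Context (Hsg : simple_graph n adj).
Context (Hdeg : forall v, (v < n)%nat -> (1 <= deg adj v)%nat).
Local Notation d := (rdeg adj).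
Local Notation V := (seq 0 n).
Local Notation esum := (edge_sum n adj).

Lemma INR_vol S : INR (vol n adj S) = rsum V (fun v => if S v then d v else 0).
Proof.
  unfold vol, vsum. rewrite INR_list_sum. apply rsum_ext. intros v _.
  destruct (S v); reflexivity.
Qed.

Lemma INR_cut S T : INR (cut n adj S T) = esum (fun v u => if S v && T u then 1 else 0).
Proof.
  unfold cut, vsum. rewrite INR_list_sum. apply rsum_ext. intros v _.
  destruct (S v); simpl.
  - apply INR_length_filter.
  - symmetry. apply rsum_zero. reflexivity.
Qed.

Lemma INR_card C : INR (card n C) = rsum V (fun v => if C v then 1 else 0).
Proof.
  unfold card, vsum. rewrite INR_list_sum. apply rsum_ext. intros v _. destruct (C v); reflexivity.
Qed.

Lemma vol_le S T : (forall v, (v < n)%nat -> S v = true -> T v = true) ->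
  (vol n adj S <= vol n adj T)%nat.
Proof.
  intros H. apply list_sum_le. intros v Hv. apply in_seq in Hv. specialize (H v ltac:(lia)).
  destruct (S v); [rewrite H by reflexivity; lia|lia].
Qed.

Context (C : nat -> bool) (phi : R) (Hphi : 0 < phi).

Definition inside (F : nat -> nat -> R) (v u : nat) : R := if C v && C u then F v u else 0.

(** Layer-cake induction on the size of the support of [H]. Subtracting the smallest positive value
    [mu] splits off [mu] times the indicator of the support [S], to which the conductance bound
    applies, and leaves a function with a strictly smaller support. *)
Lemma coarea :
  (forall S, (forall v, (v < n)%nat -> S v = true -> C v = true) ->
     (0 < vol n adj S)%nat -> (2 * vol n adj S <= vol n adj C)%nat ->
     phi <= cond_within n adj C S) ->
  forall H : nat -> R, (forall v, 0 <= H v) -> (forall v, 0 < H v -> C v = true) ->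
  (2 * vol n adj (fun v => Rltb 0 (H v)) <= vol n adj C)%nat ->
  phi * rsum V (fun v => d v * H v) <= esum (inside (fun v u => Rmax 0 (H v - H u))).
Proof.
  intros Hcond.
  enough (Hind : forall N H, (card n (fun v => Rltb 0 (H v)) < N)%nat ->
    (forall v, 0 <= H v) -> (forall v, 0 < H v -> C v = true) ->
    (2 * vol n adj (fun v => Rltb 0 (H v)) <= vol n adj C)%nat ->
    phi * rsum V (fun v => d v * H v) <= esum (inside (fun v u => Rmax 0 (H v - H u))))
    by (intros H; apply (Hind (Datatypes.S (card n (fun v => Rltb 0 (H v))))); lia).
  induction N as [|N IH]; intros H HN Hpos HC Hvol; [lia|].
  destruct (classic (exists v, In v V /\ 0 < H v)) as [Hex|Hno].
  2: { rewrite rsum_zero.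
       - rewrite Rmult_0_r. apply esum_nonneg. intros v u _ _. unfold inside.
         destruct (C v && C u); [apply Rmax_l|lra].
       - intros v Hv. replace (H v) with 0; [ring|]. apply Rle_antisym; [auto|].
         apply Rnot_lt_le. intros Hlt. apply Hno; eauto. }
  destruct (argmin_exists V (fun v => 0 < H v) H Hex) as [v0 [Hv0 [Hmu Hmin]]].
  set (mu := H v0) in *.
  set (H' := fun v => Rmax 0 (H v - mu)).
  set (S := fun v => Rltb 0 (H v)).
  assert (HS : forall v, (v < n)%nat -> if S v then mu <= H v else H v = 0).
  { intros v Hv. unfold S. destruct (Rltb 0 (H v)) eqn:E.
    - apply Rltb_true in E. apply Hmin; auto. apply in_seq; lia.
    - apply Rle_antisym; [|auto]. apply Rnot_lt_le. intros Hlt. apply Rltb_true in Hlt. congruence. }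
  assert (HH' : forall v, (v < n)%nat -> H v = (if S v then mu else 0) + H' v).
  { intros v Hv. specialize (HS v Hv). unfold H'. destruct (S v).
    - rewrite Rmax_right; lra.
    - rewrite Rmax_left; lra. }
  assert (Hsub : forall v, Rltb 0 (H' v) = true -> Rltb 0 (H v) = true).
  { intros v Hv. apply Rltb_true in Hv. apply Rltb_true. unfold H' in Hv.
    destruct (Rle_lt_dec (H v - mu) 0); [rewrite Rmax_left in Hv; lra|lra]. }
  assert (HIH : phi * rsum V (fun v => d v * H' v) <= esum (inside (fun v u => Rmax 0 (H' v - H' u)))).
  { apply IH.
    - apply Nat.lt_le_trans with (card n (fun v => Rltb 0 (H v))); [|lia].
      apply (list_sum_lt V _ _ v0); auto.
      + intros v _. destruct (Rltb 0 (H' v)) eqn:E; [rewrite Hsub by exact E|]; lia.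
      + replace (Rltb 0 (H' v0)) with false.
        * assert (E : Rltb 0 (H v0) = true) by (apply Rltb_true; exact Hmu). rewrite E. lia.
        * symmetry. apply Bool.not_true_iff_false. rewrite Rltb_true. unfold H'.
          rewrite Rmax_left; unfold mu; lra.
    - intros v. apply Rmax_l.
    - intros v Hv. apply HC. apply Rltb_true, Hsub, Rltb_true, Hv.
    - eapply Nat.le_trans; [|exact Hvol].
      apply Nat.mul_le_mono_l, vol_le. auto. }
  assert (HSvol : phi * INR (vol n adj S) <= INR (cut n adj S (setminus C S))).
  { destruct (Nat.eq_dec (vol n adj S) 0) as [E|E].
    - rewrite E, Rmult_0_r. apply pos_INR.
    - assert (0 < INR (vol n adj S)) by (apply lt_0_INR; lia).
      apply Rmult_le_reg_r with (/ INR (vol n adj S)); [apply Rinv_0_lt_compat; auto|].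
      rewrite Rmult_assoc, Rinv_r, Rmult_1_r by lra.
      apply Hcond; [|lia|exact Hvol].
      intros v _ Hv. apply HC, Rltb_true, Hv. }
  rewrite INR_vol, INR_cut in HSvol.
  assert (Hlhs : rsum V (fun v => d v * H v)
      = mu * rsum V (fun v => if S v then d v else 0) + rsum V (fun v => d v * H' v)).
  { rewrite <- rsum_scal, <- rsum_plus. apply rsum_ext. intros v Hv. apply in_seq in Hv.
    rewrite (HH' v) by lia. destruct (S v); ring. }
  (* Edge by edge: the positive difference loses exactly [mu] on edges from [S] to its complement in
     [C] and is unchanged on the other edges inside [C]. *)
  assert (Hrhs : mu * esum (fun v u => if S v && setminus C S u then 1 else 0)
      + esum (inside (fun v u => Rmax 0 (H' v - H' u)))
      <= esum (inside (fun v u => Rmax 0 (H v - H u)))).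
  { rewrite <- esum_scal, <- esum_plus. apply esum_le. intros v u Hv Hu.
    apply (adj_lt n adj Hsg) in Hu. unfold inside, setminus.
    assert (HSv : S v = true -> C v = true) by (intros E; apply HC, Rltb_true, E).
    pose proof (HS v Hv) as Hv'. pose proof (HS u Hu) as Hu'.
    pose proof (HH' v Hv) as Hv2. pose proof (HH' u Hu) as Hu2.
    assert (0 <= H' u) by apply Rmax_l. assert (0 <= H' v) by apply Rmax_l.
    destruct (S v).
    - rewrite (HSv eq_refl). destruct (C u), (S u); simpl; try lra.
      + rewrite Rmult_0_r, Rplus_0_l. right. f_equal. lra.
      + rewrite Rmult_1_r, !Rmax_right; lra.
    - simpl. rewrite Rmult_0_r, Rplus_0_l. destruct (C v && C u); [|lra].
      replace (H' v) with 0 by lra. rewrite (Rmax_left 0 (0 - H' u)) by lra. apply Rmax_l. }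
  rewrite Hlhs, Rmult_plus_distr_l.
  apply Rle_trans with (2 := Hrhs). apply Rplus_le_compat; [|exact HIH].
  rewrite <- Rmult_assoc, (Rmult_comm phi), Rmult_assoc.
  apply Rmult_le_compat_l; [lra|exact HSvol].
Qed.

(** Write X, D, E for the weighted square norm of [h], the sum of positive differences of h^2, and
    the energy of [h]. The coarea bound gives phi X <= D, and AM-GM with weight [phi] gives 2 D <= E
    / phi + phi X; the last term is absorbed, so phi^2 X <= E. *)
Lemma cheeger_small_support h :
  (forall S, (forall v, (v < n)%nat -> S v = true -> C v = true) ->
     (0 < vol n adj S)%nat -> (2 * vol n adj S <= vol n adj C)%nat ->
     phi <= cond_within n adj C S) ->
  (forall v, 0 <= h v) -> (forall v, 0 < h v -> C v = true) ->
  (2 * vol n adj (fun v => Rltb 0 (h v)) <= vol n adj C)%nat ->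
  phi * phi * rsum V (fun v => d v * (h v * h v))
  <= esum (inside (fun v u => (h v - h u) * (h v - h u))).
Proof.
  intros Hcond Hpos HC Hvol.
  assert (Hsq : forall v, 0 < h v * h v <-> 0 < h v).
  { intros v. specialize (Hpos v). split; intros; [|nra]. destruct (Req_dec (h v) 0) as [E|]; [|lra].
    rewrite E in *. lra. }
  assert (Hco := coarea Hcond (fun v => h v * h v)). cbv beta in Hco.
  specialize (Hco ltac:(intros; apply Rle_0_sqr) ltac:(intros v Hv; apply HC, Hsq, Hv)).
  assert (Hvol' : (2 * vol n adj (fun v => Rltb 0 (h v * h v)) <= vol n adj C)%nat).
  { eapply Nat.le_trans; [|exact Hvol]. apply Nat.mul_le_mono_l, vol_le.
    intros v _. rewrite !Rltb_true. apply Hsq. }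
  specialize (Hco Hvol').
  set (X := rsum V (fun v => d v * (h v * h v))) in *.
  set (D := esum (inside (fun v u => Rmax 0 (h v * h v - h u * h u)))) in *.
  set (E := esum (inside (fun v u => (h v - h u) * (h v - h u)))).
  (* AM-GM: |h_v^2 - h_u^2| <= (h_v - h_u)^2 / phi + phi (h_v + h_u)^2 / 4 *)
  assert (HD : 2 * D <= / phi * E + phi * X).
  (* Reversing orientations, D + D becomes the sum of |h_v^2 - h_u^2|. *)
  { assert (HD2 : D = esum (inside (fun v u => Rmax 0 (h u * h u - h v * h v)))).
    { unfold D. rewrite esum_sym by auto. apply esum_ext. intros v u _ _.
      unfold inside. rewrite Bool.andb_comm. reflexivity. }
    replace (2 * D) with (D + D) by ring. rewrite HD2 at 2.
    assert (HX : X = / 4 * esum (fun v u => 2 * (h v * h v) + 2 * (h u * h u))).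
    { rewrite esum_plus, !esum_scal, (esum_left n adj (fun v => h v * h v)),
        (esum_right n adj Hsg (fun v => h v * h v)).
      fold X. field. }
    rewrite HX. unfold D, E. rewrite <- !esum_scal, <- !esum_plus.
    apply esum_le. intros v u _ _. unfold inside. destruct (C v && C u).
    - set (a := h v) in *. set (b := h u) in *.
      assert (0 <= a) by apply Hpos. assert (0 <= b) by apply Hpos.
      assert (Hk : forall y, 0 <= y -> y * (a + b) <= / phi * (y * y) + phi * (/ 4 * (2 * (a * a) + 2 * (b * b)))).
      { intros y Hy. apply Rmult_le_reg_l with phi; [exact Hphi|].
        replace (phi * (/ phi * (y * y) + phi * (/ 4 * (2 * (a * a) + 2 * (b * b)))))
          with (y * y + phi * phi * (a * a + b * b) / 2) by (field; lra).
        assert (0 <= (y - phi * (a + b) / 2) * (y - phi * (a + b) / 2)) by apply Rle_0_sqr.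
        assert (0 <= phi * phi * ((a - b) * (a - b)))
          by (apply Rmult_le_pos; apply Rle_0_sqr). nra. }
      destruct (Rle_lt_dec b a).
      + rewrite Rmax_right, Rmax_left by nra. specialize (Hk (a - b) ltac:(lra)). lra.
      + rewrite Rmax_left, Rmax_right by nra. specialize (Hk (b - a) ltac:(lra)). lra.
    - assert (0 <= h v * h v) by apply Rle_0_sqr. assert (0 <= h u * h u) by apply Rle_0_sqr.
      assert (0 <= phi * (/ 4 * (2 * (h v * h v) + 2 * (h u * h u)))).
      { apply Rmult_le_pos; lra. } lra. }
  apply Rmult_le_reg_l with (/ phi); [apply Rinv_0_lt_compat; exact Hphi|].
  replace (/ phi * (phi * phi * X)) with (phi * X) by (field; lra). lra.
Qed.

(** A weighted median of [f] on [C]: the least value with at most half of the volume strictly above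
    it. The largest value qualifies, so a least one exists. *)
Lemma median_exists (f : nat -> R) : (exists v, (v < n)%nat /\ C v = true) ->
  exists c, (2 * vol n adj (fun v => C v && Rltb c (f v)) <= vol n adj C)%nat /\
    (2 * vol n adj (fun v => C v && Rltb (f v) c) <= vol n adj C)%nat.
Proof.
  intros [v1 [Hv1 HC1]].
  assert (Hvempty : forall S, (forall v, (v < n)%nat -> S v = true -> False) -> vol n adj S = 0%nat).
  { intros S HS. apply INR_eq. rewrite INR_vol. simpl. apply rsum_zero. intros v Hv.
    apply in_seq in Hv. destruct (S v) eqn:E; [|reflexivity]. exfalso; apply (HS v); [lia|exact E]. }
  set (gt := fun c => vol n adj (fun v => C v && Rltb c (f v))).
  destruct (argmin_exists V (fun w => C w = true /\ (2 * gt (f w) <= vol n adj C)%nat) f)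
    as [w [Hw [[HCw Hgt] Hmin]]].
  { destruct (argmin_exists V (fun w => C w = true) (fun w => - f w)) as [w [Hw [HCw Hmax]]].
    - exists v1. split; [apply in_seq; lia|exact HC1].
    - exists w. split; [exact Hw|]. split; [exact HCw|].
      unfold gt. rewrite Hvempty; [lia|]. intros v Hv Hc. apply andb_prop in Hc.
      destruct Hc as [Hc Hl]. apply Rltb_true in Hl.
      assert (In v V) by (apply in_seq; lia). specialize (Hmax v H Hc). lra. }
  exists (f w). split; [exact Hgt|].
  destruct (classic (exists v, In v V /\ (C v = true /\ f v < f w))) as [Hex|Hno].
  (* Let [f w'] be the next smaller value. By minimality more than half of the volume lies strictly
     above it, and that set is disjoint from the set strictly below [f w]. *)
  - destruct (argmin_exists V (fun v => C v = true /\ f v < f w) (fun v => - f v) Hex)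
      as [w' [Hw' [[HCw' Hlt] Hmax]]].
    assert (Hbig : ~ (2 * gt (f w') <= vol n adj C)%nat).
    { intros Hle. specialize (Hmin w' Hw' (conj HCw' Hle)). lra. }
    assert (Hsum : (gt (f w') + vol n adj (fun v => C v && Rltb (f v) (f w)) <= vol n adj C)%nat).
    { apply INR_le. rewrite plus_INR. unfold gt. rewrite !INR_vol, <- rsum_plus.
      apply rsum_le. intros v Hv. specialize (Hmax v Hv).
      assert (0 <= d v) by apply pos_INR.
      destruct (C v); simpl; [|lra].
      destruct (Rltb (f w') (f v)) eqn:E1, (Rltb (f v) (f w)) eqn:E2; try lra.
      apply Rltb_true in E1. apply Rltb_true in E2. specialize (Hmax (conj eq_refl E2)). lra. }
    lia.
  - rewrite Hvempty; [lia|]. intros v Hv Hc. apply andb_prop in Hc. destruct Hc as [Hc Hl].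
    apply Rltb_true in Hl. apply Hno. exists v. split; [apply in_seq; lia|auto].
Qed.

Lemma card_ge2 v w : (v < n)%nat -> (w < n)%nat -> v <> w -> C v = true -> C w = true ->
  (2 <= card n C)%nat.
Proof.
  intros Hv Hw Hne HCv HCw. apply INR_le. rewrite INR_card.
  apply Rle_trans with (rsum V (fun u => if Nat.eqb u v then 1 else 0)
                        + rsum V (fun u => if Nat.eqb u w then 1 else 0)).
  - rewrite !(rsum_delta_nat V _ (fun _ => 1)) by (apply seq_NoDup || (apply in_seq; lia)). simpl; lra.
  - rewrite <- rsum_plus. apply rsum_le. intros u _.
    destruct (Nat.eqb_spec u v) as [E1|], (Nat.eqb_spec u w) as [E2|];
      [congruence|rewrite E1, HCv; lra|rewrite E2, HCw; lra|destruct (C u); lra].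
Qed.

(** Shift [f] by a median rather than its mean, so that the positive and the negative part are each
    supported on at most half of the volume, and apply the previous bound to both. *)
Lemma cheeger (f : nat -> R) :
  internal_conductance_ge n adj C phi ->
  rsum V (fun v => if C v then d v * f v else 0) = 0 ->
  phi * phi * rsum V (fun v => if C v then d v * (f v * f v) else 0)
  <= esum (inside (fun v u => (f v - f u) * (f v - f u))).
Proof.
  intros Hcond Hmean. unfold internal_conductance_ge in Hcond.
  assert (Hnn : 0 <= esum (inside (fun v u => (f v - f u) * (f v - f u)))).
  { apply esum_nonneg. intros v u _ _. unfold inside.
    destruct (C v && C u); [apply Rle_0_sqr|lra]. }
  destruct (Nat.ltb_spec 1 (card n C)) as [Hcard|Hcard].
  - destruct (classic (exists v, (v < n)%nat /\ C v = true)) as [Hex|Hno].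
    2: { rewrite rsum_zero; [lra|]. intros v Hv. apply in_seq in Hv.
         destruct (C v) eqn:E; [|reflexivity]. exfalso; apply Hno; exists v; split; [lia|auto]. }
    destruct (median_exists f Hex) as [c [Hc1 Hc2]].
    set (h1 := fun v => if C v then Rmax 0 (f v - c) else 0).
    set (h2 := fun v => if C v then Rmax 0 (c - f v) else 0).
    assert (H1 := cheeger_small_support h1 Hcond).
    assert (H2 := cheeger_small_support h2 Hcond).
    assert (Hh : forall (g : nat -> R), let h := fun v => if C v then Rmax 0 (g v) else 0 in
      (forall v, 0 <= h v) /\ (forall v, 0 < h v -> C v = true /\ 0 < g v)).
    { intros g h. split; intros v; unfold h; destruct (C v); try lra.
      - apply Rmax_l.
      - intros H. split; [reflexivity|]. destruct (Rle_lt_dec (g v) 0); [rewrite Rmax_left in H; lra|auto]. }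
    destruct (Hh (fun v => f v - c)) as [P1 Q1]. destruct (Hh (fun v => c - f v)) as [P2 Q2].
    specialize (H1 P1 (fun v Hv => proj1 (Q1 v Hv))).
    specialize (H2 P2 (fun v Hv => proj1 (Q2 v Hv))).
    specialize (H1 ltac:(eapply Nat.le_trans; [apply Nat.mul_le_mono_l, vol_le|exact Hc1];
      intros v _ Hv; apply Rltb_true, Q1 in Hv; apply andb_true_intro; split; [tauto|];
      apply Rltb_true; lra)).
    specialize (H2 ltac:(eapply Nat.le_trans; [apply Nat.mul_le_mono_l, vol_le|exact Hc2];
      intros v _ Hv; apply Rltb_true, Q2 in Hv; apply andb_true_intro; split; [tauto|];
      apply Rltb_true; lra)).
    apply Rle_trans with (phi * phi * (rsum V (fun v => d v * (h1 v * h1 v))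
                            + rsum V (fun v => d v * (h2 v * h2 v)))).
    + apply Rmult_le_compat_l; [apply Rle_0_sqr|].
      rewrite <- rsum_plus.
      (* This is the weighted square norm of f - c expanded; as [f] has mean zero, the shift can
         only increase the norm. *)
      apply Rle_trans with (rsum V (fun v => if C v then d v * (f v * f v) else 0)
        - 2 * c * rsum V (fun v => if C v then d v * f v else 0)
        + c * c * rsum V (fun v => if C v then d v else 0)).
      * rewrite Hmean.
        assert (0 <= c * c * rsum V (fun v => if C v then d v else 0)).
        { apply Rmult_le_pos; [apply Rle_0_sqr|]. rewrite <- INR_vol. apply pos_INR. } lra.
      * rewrite <- !rsum_scal, <- rsum_minus, <- rsum_plus. right. apply rsum_ext.
        intros v _. unfold h1, h2. destruct (C v); [|ring].
        destruct (Rle_lt_dec c (f v)).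
        -- rewrite (Rmax_right 0 (f v - c)), (Rmax_left 0 (c - f v)) by lra. ring.
        -- rewrite (Rmax_left 0 (f v - c)), (Rmax_right 0 (c - f v)) by lra. ring.
    + rewrite Rmult_plus_distr_l. eapply Rle_trans; [apply Rplus_le_compat; [exact H1|exact H2]|].
      rewrite <- esum_plus. apply esum_le. intros v u _ _. unfold inside, h1, h2.
      destruct (C v), (C u); simpl; try lra.
      set (a := f v). set (b := f u).
      (* When [a] and [b] lie on opposite sides of [c], the claim is (a - c)^2 + (b - c)^2 <= (a -
         b)^2. *)
      destruct (Rle_lt_dec c a), (Rle_lt_dec c b).
      * rewrite !(Rmax_right 0 (_ - c)), !(Rmax_left 0 (c - _)) by lra. nra.
      * rewrite (Rmax_right 0 (a - c)), (Rmax_left 0 (b - c)), (Rmax_left 0 (c - a)),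
          (Rmax_right 0 (c - b)) by lra. nra.
      * rewrite (Rmax_left 0 (a - c)), (Rmax_right 0 (b - c)), (Rmax_right 0 (c - a)),
          (Rmax_left 0 (c - b)) by lra. nra.
      * rewrite !(Rmax_left 0 (_ - c)), !(Rmax_right 0 (c - _)) by lra. nra.
  (* In a cluster of at most one vertex, mean zero already forces d_v f(v) = 0. *)
  - rewrite rsum_zero; [lra|]. intros v Hv. apply in_seq in Hv.
    destruct (C v) eqn:E; [|reflexivity].
    assert (Hz : d v * f v = 0).
    { rewrite <- Hmean.
      rewrite (rsum_ext _ _ (fun u => if Nat.eqb u v then d v * f v else 0)).
      - symmetry. apply (rsum_delta_nat V v (fun _ => d v * f v)); [apply seq_NoDup|apply in_seq; lia].
      - intros u Hu. apply in_seq in Hu. destruct (Nat.eqb_spec u v) as [->|Hne]; [rewrite E; reflexivity|].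
        destruct (C u) eqn:E'; [|reflexivity].
        pose proof (card_ge2 u v ltac:(lia) ltac:(lia) Hne E' E). lia. }
    rewrite <- Rmult_assoc, Hz. ring.
Qed.

End Cheeger.

(** * Gram matrices of walk distributions *)

Definition sqn (L : nat) (x : nat -> R) : R := rsum (seq 0 L) (fun a => x a * x a).

Definition qform (G : nat -> nat -> R) (L : nat) (x : nat -> R) : R :=
  rsum (seq 0 L) (fun a => rsum (seq 0 L) (fun b => x a * x b * G a b)).

Definition lincomb (k : nat) (X : nat -> nat -> R) (c : nat -> R) (a : nat) : R :=
  rsum (seq 0 (S k)) (fun i => c i * X i a).

(** The square of the Frobenius norm. *)
Definition frob (G : nat -> nat -> R) (L : nat) : R :=
  rsum (seq 0 L) (fun a => rsum (seq 0 L) (fun b => G a b * G a b)).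

Lemma sqn_nonneg L x : 0 <= sqn L x.
Proof. apply rsum_nonneg. intros; apply Rle_0_sqr. Qed.

Lemma sqn_pos L x : (exists j, (j < L)%nat /\ x j <> 0) -> 0 < sqn L x.
Proof.
  intros [j [Hj Hx]]. apply Rlt_le_trans with (x j * x j); [nra|].
  apply (rsum_ge_term (seq 0 L) (fun a => x a * x a)); [intros; apply Rle_0_sqr|apply in_seq; lia].
Qed.

Lemma sq_le_bound a b : 0 <= b -> a * a <= b * b -> - b <= a <= b.
Proof. intros Hb H. split; nra. Qed.

(** The Frobenius norm dominates the operator norm, by two uses of Cauchy-Schwarz. Entrywise second
    moments of an estimate thus control its quadratic form in all directions at once. *)
Lemma qform_bound D L eps x : 0 <= eps -> frob D L <= eps * eps ->
  - (eps * sqn L x) <= qform D L x <= eps * sqn L x.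
Proof.
  intros Heps HD. pose proof (sqn_nonneg L x) as Hs.
  apply sq_le_bound; [apply Rmult_le_pos; auto|].
  assert (Hq : qform D L x = rsum (seq 0 L) (fun a => x a * rsum (seq 0 L) (fun b => x b * D a b))).
  { apply rsum_ext. intros a _. rewrite <- rsum_scal. apply rsum_ext. intros; ring. }
  rewrite Hq.
  eapply Rle_trans; [apply rsum_cauchy_schwarz|].
  fold (sqn L x). replace (eps * sqn L x * (eps * sqn L x)) with (sqn L x * (eps * eps * sqn L x)) by ring.
  apply Rmult_le_compat_l; [exact Hs|].
  apply Rle_trans with (frob D L * sqn L x); [|apply Rmult_le_compat_r; auto].
  unfold frob. rewrite <- rsum_scal_r. apply rsum_le. intros a _.
  rewrite (Rmult_comm (rsum _ (fun b => D a b * D a b))). apply (rsum_cauchy_schwarz (seq 0 L) x (D a)).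
Qed.

Lemma qform_minus G H L x :
  qform (fun a b => G a b - H a b) L x = qform G L x - qform H L x.
Proof.
  unfold qform. rewrite <- rsum_minus. apply rsum_ext. intros a _.
  rewrite <- rsum_minus. apply rsum_ext. intros; ring.
Qed.

Lemma seq_disjoint_classes (K : nat) (p : nat -> bool) :
  (forall i j, (i < K)%nat -> (j < K)%nat -> i <> j -> p i && p j = false) ->
  (forall i, (i < K)%nat -> p i = false) \/
  exists i0, (i0 < K)%nat /\ forall i, (i < K)%nat -> p i = Nat.eqb i i0.
Proof.
  intros H. destruct (classic (exists i, (i < K)%nat /\ p i = true)) as [[i0 [Hi Hp]]|Hno].
  - right. exists i0. split; [exact Hi|]. intros i Hik. destruct (Nat.eqb_spec i i0) as [->|Hne]; [exact Hp|].
    specialize (H i i0 Hik Hi Hne). rewrite Hp, andb_true_r in H. exact H.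
  - left. intros i Hi. destruct (p i) eqn:E; [|reflexivity]. exfalso; apply Hno; eauto.
Qed.

Section Spectral.
Context (n : nat) (adj : nat -> list nat).
Context (Hsg : simple_graph n adj).
Context (Hdeg : forall v, (v < n)%nat -> (1 <= deg adj v)%nat).
Local Notation d := (rdeg adj).
Local Notation V := (seq 0 n).
Local Notation esum := (edge_sum n adj).
Local Notation ip := (deg_ip n adj).
Local Notation step := (lazy_step adj).
Local Notation iter := (lazy_iter adj).
Local Notation dens := (walk_density adj).

Definition tvol : R := rsum (seq 0 n) (rdeg adj).

Definition gram (t v w : nat) : R := tvol * ip (dens t v) (dens t w).

Definition sgram (t : nat) (vs : list nat) (a b : nat) : R :=
  gram t (nth a vs 0%nat) (nth b vs 0%nat).

Lemma tvol_nonneg : 0 <= tvol.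
Proof. apply rsum_nonneg. intros; apply pos_INR. Qed.

Lemma gram_nonneg t v w : (v < n)%nat -> (w < n)%nat -> 0 <= gram t v w.
Proof.
  intros Hv Hw. apply Rmult_le_pos; [apply tvol_nonneg|]. apply rsum_nonneg.
  intros u Hu. apply in_seq in Hu.
  apply Rmult_le_pos; [apply pos_INR|].
  apply Rmult_le_pos; apply (walk_density_nonneg n adj Hsg Hdeg); lia.
Qed.

(** The sum is a pairing with the constant function 1, which the walk preserves. In the degree
    measure every row of the Gram matrix thus has average 1. *)
Lemma gram_sum t v : (v < n)%nat -> rsum V (fun w => d w * gram t v w) = tvol.
Proof.
  intros Hv. unfold gram.
  rewrite (rsum_ext _ _ (fun w => tvol * (d w * (iter t (dens t v) w * 1)))).
  - rewrite rsum_scal. change (tvol * ip (iter t (dens t v)) (fun _ => 1) = tvol).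
    rewrite <- (ip_iter_sym n adj Hsg Hdeg), (ip_walk_density n adj Hsg Hdeg) by auto.
    rewrite (lazy_iter_ext n adj Hsg t _ (fun _ => 1))
      by (auto; intros; apply (lazy_iter_one n adj Hsg Hdeg); auto).
    rewrite (lazy_iter_one n adj Hsg Hdeg) by auto. ring.
  - intros w Hw. apply in_seq in Hw.
    rewrite ip_sym, (ip_walk_density n adj Hsg Hdeg) by lia. ring.
Qed.

Lemma qform_sgram t vs x :
  let h := fun u => rsum (seq 0 (length vs)) (fun a => x a * dens t (nth a vs 0%nat) u) in
  qform (sgram t vs) (length vs) x = tvol * ip h h.
Proof.
  intros h. unfold h at 1. rewrite (ip_rsum_l n adj (seq 0 (length vs)) (fun a u => x a * dens t (nth a vs 0%nat) u)).
  rewrite <- rsum_scal. apply rsum_ext. intros a _.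
  rewrite ip_scal_l. unfold h. rewrite ip_rsum_r, <- !rsum_scal.
  apply rsum_ext. intros b _. rewrite ip_scal_r. unfold sgram, gram. ring.
Qed.

(** * Clusterable graphs: spectral gap and small Gram forms *)

Section Clusterable.
Context (k : nat) (phi : R) (Hphi : 0 < phi <= 1).
Context (Hcl : clusterable n adj k phi).

(** Discarding the edges between clusters only lowers the energy; inside each cluster [f] has mean
    zero and Cheeger applies. The factor 1/4 comes from [ip_step_energy]. *)
Lemma spectral_gap : exists P : nat -> nat, forall f,
  (forall i, (i < k)%nat -> ip (fun v => if Nat.eqb (P v) i then 1 else 0) f = 0) ->
  ip f (step f) <= (1 - phi * phi / 4) * ip f f.
Proof.
  destruct Hcl as [h [P [Hh [HP Hcond]]]]. exists P. intros f Hf.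
  rewrite (ip_step_energy n adj Hsg Hdeg).
  assert (Hsplit : ip f f = rsum (seq 0 h) (fun i =>
      rsum V (fun v => if Nat.eqb (P v) i then d v * (f v * f v) else 0))).
  { rewrite rsum_swap. apply rsum_ext. intros v Hv. apply in_seq in Hv.
    rewrite (rsum_ext _ _ (fun i => if Nat.eqb i (P v) then d v * (f v * f v) else 0))
      by (intros i _; rewrite Nat.eqb_sym; reflexivity).
    symmetry. apply (rsum_delta_nat (seq 0 h) (P v) (fun _ => d v * (f v * f v))); [apply seq_NoDup|].
    apply in_seq. specialize (HP v). lia. }
  assert (Hen : rsum (seq 0 h) (fun i => esum (inside (fun v => Nat.eqb (P v) i)
                   (fun v u => (f v - f u) * (f v - f u))))
                <= esum (fun v u => (f v - f u) * (f v - f u))).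
  { rewrite <- esum_rsum. apply esum_le. intros v u Hv _. unfold inside.
    assert (0 <= (f v - f u) * (f v - f u)) by apply Rle_0_sqr.
    apply Rle_trans with (rsum (seq 0 h) (fun i => if Nat.eqb i (P v) then (f v - f u) * (f v - f u) else 0)).
    - apply rsum_le. intros i _. rewrite (Nat.eqb_sym i).
      destruct (Nat.eqb (P v) i), (Nat.eqb (P u) i); simpl; lra.
    - right. apply (rsum_delta_nat (seq 0 h) (P v) (fun _ => (f v - f u) * (f v - f u))); [apply seq_NoDup|].
      apply in_seq. specialize (HP v Hv). lia. }
  assert (Hmain : phi * phi * ip f f <= esum (fun v u => (f v - f u) * (f v - f u))).
  { apply Rle_trans with (2 := Hen). rewrite Hsplit, <- rsum_scal. apply rsum_le.
    intros i Hi. apply in_seq in Hi. apply cheeger; auto; try lra.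
    - apply Hcond. lia.
    - transitivity (ip (fun v => if Nat.eqb (P v) i then 1 else 0) f); [|apply Hf; lia]. apply rsum_ext. intros v _. cbv beta. destruct (Nat.eqb (P v) i); ring. }
  lra.
Qed.

Lemma gram_small_direction t vs X : (forall v, In v vs -> (v < n)%nat) ->
  exists c : nat -> R, (exists j, (j < S k)%nat /\ c j <> 0) /\
    qform (sgram t vs) (length vs) (lincomb k X c)
    <= tvol * INR (length vs) * (1 - phi * phi / 4) ^ (2 * t) * sqn (length vs) (lincomb k X c).
Proof.
  intros Hvs. destruct spectral_gap as [P HP].
  set (L := length vs).
  set (delta := fun a u => if Nat.eqb u (nth a vs 0%nat) then / d (nth a vs 0%nat) else 0).
  set (E := fun j u => rsum (seq 0 L) (fun a => X j a * delta a u)).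
  (* The k orthogonality conditions concern P^t [E j], and are linear in the k+1 coefficients. *)
  destruct (homogeneous_system k (fun i j => ip (fun v => if Nat.eqb (P v) i then 1 else 0) (iter t (E j))))
    as [c [Hc Horth]].
  exists c. split; [exact Hc|].
  set (x := lincomb k X c).
  set (e := fun u => rsum (seq 0 (S k)) (fun j => c j * E j u)).
  assert (He : e = fun u => rsum (seq 0 L) (fun a => x a * delta a u)).
  { apply functional_extensionality. intros u. unfold e, E, x, lincomb.
    rewrite (rsum_ext _ _ (fun j => rsum (seq 0 L) (fun a => c j * X j a * delta a u)))
      by (intros; rewrite <- rsum_scal; apply rsum_ext; intros; ring).
    rewrite rsum_swap. apply rsum_ext. intros a _. rewrite rsum_scal_r. reflexivity. }
  assert (Hlt : forall a, (a < L)%nat -> (nth a vs 0 < n)%nat) by (intros; apply Hvs, nth_In; auto).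
  (* The gap inequality for P^t e is a bound on the ratio at exponent 2t of the sequence <e, P^j
     e>. *)
  assert (Hgap : ip e (iter (S (2 * t)) e) <= (1 - phi * phi / 4) * ip e (iter (2 * t) e)).
  { replace (S (2 * t)) with (t + S t)%nat by lia. replace (2 * t)%nat with (t + t)%nat by lia.
    rewrite <- !(ip_iter_add n adj Hsg Hdeg). apply HP. intros i Hi. eapply eq_trans; [|exact (Horth i Hi)].
    rewrite (rsum_ext _ (fun j => _ * c j)
      (fun j => ip (fun v => if Nat.eqb (P v) i then 1 else 0) (fun v => c j * iter t (E j) v)))
      by (intros; rewrite ip_scal_r; apply Rmult_comm).
    rewrite <- (ip_rsum_r n adj (seq 0 (S k)) (fun j v => c j * iter t (E j) v)).
    apply ip_ext; [reflexivity|]. intros v _. apply lazy_iter_rsum. }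
  assert (Hmain := log_convex_ratio_bound (fun j => ip e (iter j e)) (1 - phi * phi / 4) (2 * t)
    (fun j => ip_iter_nonneg n adj Hsg Hdeg j e) (ip_iter_log_convex n adj Hsg Hdeg e)
    ltac:(nra) Hgap).
  cbv beta in Hmain. change (iter 0 e) with e in Hmain.
  assert (Hq : qform (sgram t vs) L x = tvol * ip e (iter (2 * t) e)).
  { unfold L. rewrite qform_sgram. replace (2 * t)%nat with (t + t)%nat by lia.
    rewrite <- (ip_iter_add n adj Hsg Hdeg). f_equal. fold L.
    assert (Hd : forall u, rsum (seq 0 L) (fun a => x a * dens t (nth a vs 0%nat) u) = iter t e u).
    { intros u. rewrite He. rewrite lazy_iter_rsum. reflexivity. }
    apply ip_ext; intros; apply Hd. }
  (* The factor [L] allows for repeated sample vertices; each delta function has square norm 1/d <=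
     1. *)
  assert (He0 : ip e e <= INR L * sqn L x).
  { rewrite He.
    apply Rle_trans with (rsum V (fun v => rsum (seq 0 L) (fun a => INR L * (x a * x a) * (d v * (delta a v * delta a v))))).
    - apply rsum_le. intros v _.
      rewrite (rsum_ext (seq 0 L) (fun a => INR L * (x a * x a) * (d v * (delta a v * delta a v)))
        (fun a => d v * (INR L * ((x a * delta a v) * (x a * delta a v))))) by (intros; ring).
      rewrite !rsum_scal. apply Rmult_le_compat_l; [apply pos_INR|].
      pose proof (rsum_sq_le (seq 0 L) (fun a => x a * delta a v)) as Hs.
      rewrite length_seq in Hs. exact Hs.
    - rewrite rsum_swap. unfold sqn. rewrite <- rsum_scal. apply rsum_le. intros a Ha. apply in_seq in Ha.
      rewrite rsum_scal.
      change (rsum V (fun v => d v * (delta a v * delta a v))) with (ip (delta a) (delta a)).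
      unfold delta at 1. rewrite (ip_delta n adj Hdeg) by (apply Hlt; lia).
      unfold delta. rewrite Nat.eqb_refl.
      pose proof (rdeg_ge1 n adj Hdeg _ (Hlt a ltac:(lia))) as Hd.
      rewrite <- Rmult_1_r. apply Rmult_le_compat_l.
      + apply Rmult_le_pos; [apply pos_INR|apply Rle_0_sqr].
      + rewrite <- Rinv_1. apply Rinv_le_contravar; lra. }
  rewrite Hq, !Rmult_assoc. apply Rmult_le_compat_l; [apply tvol_nonneg|].
  eapply Rle_trans; [exact Hmain|].
  rewrite (Rmult_comm (INR L)), !Rmult_assoc. apply Rmult_le_compat_l; [apply pow_le; nra|].
  rewrite (Rmult_comm (sqn L x)). exact He0.
Qed.

(* Vertices whose walks have a large collision probability are few: otherwise
   k+1 of them could be picked greedily with nearly orthogonal walk densities,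
   which would give the walk operator k+1 large eigenvalues. *)
Lemma heavy_collision_vol t K :
  (1 <= k)%nat -> INR k + 1 < K -> tvol * (1 - phi * phi / 4) ^ (2 * t) <= 1 ->
  rsum V (fun v => if Rltb K (gram t v v) then d v else 0) * (K - INR k - 1) <= INR k * INR k * tvol.
Proof.
  intros Hk HK Hsmall. apply Rnot_lt_le. intros Hbig.
  set (b := rsum V (fun v => if Rltb K (gram t v v) then d v else 0)) in *.
  assert (Hk1 : 1 <= INR k) by (apply (le_INR 1); auto).
  assert (Hb : 0 < b).
  { apply Rnot_le_lt. intros Hb. pose proof tvol_nonneg.
    assert (0 <= INR k * INR k * tvol) by (apply Rmult_le_pos; [nra|auto]). nra. }
  (* Averaging threshold: the rows of at most k chosen vertices sum to at most k [tvol] in the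
     degree measure, so some vertex in the heavy set of volume [b] has row sum at most k [tvol] /
     b. *)
  set (mu := INR k * tvol / b).
  assert (Hmu : 0 <= mu).
  { unfold mu. apply Rle_mult_inv_pos; auto. apply Rmult_le_pos; [lra|apply tvol_nonneg]. }
  assert (Hpick : forall j, (j <= S k)%nat -> exists vs : list nat, length vs = j /\
    (forall v, In v vs -> (v < n)%nat /\ K < gram t v v) /\
    (forall a b, (a < b)%nat -> (b < j)%nat -> gram t (nth a vs 0%nat) (nth b vs 0%nat) <= mu)).
  { induction j as [|j IH]; intros Hj.
    - exists []. split; [reflexivity|]. split; [intros v []|intros; lia].
    - destruct (IH ltac:(lia)) as [vs [Hlen [Hvs Hoff]]].
      destruct (classic (exists u, (u < n)%nat /\ K < gram t u u /\ rsum vs (fun v => gram t v u) <= mu))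
        as [[u [Hu [HKu Hsum]]]|Hno].
      + exists (u :: vs). split; [simpl; lia|]. split.
        * intros v [<-|Hv]; auto.
        * intros a b' Hab Hb'. destruct b' as [|b']; [lia|]. destruct a as [|a].
          -- simpl. unfold gram. rewrite ip_sym.
             eapply Rle_trans; [|exact Hsum].
             apply (rsum_ge_term vs (fun v => gram t v u)); [|apply nth_In; lia].
             intros v Hv. apply gram_nonneg; auto. apply Hvs, Hv.
          -- simpl. apply Hoff; lia.
      + exfalso.
        assert (H2 : rsum V (fun u => d u * rsum vs (fun v => gram t v u)) = INR j * tvol).
        { rewrite (rsum_ext _ _ (fun u => rsum vs (fun v => d u * gram t v u)))
            by (intros; rewrite rsum_scal; reflexivity).
          rewrite rsum_swap, (rsum_ext vs _ (fun _ => tvol)) by (intros v Hv; apply gram_sum, Hvs, Hv).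
          rewrite rsum_const, Hlen. reflexivity. }
        assert (H3 : mu * b = INR k * tvol) by (unfold mu; field; lra).
        assert (Hjk : INR j * tvol <= INR k * tvol)
          by (apply Rmult_le_compat_r; [apply tvol_nonneg|apply le_INR; lia]).
        (* If no heavy vertex could be added, these terms would be nonnegative with total at most 0;
           then a heavy vertex would attain [mu] exactly and could be added after all. *)
        assert (Hterm : forall u, In u V ->
          0 <= d u * rsum vs (fun v => gram t v u) - mu * (if Rltb K (gram t u u) then d u else 0)).
        { intros u Hu. apply in_seq in Hu.
          assert (Hnn : 0 <= rsum vs (fun v => gram t v u))
            by (apply rsum_nonneg; intros v Hv; apply gram_nonneg; [apply Hvs, Hv|lia]).
          pose proof (pos_INR (deg adj u)) as Hd. fold (d u) in Hd.
          destruct (Rltb K (gram t u u)) eqn:E; [|nra]. apply Rltb_true in E.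
          assert (~ rsum vs (fun v => gram t v u) <= mu) by (intros Hle; apply Hno; exists u; split; [lia|auto]).
          nra. }
        assert (Htot : rsum V (fun u => d u * rsum vs (fun v => gram t v u)
            - mu * (if Rltb K (gram t u u) then d u else 0)) <= 0).
        { rewrite rsum_minus, rsum_scal. fold b. lra. }
        destruct (classic (exists u, In u V /\ K < gram t u u)) as [[u [Hu HKu]]|Hnone].
        * pose proof (rsum_eq_zero V _ u Hterm Htot Hu) as Hz. cbv beta in Hz.
          assert (E : Rltb K (gram t u u) = true) by (apply Rltb_true, HKu). rewrite E in Hz.
          apply in_seq in Hu. pose proof (rdeg_ge1 n adj Hdeg u ltac:(lia)).
          apply Hno. exists u. split; [lia|]. split; [exact HKu|]. nra.
        * assert (b = 0); [|lra]. unfold b. apply rsum_zero. intros u Hu.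
          destruct (Rltb K (gram t u u)) eqn:E; [|reflexivity]. apply Rltb_true in E.
          exfalso; apply Hnone; eauto. }
  destruct (Hpick (S k) ltac:(lia)) as [vs [Hlen [Hvs Hoff]]].
  destruct (gram_small_direction t vs (fun i a => if Nat.eqb i a then 1 else 0)
    (fun v Hv => proj1 (Hvs v Hv))) as [c [Hc Hle]].
  rewrite Hlen in Hle.
  assert (Hx : forall a, (a < S k)%nat -> lincomb k (fun i a => if Nat.eqb i a then 1 else 0) c a = c a).
  { intros a Ha. unfold lincomb.
    rewrite (rsum_ext _ _ (fun i => if Nat.eqb i a then c i else 0))
      by (intros i _; destruct (Nat.eqb i a); ring).
    apply rsum_delta_nat; [apply seq_NoDup|apply in_seq; lia]. }
  set (x := lincomb k (fun i a => if Nat.eqb i a then 1 else 0) c) in *.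
  assert (Hpos : 0 < sqn (S k) x).
  { apply sqn_pos. destruct Hc as [j [Hj Hcj]]. exists j. split; [auto|]. rewrite Hx; auto. }
  assert (Hlow : (K - mu * INR k) * sqn (S k) x <= qform (sgram t vs) (S k) x).
  { apply Rle_trans with (rsum (seq 0 (S k)) (fun a => rsum (seq 0 (S k)) (fun b' =>
      (if Nat.eqb b' a then (K + mu) * (x a * x a) else 0) - mu / 2 * (x a * x a) - mu / 2 * (x b' * x b')))).
    - right.
      rewrite (rsum_ext _ _ (fun a => (K + mu) * (x a * x a) - INR (S k) * (mu / 2) * (x a * x a) - mu / 2 * sqn (S k) x)).
      + rewrite !rsum_minus, !rsum_scal, rsum_const, length_seq. fold (sqn (S k) x).
        rewrite S_INR. field.
      + intros a Ha. rewrite !rsum_minus.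
        rewrite (rsum_delta_nat (seq 0 (S k)) a (fun _ => (K + mu) * (x a * x a)));
          [|apply seq_NoDup|exact Ha].
        rewrite rsum_const, rsum_scal, length_seq. fold (sqn (S k) x). ring.
    - apply rsum_le. intros a Ha. apply rsum_le. intros b' Hb'. apply in_seq in Ha. apply in_seq in Hb'.
      destruct (Nat.eqb_spec b' a) as [->|Hne].
      + unfold sgram. destruct (Hvs (nth a vs 0%nat)) as [_ HKa]; [apply nth_In; lia|].
        assert (0 <= x a * x a) by apply Rle_0_sqr. nra.
      + assert (Hg : 0 <= sgram t vs a b' <= mu).
        { split.
          - apply gram_nonneg; apply Hvs, nth_In; lia.
          - destruct (Nat.lt_ge_cases a b'); [apply Hoff; lia|].
            unfold sgram, gram. rewrite ip_sym. apply Hoff; lia. }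
        set (g := sgram t vs a b') in *.
        assert (0 <= (x a + x b') * (x a + x b')) by apply Rle_0_sqr.
        assert (0 <= x a * x a) by apply Rle_0_sqr. assert (0 <= x b' * x b') by apply Rle_0_sqr.
        assert (0 <= g * ((x a + x b') * (x a + x b'))) by (apply Rmult_le_pos; lra).
        nra. }
  assert (Hup : qform (sgram t vs) (S k) x <= (INR k + 1) * sqn (S k) x).
  { eapply Rle_trans; [exact Hle|]. apply Rmult_le_compat_r; [lra|].
    rewrite S_INR. replace (tvol * (INR k + 1) * (1 - phi * phi / 4) ^ (2 * t))
      with ((INR k + 1) * (tvol * (1 - phi * phi / 4) ^ (2 * t))) by ring. nra. }
  assert (Hgap : mu * INR k < K - INR k - 1).
  { apply Rmult_lt_reg_r with b; [exact Hb|]. unfold mu.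
    replace (INR k * tvol / b * INR k * b) with (INR k * INR k * tvol) by (field; lra). lra. }
  nra.
Qed.

End Clusterable.
End Spectral.

(** * Many sparsely connected sets *)

Section Unclusterable.
Context (n : nat) (adj : nat -> list nat).
Context (Hsg : simple_graph n adj).
Context (Hdeg : forall v, (v < n)%nat -> (1 <= deg adj v)%nat).
Local Notation d := (rdeg adj).
Local Notation V := (seq 0 n).
Local Notation esum := (edge_sum n adj).
Local Notation ip := (deg_ip n adj).
Local Notation step := (lazy_step adj).
Local Notation iter := (lazy_iter adj).
Local Notation dens := (walk_density adj).
Local Notation tvol := (tvol n adj).
Context (k : nat) (phi : R) (Cs : nat -> nat -> bool).
Context (Hdisj : forall i j v, (i < S k)%nat -> (j < S k)%nat -> i <> j -> (v < n)%nat ->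
        andb (Cs i v) (Cs j v) = false).
Context (Hvol : forall i, (i < S k)%nat -> 0 < INR (vol n adj (Cs i))).
Context (Hcut : forall i, (i < S k)%nat -> cond_within n adj all_vertices (Cs i) <= phi).
Context (Hphi : 0 < phi < 1).

(** Normalized in [deg_ip]; disjointness of the sets makes these functions orthonormal. *)
Definition cluster_fun (i v : nat) : R :=
  if Cs i v then / sqrt (INR (vol n adj (Cs i))) else 0.

Definition combo (c : nat -> R) (v : nat) : R :=
  rsum (seq 0 (S k)) (fun i => c i * cluster_fun i v).

Lemma inv_sqrt_sq x : 0 < x -> / sqrt x * / sqrt x = / x.
Proof. intros Hx. rewrite <- Rinv_mult, sqrt_sqrt; lra. Qed.

Lemma combo_sq c v : (v < n)%nat ->
  combo c v * combo c v =
  rsum (seq 0 (S k)) (fun i => if Cs i v then c i * c i / INR (vol n adj (Cs i)) else 0).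
Proof.
  intros Hv. unfold combo, cluster_fun.
  destruct (seq_disjoint_classes (S k) (fun i => Cs i v)) as [Hnone|[i0 [Hi0 Hone]]].
  - intros i j Hi Hj Hne. apply Hdisj; auto.
  - rewrite !rsum_zero; [ring| |]; intros i Hi; apply in_seq in Hi; rewrite Hnone by lia; ring.
  - rewrite (rsum_ext _ _ (fun i => if Nat.eqb i i0 then c i * / sqrt (INR (vol n adj (Cs i))) else 0)).
    2: { intros i Hi. apply in_seq in Hi. rewrite Hone by lia. destruct (Nat.eqb i i0); ring. }
    rewrite (rsum_ext _ (fun i => if Cs i v then _ else _)
      (fun i => if Nat.eqb i i0 then c i * c i / INR (vol n adj (Cs i)) else 0))
      by (intros i Hi; apply in_seq in Hi; rewrite Hone by lia; reflexivity).
    rewrite (rsum_delta_nat (seq 0 (S k)) i0 (fun i => c i * / sqrt (INR (vol n adj (Cs i)))))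
      by (apply seq_NoDup || (apply in_seq; lia)).
    rewrite (rsum_delta_nat (seq 0 (S k)) i0 (fun i => c i * c i / INR (vol n adj (Cs i))))
      by (apply seq_NoDup || (apply in_seq; lia)).
    unfold Rdiv. rewrite <- (inv_sqrt_sq (INR (vol n adj (Cs i0)))) by auto. ring.
Qed.

Lemma combo_norm c : ip (combo c) (combo c) = sqn (S k) c.
Proof.
  unfold deg_ip.
  rewrite (rsum_ext _ _ (fun v => rsum (seq 0 (S k)) (fun i =>
      c i * c i / INR (vol n adj (Cs i)) * (if Cs i v then d v else 0)))).
  - rewrite rsum_swap. apply rsum_ext. intros i Hi. apply in_seq in Hi.
    rewrite rsum_scal, <- INR_vol. field. pose proof (Hvol i ltac:(lia)). lra.
  - intros v Hv. apply in_seq in Hv. rewrite combo_sq by lia. rewrite <- rsum_scal.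
    apply rsum_ext. intros i _. destruct (Cs i v); ring.
Qed.

(** An edge inside one [C_i] contributes nothing. On any other edge, (a - b)^2 <= 2 a^2 + 2 b^2 is
    charged to the boundaries of the sets containing its ends. Two orientations make the factor 4,
    which cancels the 1/4 of [ip_step_energy]. *)
Lemma combo_energy c : esum (fun v u => (combo c v - combo c u) * (combo c v - combo c u))
  <= 4 * phi * sqn (S k) c.
Proof.
  set (w := fun i => c i * c i / INR (vol n adj (Cs i))).
  assert (Hw : forall i, (i < S k)%nat -> 0 <= w i).
  { intros i Hi. apply Rle_mult_inv_pos; [apply Rle_0_sqr|auto]. }
  set (bd := fun i v u => if Cs i v && setminus all_vertices (Cs i) u then 1 else 0).
  apply Rle_trans with (esum (fun v u => rsum (seq 0 (S k)) (fun i => 2 * w i * (bd i v u + bd i u v)))).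
  - apply esum_le. intros v u Hv Hu. apply (adj_lt n adj Hsg) in Hu.
    destruct (classic (exists i, (i < S k)%nat /\ Cs i v = true /\ Cs i u = true)) as [[i [Hi [Hiv Hiu]]]|Hno].
    + assert (Heq : combo c v = combo c u).
      { apply rsum_ext. intros j Hj. apply in_seq in Hj. unfold cluster_fun.
        destruct (Nat.eq_dec i j) as [<-|Hne]; [rewrite Hiv, Hiu; reflexivity|].
        pose proof (Hdisj i j v Hi ltac:(lia) Hne Hv) as H1.
        pose proof (Hdisj i j u Hi ltac:(lia) Hne Hu) as H2.
        rewrite Hiv in H1. rewrite Hiu in H2. simpl in H1, H2. rewrite H1, H2. reflexivity. }
      rewrite Heq. replace ((combo c u - combo c u) * (combo c u - combo c u)) with 0 by ring.
      apply rsum_nonneg. intros j Hj. apply in_seq in Hj. specialize (Hw j ltac:(lia)).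
      apply Rmult_le_pos; [lra|]. unfold bd.
      destruct (Cs j v && _), (Cs j u && _); lra.
    + apply Rle_trans with (2 * (combo c v * combo c v) + 2 * (combo c u * combo c u)).
      { assert (0 <= (combo c v + combo c u) * (combo c v + combo c u)) by apply Rle_0_sqr. lra. }
      rewrite !combo_sq by auto. rewrite <- !rsum_scal, <- rsum_plus. right.
      apply rsum_ext. intros i Hi. apply in_seq in Hi. unfold bd, setminus, all_vertices. fold (w i).
      destruct (Cs i v) eqn:E1, (Cs i u) eqn:E2; simpl; try ring.
      exfalso; apply Hno. exists i. split; [lia|auto].
  - rewrite esum_rsum. unfold sqn. rewrite <- rsum_scal. apply rsum_le. intros i Hi. apply in_seq in Hi.
    rewrite esum_scal, esum_plus.
    assert (Hb : esum (bd i) = INR (cut n adj (Cs i) (setminus all_vertices (Cs i))))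
      by (rewrite INR_cut; reflexivity).
    assert (Hb' : esum (fun v u => bd i u v) = INR (cut n adj (Cs i) (setminus all_vertices (Cs i))))
      by (rewrite (esum_sym n adj Hsg); exact Hb).
    change (esum (fun v u => bd i v u)) with (esum (bd i)). rewrite Hb, Hb'.
    pose proof (Hcut i ltac:(lia)) as Hc. pose proof (Hvol i ltac:(lia)) as Hv. unfold cond_within in Hc.
    assert (Hc' : INR (cut n adj (Cs i) (setminus all_vertices (Cs i))) <= phi * INR (vol n adj (Cs i))).
    { apply Rmult_le_reg_r with (/ INR (vol n adj (Cs i))); [apply Rinv_0_lt_compat; auto|].
      rewrite Rmult_assoc, Rinv_r, Rmult_1_r by lra. exact Hc. }
    replace (4 * phi * (c i * c i)) with (4 * (w i * (phi * INR (vol n adj (Cs i)))))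
      by (unfold w; field; lra).
    assert (w i * INR (cut n adj (Cs i) (setminus all_vertices (Cs i))) <= w i * (phi * INR (vol n adj (Cs i))))
      by (apply Rmult_le_compat_l; [apply Hw; lia|exact Hc']).
    lra.
Qed.

Lemma combo_iter_norm t c :
  (1 - phi) ^ (2 * t) * sqn (S k) c <= ip (iter t (combo c)) (iter t (combo c)).
Proof.
  rewrite (ip_iter_add n adj Hsg Hdeg). replace (t + t)%nat with (2 * t)%nat by lia.
  rewrite <- combo_norm.
  apply (log_convex_ratio_increasing (fun j => ip (combo c) (iter j (combo c)))).
  - intros j. apply (ip_iter_nonneg n adj Hsg Hdeg).
  - apply (ip_iter_log_convex n adj Hsg Hdeg).
  - lra.
  - change (iter 1 (combo c)) with (step (combo c)). change (iter 0 (combo c)) with (combo c).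
    rewrite (ip_step_energy n adj Hsg Hdeg), combo_norm. pose proof (combo_energy c). lra.
Qed.

(** Maximum principle: averaging keeps the values between 0 and the initial maximum. This
    boundedness controls the variance on the sample. *)
Lemma cluster_iter_bound t i v : (i < S k)%nat -> (v < n)%nat ->
  iter t (cluster_fun i) v * iter t (cluster_fun i) v <= / INR (vol n adj (Cs i)).
Proof.
  intros Hi Hv. rewrite <- (inv_sqrt_sq (INR (vol n adj (Cs i)))) by auto.
  assert (0 < / sqrt (INR (vol n adj (Cs i)))) by (apply Rinv_0_lt_compat, sqrt_lt_R0; auto).
  assert (H0 : 0 <= iter t (cluster_fun i) v).
  { apply (lazy_iter_nonneg n adj Hsg Hdeg); auto. intros u _. unfold cluster_fun.
    destruct (Cs i u); lra. }
  assert (iter t (cluster_fun i) v <= / sqrt (INR (vol n adj (Cs i)))).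
  { apply (lazy_iter_le n adj Hsg Hdeg); auto. intros u _. unfold cluster_fun.
    destruct (Cs i u); lra. }
  apply Rmult_le_compat; auto.
Qed.

Lemma cluster_iter_norm t i : (i < S k)%nat ->
  ip (iter t (cluster_fun i)) (iter t (cluster_fun i)) <= 1.
Proof.
  intros Hi. rewrite (ip_iter_add n adj Hsg Hdeg).
  set (c := fun j => if Nat.eqb j i then 1 else 0).
  assert (Hf : forall v, (v < n)%nat -> cluster_fun i v = combo c v).
  { intros v _. unfold combo, c.
    rewrite (rsum_ext _ _ (fun j => if Nat.eqb j i then cluster_fun j v else 0))
      by (intros j _; destruct (Nat.eqb j i); ring).
    symmetry. apply (rsum_delta_nat (seq 0 (S k)) i (fun j => cluster_fun j v)); [apply seq_NoDup|apply in_seq; lia]. }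
  assert (Hn : ip (cluster_fun i) (cluster_fun i) = 1).
  { rewrite (ip_ext n adj _ (combo c) _ (combo c)) by auto. rewrite combo_norm. unfold sqn, c.
    rewrite (rsum_ext _ _ (fun j => if Nat.eqb j i then 1 else 0))
      by (intros j _; destruct (Nat.eqb j i); ring).
    apply (rsum_delta_nat (seq 0 (S k)) i (fun _ => 1)); [apply seq_NoDup|apply in_seq; lia]. }
  rewrite <- Hn.
  assert (Hle := log_convex_ratio_bound (fun j => ip (cluster_fun i) (iter j (cluster_fun i))) 1).
  specialize (Hle (t + t)%nat (fun j => ip_iter_nonneg n adj Hsg Hdeg j _)
    (ip_iter_log_convex n adj Hsg Hdeg _) ltac:(lra)).
  cbv beta in Hle. rewrite pow1, !Rmult_1_l in Hle. apply Hle.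
  replace (S (t + t)) with (t + S t)%nat by lia. rewrite <- !(ip_iter_add n adj Hsg Hdeg).
  change (iter (S t) (cluster_fun i)) with (step (iter t (cluster_fun i))).
  rewrite (ip_step_energy n adj Hsg Hdeg).
  assert (0 <= esum (fun v u => (iter t (cluster_fun i) v - iter t (cluster_fun i) u)
     * (iter t (cluster_fun i) v - iter t (cluster_fun i) u)))
    by (apply esum_nonneg; intros; apply Rle_0_sqr). lra.
Qed.

(** Importance weighting: if one draw returns [v] with probability [sigma v], the expectation over
    [s] draws is [exact_form]. Draws may fail, hence the division by [s] instead of the number of
    returned vertices. *)
Definition empirical (sigma : nat -> R) (s : R) (t : nat) (vs : list nat) (i j : nat) : R :=
  / s * rsum vs (fun v => rdeg adj v / sigma v *
    (lazy_iter adj t (cluster_fun i) v * lazy_iter adj t (cluster_fun j) v)).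

Definition exact_form (t i j : nat) : R :=
  deg_ip n adj (lazy_iter adj t (cluster_fun i)) (lazy_iter adj t (cluster_fun j)).

(** Let x be the restriction of P^t y to the sample and h the combination of walk densities with
    coefficients x. Self-adjointness gives <h, y> = |x|^2, so |x|^4 <= <h, h> |c|^2, where |c| is
    the norm of y. It remains to bound |x|^2 below by a multiple of |c|^2. *)
Lemma gram_large_subspace (sigma : nat -> R) (s tau : R) t vs :
  0 < s -> 0 < tau <= (1 - phi) ^ (2 * t) -> 0 < tvol ->
  (forall v, In v vs -> (v < n)%nat /\ 0 <= d v / sigma v <= 4 * tvol) ->
  frob (fun i j => empirical sigma s t vs i j - exact_form t i j) (S k) <= tau / 2 * (tau / 2) ->
  forall c, (exists j, (j < S k)%nat /\ c j <> 0) ->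
  let x := lincomb k (fun i a => iter t (cluster_fun i) (nth a vs 0%nat)) c in
  0 < sqn (length vs) x /\
  s * tau / 8 * sqn (length vs) x <= qform (sgram n adj t vs) (length vs) x.
Proof.
  intros Hs Htau Htv Hvs Hfrob c Hc x.
  set (L := length vs).
  set (y := iter t (combo c)).
  assert (Hy : forall v, y v = rsum (seq 0 (S k)) (fun i => c i * iter t (cluster_fun i) v))
    by (intros v; apply lazy_iter_rsum).
  assert (Hc2 : 0 < sqn (S k) c) by (apply sqn_pos; exact Hc).
  assert (Hexact : qform (exact_form t) (S k) c = ip y y).
  { transitivity (ip (fun v => rsum (seq 0 (S k)) (fun i => c i * iter t (cluster_fun i) v)) y).
    - rewrite (ip_rsum_l n adj (seq 0 (S k)) (fun i v => c i * iter t (cluster_fun i) v)).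
      apply rsum_ext. intros i _. rewrite ip_scal_l.
      rewrite (ip_ext n adj _ (iter t (cluster_fun i)) y
        (fun v => rsum (seq 0 (S k)) (fun i => c i * iter t (cluster_fun i) v))) by auto.
      rewrite (ip_rsum_r n adj (seq 0 (S k)) (fun i v => c i * iter t (cluster_fun i) v)).
      rewrite <- rsum_scal. apply rsum_ext. intros j _. rewrite ip_scal_r. unfold exact_form. ring.
    - apply ip_ext; auto. }
  assert (Hemp : qform (empirical sigma s t vs) (S k) c = / s * rsum vs (fun v => d v / sigma v * (y v * y v))).
  { unfold qform, empirical.
    rewrite (rsum_ext (seq 0 (S k)) _ (fun i => rsum (seq 0 (S k)) (fun j => rsum vs (fun v =>
       / s * (d v / sigma v * ((c i * iter t (cluster_fun i) v) * (c j * iter t (cluster_fun j) v))))))).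
    2: { intros i _. apply rsum_ext. intros j _. rewrite <- !rsum_scal. apply rsum_ext. intros; ring. }
    rewrite (rsum_ext (seq 0 (S k)) _ (fun i => rsum vs (fun v => rsum (seq 0 (S k)) (fun j =>
       / s * (d v / sigma v * ((c i * iter t (cluster_fun i) v) * (c j * iter t (cluster_fun j) v)))))))
      by (intros; apply rsum_swap).
    rewrite rsum_swap, <- rsum_scal. apply rsum_ext. intros v _.
    rewrite !Hy, rsum_prod, <- !rsum_scal.
    apply rsum_ext. intros i _. rewrite <- !rsum_scal. reflexivity. }
  assert (Hx : forall a, x a = y (nth a vs 0%nat)) by (intros a; rewrite Hy; reflexivity).
  assert (Hsqn : sqn L x = rsum vs (fun v => y v * y v)).
  { unfold sqn, L. rewrite (rsum_nth vs 0%nat). apply rsum_ext. intros a _. rewrite Hx. reflexivity. }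
  (* The exact form is at least tau |c|^2, the sampling error costs half of it, and the weights
     [d v / sigma v] are at most 4 [tvol]. *)
  assert (Hlow : s * tau / (8 * tvol) * sqn (S k) c <= sqn L x).
  { pose proof (qform_bound _ (S k) (tau / 2) c ltac:(lra) Hfrob) as [Hb _].
    rewrite (qform_minus (empirical sigma s t vs) (exact_form t)), Hexact, Hemp in Hb.
    pose proof (combo_iter_norm t c) as Hn. fold y in Hn.
    assert (H1 : rsum vs (fun v => d v / sigma v * (y v * y v)) <= 4 * tvol * sqn L x).
    { rewrite Hsqn, <- rsum_scal. apply rsum_le. intros v Hv. apply Rmult_le_compat_r; [apply Rle_0_sqr|].
      apply Hvs, Hv. }
    assert (H2 : tau / 2 * sqn (S k) c <= / s * (4 * tvol * sqn L x)).
    { assert (tau * sqn (S k) c <= (1 - phi) ^ (2 * t) * sqn (S k) c) by (apply Rmult_le_compat_r; lra).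
      assert (/ s * rsum vs (fun v => d v / sigma v * (y v * y v)) <= / s * (4 * tvol * sqn L x))
        by (apply Rmult_le_compat_l; [left; apply Rinv_0_lt_compat; lra|auto]).
      lra. }
    apply Rmult_le_reg_l with (4 * tvol / s); [apply Rdiv_lt_0_compat; lra|].
    replace (4 * tvol / s * (s * tau / (8 * tvol) * sqn (S k) c)) with (tau / 2 * sqn (S k) c) by (field; lra).
    replace (4 * tvol / s * sqn L x) with (/ s * (4 * tvol * sqn L x)) by (field; lra). exact H2. }
  assert (Hxpos : 0 < sqn L x).
  { eapply Rlt_le_trans; [|exact Hlow]. apply Rmult_lt_0_compat; [|auto].
    apply Rdiv_lt_0_compat; [apply Rmult_lt_0_compat|]; lra. }
  split; [exact Hxpos|].
  unfold L. rewrite qform_sgram. fold L.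
  set (h := fun u => rsum (seq 0 L) (fun a => x a * dens t (nth a vs 0%nat) u)).
  assert (Hhy : ip h (combo c) = sqn L x).
  { unfold h. rewrite (ip_rsum_l n adj (seq 0 L) (fun a u => x a * dens t (nth a vs 0%nat) u)).
    apply rsum_ext. intros a Ha. apply in_seq in Ha.
    rewrite ip_scal_l, (ip_walk_density n adj Hsg Hdeg) by (apply Hvs, nth_In; unfold L in *; lia).
    rewrite Hx. reflexivity. }
  pose proof (ip_cauchy_schwarz n adj h (combo c)) as Hcs.
  rewrite Hhy, combo_norm in Hcs.
  apply Rmult_le_reg_r with (sqn (S k) c); [exact Hc2|].
  apply Rle_trans with (tvol * (sqn L x * sqn L x)).
  - apply Rle_trans with (tvol * sqn L x * (s * tau / (8 * tvol) * sqn (S k) c)).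
    + right. field. lra.
    + rewrite (Rmult_assoc tvol (sqn L x)). apply Rmult_le_compat_l; [lra|].
      apply Rmult_le_compat_l; [lra|exact Hlow].
  - rewrite Rmult_assoc. apply Rmult_le_compat_l; [lra|exact Hcs].
Qed.

End Unclusterable.

(** * Query programs with a result *)

(* [PBern d] flips a coin that shows [true] with probability 1/(d+1). *)
Inductive Prog (A : Type) : Type :=
| Ret : A -> Prog A
| PRand : (nat -> Prog A) -> Prog A
| PDeg : nat -> (nat -> Prog A) -> Prog A
| PNbr : nat -> nat -> (option nat -> Prog A) -> Prog A
| PBern : nat -> (bool -> Prog A) -> Prog A.
Arguments Ret {A}. Arguments PRand {A}. Arguments PDeg {A}.
Arguments PNbr {A}. Arguments PBern {A}.

Fixpoint bind {A B} (m : Prog A) (f : A -> Prog B) : Prog B :=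
  match m with
  | Ret a => f a
  | PRand g => PRand (fun v => bind (g v) f)
  | PDeg v g => PDeg v (fun d => bind (g d) f)
  | PNbr v i g => PNbr v i (fun o => bind (g o) f)
  | PBern d g => PBern d (fun b => bind (g b) f)
  end.

(* As in [queries_le], the answers range over all values, not only those given by a graph. *)
Fixpoint pspec {A} (q : nat) (P : A -> Prop) (m : Prog A) : Prop :=
  match m with
  | Ret a => P a
  | PRand g => match q with O => False | S q' => forall v, pspec q' P (g v) end
  | PDeg _ g => match q with O => False | S q' => forall d, pspec q' P (g d) end
  | PNbr _ _ g => match q with O => False | S q' => forall o, pspec q' P (g o) end
  | PBern _ g => forall b, pspec q P (g b)
  end.

Lemma pspec_weaken {A} q q' (P Q : A -> Prop) m :
  (q <= q')%nat -> (forall a, P a -> Q a) -> pspec q P m -> pspec q' Q m.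
Proof.
  revert q q'. induction m as [a|g IH|v g IH|v i g IH|d g IH]; intros q q' Hq HPQ Hm; simpl in *; auto;
    try (destruct q; [destruct Hm|]; destruct q'; [lia|]; intros x; apply (IH x q q'); auto; lia).
  intros b. apply (IH b q q'); auto.
Qed.

Lemma pspec_bind {A B} q1 q2 (P : A -> Prop) (Q : B -> Prop) m f :
  pspec q1 P m -> (forall a, P a -> pspec q2 Q (f a)) -> pspec (q1 + q2) Q (bind m f).
Proof.
  revert q1. induction m as [a|g IH|v g IH|v i g IH|d g IH]; intros q1 Hm Hf; simpl in *;
    try (destruct q1; [destruct Hm|]; intros x; apply IH; auto).
  - apply (pspec_weaken q2 _ Q); auto. lia.
  - intros b. apply IH; auto.
Qed.

Fixpoint rep {A} (r : nat) (m : Prog A) : Prog (list A) :=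
  match r with
  | O => Ret []
  | S r' => bind m (fun a => bind (rep r' m) (fun l => Ret (a :: l)))
  end.

Fixpoint map_prog {A B} (f : A -> Prog B) (l : list A) : Prog (list B) :=
  match l with
  | [] => Ret []
  | a :: l' => bind (f a) (fun b => bind (map_prog f l') (fun bs => Ret (b :: bs)))
  end.

Lemma pspec_rep {A} q (P : A -> Prop) m r : pspec q P m ->
  pspec (r * q) (fun l => length l = r) (rep r m).
Proof.
  intros Hm. induction r as [|r IH]; simpl; [reflexivity|].
  apply (pspec_bind q (r * q) P); [exact Hm|]. intros a _.
  rewrite <- (Nat.add_0_r (r * q)).
  apply (pspec_bind (r * q) 0 (fun l => length l = r)); [exact IH|].
  intros l Hl. simpl. lia.
Qed.

Lemma pspec_map {A B} q (P : B -> Prop) (f : A -> Prog B) l : (forall a, pspec q P (f a)) ->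
  pspec (length l * q) (fun _ => True) (map_prog f l).
Proof.
  intros Hm. induction l as [|a l IH]; simpl; [exact I|].
  apply (pspec_bind q (length l * q) P); auto. intros b _.
  rewrite <- (Nat.add_0_r (length l * q)).
  apply (pspec_bind (length l * q) 0 (fun _ => True)); auto.
Qed.

(** Keeps the last of [d] indices with probability 1/d and otherwise recurses, so all indices below
    [d] are equally likely. The value at [d = 0] is a default. *)
Fixpoint unif (d : nat) : Prog nat :=
  match d with
  | O => Ret 0%nat
  | S d' => PBern d' (fun b => if b then Ret d' else unif d')
  end.

Lemma pspec_unif d : pspec 0 (fun _ => True) (unif d).
Proof. induction d as [|d IH]; simpl; auto. intros []; simpl; auto. Qed.

Lemma inv_INR_S d : 0 < / INR (S d) <= 1.
Proof.
  assert (1 <= INR (S d)) by (apply (le_INR 1); lia).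
  split; [apply Rinv_0_lt_compat; lra|]. rewrite <- Rinv_1. apply Rinv_le_contravar; lra.
Qed.

Section Expectation.
Context (n : nat) (adj : nat -> list nat) (Hn : (0 < n)%nat).

Fixpoint expect {A} (m : Prog A) (h : A -> R) : R :=
  match m with
  | Ret a => h a
  | PRand g => rsum (seq 0 n) (fun v => expect (g v) h) / INR n
  | PDeg v g => expect (g (length (adj v))) h
  | PNbr v i g => expect (g (nbr_answer adj v i)) h
  | PBern d g => / INR (S d) * expect (g true) h + (1 - / INR (S d)) * expect (g false) h
  end.

(** In contrast to [pspec], only answers that the given graph can produce are considered. *)
Fixpoint always {A} (P : A -> Prop) (m : Prog A) : Prop :=
  match m with
  | Ret a => P a
  | PRand g => forall v, (v < n)%nat -> always P (g v)
  | PDeg v g => always P (g (length (adj v)))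
  | PNbr v i g => always P (g (nbr_answer adj v i))
  | PBern _ g => forall b, always P (g b)
  end.

Lemma always_bind {A B} (P : A -> Prop) (Q : B -> Prop) m f :
  always P m -> (forall a, P a -> always Q (f a)) -> always Q (bind m f).
Proof. induction m; simpl; auto. Qed.

Lemma always_true {A} (m : Prog A) : always (fun _ => True) m.
Proof. induction m; simpl; auto. Qed.

Lemma always_rep {A} (P : A -> Prop) m r : always P m ->
  always (fun l => length l = r /\ forall a, In a l -> P a) (rep r m).
Proof.
  intros Hm. induction r as [|r IH]; simpl; [split; [reflexivity|intros a []]|].
  apply (always_bind P); auto. intros a Ha. eapply always_bind; [exact IH|].
  intros l [Hl HP]. simpl. split; [lia|]. intros b [<-|Hb]; auto.
Qed.

Lemma expect_le_always {A} (P : A -> Prop) (m : Prog A) g h :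
  always P m -> (forall a, P a -> g a <= h a) -> expect m g <= expect m h.
Proof.
  intros Hm Hgh. induction m as [a|f IH|v f IH|v i f IH|d f IH]; simpl in *; auto.
  - apply Rmult_le_compat_r; [left; apply Rinv_0_lt_compat, lt_0_INR, Hn|].
    apply rsum_le. intros v Hv. apply in_seq in Hv. apply IH, Hm. lia.
  - pose proof (inv_INR_S d). apply Rplus_le_compat; apply Rmult_le_compat_l; auto; simpl in *; lra.
Qed.

Lemma expect_le {A} (m : Prog A) g h : (forall a, g a <= h a) -> expect m g <= expect m h.
Proof. intros H. apply (expect_le_always (fun _ => True)); auto using always_true. Qed.

Lemma expect_ext {A} (m : Prog A) g h : (forall a, g a = h a) -> expect m g = expect m h.
Proof. intros H. f_equal. apply functional_extensionality, H. Qed.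

Lemma expect_const {A} (m : Prog A) c : expect m (fun _ => c) = c.
Proof.
  induction m as [a|f IH|v f IH|v i f IH|d f IH]; cbn [expect]; auto.
  - rewrite (rsum_ext _ _ (fun _ => c)) by auto. rewrite rsum_const, length_seq.
    field. apply not_0_INR. lia.
  - rewrite !IH. ring.
Qed.

Lemma expect_plus {A} (m : Prog A) g h :
  expect m (fun a => g a + h a) = expect m g + expect m h.
Proof.
  induction m as [a|f IH|v f IH|v i f IH|d f IH]; cbn [expect]; auto.
  - rewrite (rsum_ext _ _ (fun v => expect (f v) g + expect (f v) h)) by auto.
    rewrite rsum_plus. unfold Rdiv. ring.
  - rewrite !IH. ring.
Qed.

Lemma expect_scal {A} (m : Prog A) c g : expect m (fun a => c * g a) = c * expect m g.
Proof.
  induction m as [a|f IH|v f IH|v i f IH|d f IH]; cbn [expect]; auto.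
  - rewrite (rsum_ext _ _ (fun v => c * expect (f v) g)) by auto.
    rewrite rsum_scal. unfold Rdiv. ring.
  - rewrite !IH. ring.
Qed.

Lemma expect_le_const {A} (m : Prog A) g c : (forall a, g a <= c) -> expect m g <= c.
Proof. intros H. rewrite <- (expect_const m c). apply expect_le, H. Qed.

Lemma expect_rsum {A B} (m : Prog A) (l : list B) g :
  expect m (fun a => rsum l (fun b => g b a)) = rsum l (fun b => expect m (g b)).
Proof.
  induction l as [|b l IH]; [apply (expect_const m 0)|].
  rewrite (expect_ext m _ (fun a => g b a + rsum l (fun b => g b a))) by reflexivity.
  rewrite expect_plus, IH. reflexivity.
Qed.

Lemma expect_bind {A B} (m : Prog A) (f : A -> Prog B) h :
  expect (bind m f) h = expect m (fun a => expect (f a) h).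
Proof.
  induction m as [a|g IH|v g IH|v i g IH|d g IH]; cbn [expect bind]; auto.
  - f_equal. apply rsum_ext. auto.
  - rewrite !IH. reflexivity.
Qed.

Lemma expect_swap {A B} (m : Prog A) (m' : Prog B) h :
  expect m (fun a => expect m' (fun b => h a b)) = expect m' (fun b => expect m (fun a => h a b)).
Proof.
  induction m as [a|g IH|v g IH|v i g IH|d g IH]; cbn [expect]; auto.
  - rewrite (rsum_ext _ _ (fun v => expect m' (fun b => expect (g v) (fun a => h a b)))) by auto.
    rewrite <- expect_rsum. unfold Rdiv. rewrite Rmult_comm, <- expect_scal.
    apply expect_ext. intros; ring.
  - rewrite !IH, <- !expect_scal, <- expect_plus. reflexivity.
Qed.

Lemma expect_unif d h : (0 < d)%nat -> expect (unif d) h = rsum (seq 0 d) h / INR d.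
Proof.
  induction d as [|d IH]; intros Hd; [lia|].
  cbn [unif expect]. rewrite seq_S, rsum_app, rsum_cons, rsum_nil. simpl (0 + d)%nat.
  destruct d as [|d].
  - simpl. unfold rsum. simpl. field.
  - rewrite IH by lia. rewrite !S_INR. pose proof (pos_INR d). field. lra.
Qed.

(** * Moments of independent repetitions *)

Lemma expect_rep_sum {A} (m : Prog A) r g :
  expect (rep r m) (fun l => rsum l g) = INR r * expect m g.
Proof.
  induction r as [|r IH]; [simpl; unfold rsum; simpl; ring|].
  cbn [rep]. rewrite expect_bind.
  rewrite (expect_ext m _ (fun a => g a + INR r * expect m g)).
  - rewrite expect_plus, expect_const, S_INR. ring.
  - intros a. rewrite expect_bind. cbn [expect]. rewrite <- IH.
    rewrite (expect_ext (rep r m) _ (fun l => g a + rsum l g)) by (intros; apply rsum_cons).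
    rewrite expect_plus, expect_const. reflexivity.
Qed.

Lemma expect_rep_sq {A} (m : Prog A) r g :
  expect (rep r m) (fun l => rsum l g * rsum l g)
  = INR r * expect m (fun a => g a * g a) + INR r * (INR r - 1) * (expect m g * expect m g).
Proof.
  induction r as [|r IH]; [simpl; unfold rsum; simpl; ring|].
  cbn [rep]. rewrite expect_bind.
  rewrite (expect_ext m _ (fun a => g a * g a + (2 * (INR r * expect m g)) * g a +
    expect (rep r m) (fun l => rsum l g * rsum l g))).
  - rewrite !expect_plus, expect_const, expect_scal, S_INR, IH. ring.
  - intros a. rewrite expect_bind. cbn [expect]. rewrite <- expect_rep_sum.
    rewrite (expect_ext (rep r m) _ (fun l => g a * g a + (2 * g a * rsum l g + rsum l g * rsum l g)))
      by (intros; rewrite rsum_cons; ring).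
    rewrite !expect_plus, expect_const, expect_scal. ring.
Qed.

Lemma expect_rep_mean_sq {A} (m : Prog A) r g : (0 < r)%nat ->
  expect (rep r m) (fun l => rsum l g / INR r * (rsum l g / INR r))
  <= expect m (fun a => g a * g a) / INR r + expect m g * expect m g.
Proof.
  intros Hr. assert (0 < INR r) by (apply lt_0_INR; auto).
  rewrite (expect_ext _ _ (fun l => / INR r * / INR r * (rsum l g * rsum l g)))
    by (intros; unfold Rdiv; ring).
  rewrite expect_scal, expect_rep_sq.
  assert (0 <= / INR r * (expect m g * expect m g))
    by (apply Rmult_le_pos; [left; apply Rinv_0_lt_compat; auto|apply Rle_0_sqr]).
  replace (/ INR r * / INR r * _) with (expect m (fun a => g a * g a) / INR r
    + expect m g * expect m g - / INR r * (expect m g * expect m g)) by (field; lra). lra.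
Qed.

Lemma expect_rep_deviation {A} (m : Prog A) r g c : (0 < r)%nat ->
  expect (rep r m) (fun l => (rsum l g / INR r - c) * (rsum l g / INR r - c))
  <= expect m (fun a => g a * g a) / INR r + (expect m g - c) * (expect m g - c).
Proof.
  intros Hr. assert (0 < INR r) by (apply lt_0_INR; auto).
  rewrite (expect_ext _ _ (fun l => rsum l g / INR r * (rsum l g / INR r)
    + (- 2 * c / INR r * rsum l g + c * c))) by (intros; unfold Rdiv; ring).
  rewrite !expect_plus, expect_scal, expect_const, expect_rep_sum.
  pose proof (expect_rep_mean_sq m r g Hr).
  replace (-2 * c / INR r * (INR r * expect m g)) with (-2 * c * expect m g) by (field; lra).
  lra.
Qed.

(** For fixed [ws] the double average is an independent mean over [us] of [F ws], and the mean of
    [F ws] is itself an independent mean over [ws]. One second-moment bound for each layer gives the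
    three terms: the kernel squared, and the squares of its two marginals. *)
Lemma expect_kernel_mean {A B} (m1 : Prog A) (m2 : Prog B) (kap : A -> B -> R) r :
  (0 < r)%nat ->
  let G := expect m1 (fun u => expect m2 (kap u)) in
  expect (rep r m1) (fun us => expect (rep r m2) (fun ws =>
    (rsum us (fun u => rsum ws (kap u)) / (INR r * INR r) - G)
    * (rsum us (fun u => rsum ws (kap u)) / (INR r * INR r) - G)))
  <= expect m1 (fun u => expect m2 (fun w => kap u w * kap u w)) / (INR r * INR r)
     + (expect m1 (fun u => expect m2 (kap u) * expect m2 (kap u))
        + expect m2 (fun w => expect m1 (fun u => kap u w) * expect m1 (fun u => kap u w))) / INR r.
Proof.
  intros Hr G. assert (H : 0 < INR r) by (apply lt_0_INR; auto).
  rewrite expect_swap.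
  set (F := fun ws u => rsum ws (kap u) / INR r).
  set (g := fun w => expect m1 (fun u => kap u w)).
  apply Rle_trans with (expect (rep r m2) (fun ws =>
    / INR r * expect m1 (fun u => F ws u * F ws u)
    + (rsum ws g / INR r - G) * (rsum ws g / INR r - G))).
  - apply expect_le. intros ws.
    rewrite (expect_ext _ _ (fun us => (rsum us (F ws) / INR r - G) * (rsum us (F ws) / INR r - G))).
    2: { intros us. unfold F, Rdiv. rewrite rsum_scal_r, Rinv_mult. ring. }
    eapply Rle_trans; [apply expect_rep_deviation; auto|].
    assert (HF : expect m1 (F ws) = rsum ws g / INR r).
    { unfold F, Rdiv. rewrite (expect_ext m1 _ (fun u => / INR r * rsum ws (fun w => kap u w))) by (intros; cbv beta; apply Rmult_comm).
      rewrite expect_scal, expect_rsum. unfold g. ring. }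
    rewrite HF. unfold Rdiv. rewrite (Rmult_comm (expect m1 _)). lra.
  - rewrite expect_plus, expect_scal.
    assert (HG : expect m2 g = G) by (unfold g, G; apply expect_swap).
    pose proof (expect_rep_deviation m2 r g G Hr) as H1. rewrite HG in H1.
    assert (H2 : expect (rep r m2) (fun ws => expect m1 (fun u => F ws u * F ws u))
      <= expect m1 (fun u => expect m2 (fun w => kap u w * kap u w)) / INR r
         + expect m1 (fun u => expect m2 (kap u) * expect m2 (kap u))).
    { rewrite expect_swap. unfold Rdiv at 1. rewrite Rmult_comm, <- expect_scal, <- expect_plus.
      apply expect_le. intros u. rewrite Rmult_comm. apply (expect_rep_mean_sq m2 r (kap u) Hr). }
    apply Rmult_le_compat_l with (r := / INR r) in H2; [|left; apply Rinv_0_lt_compat; auto].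
    set (a1 := expect m1 (fun u => expect m2 (fun w => kap u w * kap u w))) in *.
    set (a2 := expect m1 (fun u => expect m2 (kap u) * expect m2 (kap u))) in *.
    fold (g) in H1. set (a3 := expect m2 (fun w => g w * g w)) in *.
    change (expect m2 (fun w => expect m1 (fun u => kap u w) * expect m1 (fun u => kap u w))) with a3.
    replace (a1 / (INR r * INR r) + (a2 + a3) / INR r) with (/ INR r * (a1 / INR r + a2) + a3 / INR r)
      by (field; lra).
    lra.
Qed.

Lemma expect_map_prog {A B} (f : A -> Prog B) (l : list A) a0 b0 a h : (a < length l)%nat ->
  expect (map_prog f l) (fun bs => h (nth a bs b0)) = expect (f (nth a l a0)) h.
Proof.
  revert a. induction l as [|x l IH]; intros a Ha; [simpl in Ha; lia|].
  cbn [map_prog]. rewrite expect_bind. destruct a as [|a].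
  - apply expect_ext. intros b. rewrite expect_bind. simpl. apply expect_const.
  - rewrite (expect_ext _ _ (fun _ => expect (f (nth a l a0)) h)).
    + apply expect_const.
    + intros b. rewrite expect_bind. simpl. apply IH. simpl in Ha. lia.
Qed.

End Expectation.

(** * Simulation by fair coins *)

(** Compares fair bits with the binary expansion of [p]; each toss either decides or doubles the
    remaining problem. After [L] undecided tosses it falls back to [b], an event of probability
    2^-L. *)
Fixpoint bern_alg (L : nat) (p : R) (a b : Alg) : Alg :=
  match L with
  | O => b
  | S L' => if Rle_dec (1 / 2) p
            then Coin (fun c => if c then a else bern_alg L' (2 * p - 1) a b)
            else Coin (fun c => if c then bern_alg L' (2 * p) a b else b)
  end.

Lemma bern_alg_queries L p q a b :
  queries_le q a -> queries_le q b -> queries_le q (bern_alg L p a b).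
Proof.
  intros Ha Hb. revert p. induction L as [|L IH]; intros p; simpl; [exact Hb|].
  destruct (Rle_dec (1 / 2) p); simpl; auto.
Qed.

Lemma accept_prob_bounds n adj A : (0 < n)%nat -> 0 <= accept_prob n adj A <= 1.
Proof.
  intros Hn. assert (HN : 0 < INR n) by (apply lt_0_INR; auto).
  induction A as [| |f IH|v f IH|v i f IH|f IH]; simpl; try lra; auto.
  - change (fold_right (fun v s => accept_prob n adj (f v) + s) 0 (seq 0 n)) with
      (rsum (seq 0 n) (fun v => accept_prob n adj (f v))).
    split.
    + apply Rle_mult_inv_pos; auto. apply rsum_nonneg. intros; apply IH.
    + apply Rmult_le_reg_r with (INR n); [exact HN|]. unfold Rdiv.
      rewrite Rmult_assoc, Rinv_l, Rmult_1_r, Rmult_1_l by lra.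
      apply Rle_trans with (rsum (seq 0 n) (fun _ => 1)).
      * apply rsum_le. intros; apply IH.
      * rewrite rsum_const, length_seq. lra.
  - pose proof (IH true). pose proof (IH false). lra.
Qed.

Lemma Rabs_le_inv x a : Rabs x <= a -> - a <= x <= a.
Proof.
  intros H. pose proof (Rle_abs x). pose proof (Rle_abs (- x)) as H1.
  rewrite Rabs_Ropp in H1. lra.
Qed.

Lemma bern_alg_prob n adj L p a b : (0 < n)%nat -> 0 <= p <= 1 ->
  Rabs (accept_prob n adj (bern_alg L p a b)
        - (p * accept_prob n adj a + (1 - p) * accept_prob n adj b)) <= (1 / 2) ^ L.
Proof.
  intros Hn. revert p. induction L as [|L IH]; intros p Hp; simpl.
  - pose proof (accept_prob_bounds n adj a Hn). pose proof (accept_prob_bounds n adj b Hn).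
    apply Rabs_le. nra.
  - destruct (Rle_dec (1 / 2) p) as [H|H]; simpl.
    + specialize (IH (2 * p - 1) ltac:(lra)). apply Rabs_le_inv in IH. apply Rabs_le. lra.
    + specialize (IH (2 * p) ltac:(lra)). apply Rabs_le_inv in IH. apply Rabs_le. lra.
Qed.

(** Each biased coin uses precision L+1 and hands L+1 to its continuations, so its own error and the
    inherited one add up to 2^-L. The total error is therefore independent of the number of
    coins. *)
Fixpoint to_alg (L : nat) (m : Prog bool) : Alg :=
  match m with
  | Ret b => if b then Accept else Reject
  | PRand g => QRand (fun v => to_alg L (g v))
  | PDeg v g => QDeg v (fun d => to_alg L (g d))
  | PNbr v i g => QNbr v i (fun o => to_alg L (g o))
  | PBern d g => bern_alg (S L) (/ INR (S d)) (to_alg (S L) (g true)) (to_alg (S L) (g false))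
  end.

Lemma to_alg_queries q (P : bool -> Prop) m L : pspec q P m -> queries_le q (to_alg L m).
Proof.
  revert q L. induction m as [[]|g IH|v g IH|v i g IH|d g IH]; intros q L Hm; cbn [to_alg pspec] in *;
    try exact I; try (destruct q; [destruct Hm|]; intros x; apply IH, Hm).
  apply bern_alg_queries; apply IH, Hm.
Qed.

Lemma to_alg_prob n adj m L : (0 < n)%nat ->
  Rabs (accept_prob n adj (to_alg L m) - expect n adj m (fun b : bool => if b then 1 else 0)) <= (1 / 2) ^ L.
Proof.
  intros Hn. assert (HN : 0 < INR n) by (apply lt_0_INR; auto).
  revert L. induction m as [[]|g IH|v g IH|v i g IH|d g IH]; intros L; cbn [to_alg expect]; auto.
  - simpl. rewrite Rminus_diag, Rabs_R0. apply pow_le. lra.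
  - simpl. rewrite Rminus_diag, Rabs_R0. apply pow_le. lra.
  - set (h := fun b : bool => if b then 1 else 0) in *.
    change (accept_prob n adj (QRand (fun v => to_alg L (g v)))) with
      (rsum (seq 0 n) (fun v => accept_prob n adj (to_alg L (g v))) / INR n).
    unfold Rdiv. rewrite <- Rmult_minus_distr_r, <- rsum_minus.
    assert (Hb : - (INR n * (1 / 2) ^ L) <= rsum (seq 0 n)
       (fun v => accept_prob n adj (to_alg L (g v)) - expect n adj (g v) h) <= INR n * (1 / 2) ^ L).
    { assert (Hc : forall x, INR n * x = rsum (seq 0 n) (fun _ => x))
        by (intros; rewrite rsum_const, length_seq; reflexivity).
      rewrite Ropp_mult_distr_r, !Hc. split; apply rsum_le; intros v _;
        specialize (IH v L); apply Rabs_le_inv in IH; lra. }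
    rewrite Rabs_mult, (Rabs_pos_eq (/ INR n)) by (left; apply Rinv_0_lt_compat; auto).
    apply Rmult_le_reg_r with (INR n); [exact HN|].
    rewrite Rmult_assoc, Rinv_l, Rmult_1_r by lra. apply Rabs_le. lra.
  - apply IH.
  - apply IH.
  - pose proof (inv_INR_S d) as Hd.
    pose proof (bern_alg_prob n adj (S L) (/ INR (S d)) (to_alg (S L) (g true)) (to_alg (S L) (g false)) Hn
      ltac:(lra)) as H0.
    pose proof (IH true (S L)) as H1. pose proof (IH false (S L)) as H2.
    set (h := fun b : bool => if b then 1 else 0) in *.
    set (p := / INR (S d)) in *.
    set (x := accept_prob n adj (bern_alg (S L) p (to_alg (S L) (g true)) (to_alg (S L) (g false)))) in *.
    set (a := accept_prob n adj (to_alg (S L) (g true))) in *.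
    set (b := accept_prob n adj (to_alg (S L) (g false))) in *.
    set (ea := expect n adj (g true) h) in *. set (eb := expect n adj (g false) h) in *.
    replace (x - (p * ea + (1 - p) * eb)) with
      ((x - (p * a + (1 - p) * b)) + (p * (a - ea) + (1 - p) * (b - eb))) by ring.
    eapply Rle_trans; [apply Rabs_triang|].
    replace ((1 / 2) ^ L) with ((1 / 2) ^ S L + (1 / 2) ^ S L) by (simpl; field).
    apply Rplus_le_compat; [exact H0|].
    eapply Rle_trans; [apply Rabs_triang|]. rewrite !Rabs_mult, (Rabs_pos_eq p), (Rabs_pos_eq (1 - p)) by lra.
    replace ((1 / 2) ^ S L) with (p * (1 / 2) ^ S L + (1 - p) * (1 / 2) ^ S L) by ring.
    apply Rplus_le_compat; apply Rmult_le_compat_l; auto; lra.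
Qed.

(** * Walks and their collisions *)

(** Returns the endpoint with its degree, which the collision weight needs. Neighbours are numbered
    from 1, hence [S i]; staying at [v] on a failed query is a default for answers that no graph of
    positive degrees gives. *)
Fixpoint walk (t v : nat) : Prog (nat * nat) :=
  match t with
  | O => PDeg v (fun d => Ret (v, d))
  | S t' => PBern 1 (fun b => if b then walk t' v else
      PDeg v (fun d => bind (unif d) (fun i => PNbr v (S i) (fun o =>
        walk t' (match o with Some u => u | None => v end)))))
  end.

Lemma pspec_walk t v : pspec (2 * t + 1) (fun _ => True) (walk t v).
Proof.
  revert v. induction t as [|t IH]; intros v; [simpl; auto|].
  replace (2 * S t + 1)%nat with (S (0 + S (2 * t + 1))) by lia.
  cbn [walk pspec]. intros [].
  - eapply pspec_weaken; [|auto|apply IH]; lia.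
  - cbn [pspec]. intros d. apply (pspec_bind 0 (S (2 * t + 1)) (fun _ => True)); [apply pspec_unif|].
    intros i _. cbn [pspec]. intros o. apply IH.
Qed.

(** Two walks meet at x with probability d_x^2 times the product of their densities; dividing by the
    degree once turns the expectation into [M] times the degree inner product. *)
Definition collision (M : R) (u w : nat * nat) : R :=
  if Nat.eqb (fst u) (fst w) then M / INR (snd u) else 0.

Definition collision_mean (M : R) (r : nat) (us ws : list (nat * nat)) : R :=
  rsum us (fun u => rsum ws (collision M u)) / (INR r * INR r).

Section Collisions.
Context (n : nat) (adj : nat -> list nat) (Hn : (0 < n)%nat).
Context (Hsg : simple_graph n adj).
Context (Hdeg : forall v, (v < n)%nat -> (1 <= deg adj v)%nat).
Local Notation d := (rdeg adj).
Local Notation V := (seq 0 n).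
Local Notation ip := (deg_ip n adj).
Local Notation iter := (lazy_iter adj).
Local Notation dens := (walk_density adj).
Local Notation M := (tvol n adj).
Local Notation E := (expect n adj).

Lemma tvol_pos : 0 < M.
Proof.
  apply Rlt_le_trans with (d 0%nat).
  - pose proof (rdeg_ge1 n adj Hdeg 0%nat Hn). lra.
  - apply (rsum_ge_term V (rdeg adj)); [intros; apply pos_INR|apply in_seq; lia].
Qed.

Lemma expect_walk t v h : (v < n)%nat ->
  E (walk t v) h = iter t (fun u => h (u, deg adj u)) v.
Proof.
  revert v. induction t as [|t IH]; intros v Hv; [reflexivity|].
  pose proof (rdeg_ge1 n adj Hdeg v Hv) as Hd1.
  change (iter (S t) (fun u => h (u, deg adj u)) v) with
    (lazy_step adj (iter t (fun u => h (u, deg adj u))) v).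
  rewrite <- (lazy_step_ext n adj Hsg (fun u => E (walk t u) h)) by auto.
  cbn [walk expect].
  rewrite expect_bind, (expect_unif n adj Hn) by (specialize (Hdeg v Hv); unfold deg in Hdeg; lia).
  unfold lazy_step. fold (deg adj v).
  assert (Hs : rsum (seq 0 (deg adj v)) (fun i => E (PNbr v (S i) (fun o =>
      walk t match o with Some u => u | None => v end)) h) = rsum (adj v) (fun u => E (walk t u) h)).
  { rewrite (rsum_nth (adj v) 0%nat). apply rsum_ext. intros i Hi. apply in_seq in Hi.
    cbn [expect]. unfold nbr_answer, deg in *.
    replace (Nat.leb 1 (S i) && Nat.leb (S i) (length (adj v))) with true.
    - replace (S i - 1)%nat with i by lia. reflexivity.
    - symmetry. apply andb_true_intro. split; apply Nat.leb_le; lia. }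
  rewrite Hs. unfold rdeg. simpl (INR 2). field. apply not_0_INR. specialize (Hdeg v Hv). lia.
Qed.

Lemma lazy_iter_mono t f g v : (v < n)%nat -> (forall u, (u < n)%nat -> f u <= g u) ->
  iter t f v <= iter t g v.
Proof.
  intros Hv Hfg. rewrite <- !(ip_walk_density n adj Hsg Hdeg) by auto.
  apply rsum_le. intros u Hu. apply in_seq in Hu.
  apply Rmult_le_compat_l; [apply pos_INR|]. apply Rmult_le_compat_l; [|apply Hfg; lia].
  apply (walk_density_nonneg n adj Hsg Hdeg); lia.
Qed.

Lemma ip_point f y c : (y < n)%nat ->
  ip f (fun x => if Nat.eqb x y then c / d x else 0) = c * f y.
Proof.
  intros Hy. pose proof (rdeg_ge1 n adj Hdeg y Hy). unfold deg_ip.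
  rewrite (rsum_ext _ _ (fun x => if Nat.eqb x y then c * f y else 0)).
  - apply (rsum_delta_nat V y (fun _ => c * f y)); [apply seq_NoDup|apply in_seq; lia].
  - intros x _. destruct (Nat.eqb_spec x y) as [->|]; [field; lra|ring].
Qed.

Lemma expect_collision_l t a y e : (a < n)%nat -> (y < n)%nat ->
  E (walk t a) (fun u => collision M u (y, e)) = M * dens t a y.
Proof.
  intros Ha Hy. rewrite expect_walk, <- (ip_walk_density n adj Hsg Hdeg) by auto.
  rewrite <- ip_point by auto. reflexivity.
Qed.

Lemma expect_collision_r t b x : (b < n)%nat -> (x < n)%nat ->
  E (walk t b) (collision M (x, deg adj x)) = M * dens t b x.
Proof.
  intros Hb Hx. rewrite expect_walk, <- (ip_walk_density n adj Hsg Hdeg) by auto.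
  rewrite <- ip_point by auto. apply ip_ext; [reflexivity|]. intros y _. unfold collision. cbn [fst snd].
  rewrite (Nat.eqb_sym x). destruct (Nat.eqb_spec y x) as [->|]; reflexivity.
Qed.

Lemma expect_collision t a b : (a < n)%nat -> (b < n)%nat ->
  E (walk t a) (fun u => E (walk t b) (collision M u)) = gram n adj t a b.
Proof.
  intros Ha Hb. rewrite expect_walk by auto.
  rewrite (lazy_iter_ext n adj Hsg t _ (fun x => M * dens t b x)) by (auto; intros; apply expect_collision_r; auto).
  rewrite <- (ip_walk_density n adj Hsg Hdeg) by auto. rewrite ip_scal_r. reflexivity.
Qed.

(** A single term of the square norm of the density, together with d_y >= 1, bounds its value at
    [y]. *)
Lemma density_bound t a N y : (a < n)%nat -> (y < n)%nat -> gram n adj t a a <= N ->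
  0 <= M * dens t a y <= sqrt (M * N).
Proof.
  intros Ha Hy HN. pose proof tvol_pos as HM.
  assert (H0 : 0 <= dens t a y) by (apply (walk_density_nonneg n adj Hsg Hdeg); auto).
  split; [apply Rmult_le_pos; lra|].
  rewrite <- (sqrt_square (M * dens t a y)) by (apply Rmult_le_pos; lra).
  apply sqrt_le_1_alt.
  apply Rle_trans with (M * gram n adj t a a); [|apply Rmult_le_compat_l; lra].
  unfold gram. replace (M * dens t a y * (M * dens t a y)) with (M * (M * (dens t a y * dens t a y))) by ring.
  apply Rmult_le_compat_l; [lra|]. apply Rmult_le_compat_l; [lra|].
  apply Rle_trans with (d y * (dens t a y * dens t a y)).
  - pose proof (rdeg_ge1 n adj Hdeg y Hy). assert (0 <= dens t a y * dens t a y) by apply Rle_0_sqr. nra.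
  - apply (rsum_ge_term V (fun y => d y * (dens t a y * dens t a y))); [|apply in_seq; lia].
    intros; apply Rmult_le_pos; [apply pos_INR|apply Rle_0_sqr].
Qed.

Lemma gram_le t a b N : (a < n)%nat -> (b < n)%nat -> 0 <= N ->
  gram n adj t a a <= N -> gram n adj t b b <= N -> 0 <= gram n adj t a b <= N.
Proof.
  intros Ha Hb HN HNa HNb. pose proof tvol_pos as HM.
  assert (H0 : 0 <= gram n adj t a b) by (apply gram_nonneg; auto).
  split; [exact H0|].
  pose proof (gram_nonneg n adj Hsg Hdeg t b b Hb Hb).
  pose proof (gram_nonneg n adj Hsg Hdeg t a a Ha Ha).
  pose proof (ip_cauchy_schwarz n adj (dens t a) (dens t b)) as Hcs.
  assert (gram n adj t a b * gram n adj t a b <= gram n adj t a a * gram n adj t b b).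
  { unfold gram.
    replace (M * ip (dens t a) (dens t b) * (M * ip (dens t a) (dens t b)))
      with (M * M * (ip (dens t a) (dens t b) * ip (dens t a) (dens t b))) by ring.
    replace (M * ip (dens t a) (dens t a) * (M * ip (dens t b) (dens t b)))
      with (M * M * (ip (dens t a) (dens t a) * ip (dens t b) (dens t b))) by ring.
    apply Rmult_le_compat_l; [apply Rle_0_sqr|exact Hcs]. }
  nra.
Qed.

(** The kernel is at most [M], so its second moment is at most M N, and its marginals are at most
    sqrt(M N), so their second moments are at most N sqrt(M N). Division by r^2 and r makes all
    terms O(N^2 / om) once r >= om sqrt(M): the birthday bound. *)
Lemma collision_variance t a b r N om :
  (a < n)%nat -> (b < n)%nat -> (0 < r)%nat -> 1 <= N -> 1 <= om -> om * sqrt M <= INR r ->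
  gram n adj t a a <= N -> gram n adj t b b <= N ->
  E (rep r (walk t a)) (fun us => E (rep r (walk t b)) (fun ws =>
    (collision_mean M r us ws - gram n adj t a b) * (collision_mean M r us ws - gram n adj t a b)))
  <= 3 * (N * N) / om.
Proof.
  intros Ha Hb Hr HN Hom Hrom HNa HNb. pose proof tvol_pos as HM.
  pose proof (gram_le t a b N Ha Hb ltac:(lra) HNa HNb) as HG.
  pose proof (expect_kernel_mean n adj Hn (walk t a) (walk t b) (collision M) r Hr) as Hk.
  cbv zeta in Hk. rewrite expect_collision in Hk by auto.
  unfold collision_mean. eapply Rle_trans; [exact Hk|]. clear Hk.
  set (A1 := E (walk t a) (fun u => E (walk t b) (fun w => collision M u w * collision M u w))).
  set (B1 := E (walk t a) (fun u => E (walk t b) (collision M u) * E (walk t b) (collision M u))).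
  set (B2 := E (walk t b) (fun w => E (walk t a) (fun u => collision M u w) * E (walk t a) (fun u => collision M u w))).
  assert (HA : A1 <= M * N).
  { apply Rle_trans with (M * gram n adj t a b); [|apply Rmult_le_compat_l; lra].
    rewrite <- expect_collision by auto. unfold A1. rewrite <- expect_scal.
    apply (expect_le n adj Hn). intros u. rewrite <- expect_scal. apply (expect_le n adj Hn). intros w.
    unfold collision. destruct (Nat.eqb (fst u) (fst w)); [|lra].
    (* The bound covers arbitrary recorded pairs, including degree 0, where division yields 0. *)
    assert (Hc : 0 <= M / INR (snd u) <= M).
    { destruct (snd u) as [|e].
      - unfold Rdiv. simpl. rewrite Rinv_0. lra.
      - pose proof (inv_INR_S e). unfold Rdiv. nra. }
    apply Rmult_le_compat_r; lra. }
  set (q := sqrt (M * N)).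
  assert (HB1 : B1 <= q * N).
  { apply Rle_trans with (q * gram n adj t a b); [|apply Rmult_le_compat_l; [apply sqrt_pos|lra]].
    rewrite <- expect_collision by auto. unfold B1. rewrite <- expect_scal, !expect_walk by auto.
    apply lazy_iter_mono; auto. intros x Hx. rewrite expect_collision_r by auto.
    pose proof (density_bound t b N x Hb Hx HNb). fold q in H. apply Rmult_le_compat_r; lra. }
  assert (HB2 : B2 <= q * N).
  { apply Rle_trans with (q * gram n adj t a b); [|apply Rmult_le_compat_l; [apply sqrt_pos|lra]].
    rewrite <- expect_collision by auto. rewrite (expect_swap n adj Hn).
    unfold B2. rewrite <- expect_scal, !expect_walk by auto.
    apply lazy_iter_mono; auto. intros y Hy. rewrite expect_collision_l by auto.
    pose proof (density_bound t a N y Ha Hy HNa). fold q in H. apply Rmult_le_compat_r; lra. }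
  assert (Hq : q <= sqrt M * N).
  { unfold q. rewrite sqrt_mult by lra. apply Rmult_le_compat_l; [apply sqrt_pos|].
    rewrite <- (sqrt_square N) at 2 by lra. apply sqrt_le_1_alt. nra. }
  assert (HsM : 0 < sqrt M) by (apply sqrt_lt_R0; auto).
  assert (HrR : 0 < INR r) by (apply lt_0_INR; auto).
  set (z := sqrt M / INR r).
  assert (Hz : 0 < z <= / om).
  { unfold z. split; [apply Rdiv_lt_0_compat; auto|].
    apply Rmult_le_reg_r with (INR r * om); [apply Rmult_lt_0_compat; lra|].
    replace (sqrt M / INR r * (INR r * om)) with (om * sqrt M) by (field; lra).
    replace (/ om * (INR r * om)) with (INR r) by (field; lra). exact Hrom. }
  assert (Hom1 : 0 < / om <= 1).
  { split; [apply Rinv_0_lt_compat; lra|]. rewrite <- Rinv_1. apply Rinv_le_contravar; lra. }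
  assert (T1 : A1 / (INR r * INR r) <= N * (/ om)).
  { apply Rle_trans with (M * N / (INR r * INR r)).
    - apply Rmult_le_compat_r; [left; apply Rinv_0_lt_compat, Rmult_lt_0_compat; auto|exact HA].
    - replace (M * N / (INR r * INR r)) with (N * (z * z)).
      + apply Rmult_le_compat_l; [lra|]. nra.
      + unfold z. rewrite <- (sqrt_sqrt M) at 3 by lra. field. lra. }
  assert (T2 : (B1 + B2) / INR r <= 2 * (N * N) * / om).
  { apply Rle_trans with (2 * (sqrt M * N * N) / INR r).
    - apply Rmult_le_compat_r; [left; apply Rinv_0_lt_compat; auto|]. nra.
    - replace (2 * (sqrt M * N * N) / INR r) with (2 * (N * N) * z) by (unfold z; field; lra).
      apply Rmult_le_compat_l; [nra|lra]. }
  assert (N * / om <= N * N * / om) by (apply Rmult_le_compat_r; nra).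
  unfold Rdiv in *. lra.
Qed.

Definition sketch (t r v : nat) : Prog (list (nat * nat)) := rep r (walk t v).

Definition estimate (M : R) (r : nat) (us ws : list (list (nat * nat))) (a b : nat) : R :=
  collision_mean M r (nth a us []) (nth b ws []).

(** Because the two batches are independent, each entry compares independent walks, even on the
    diagonal and at repeated sample vertices. *)
Lemma expect_estimate t r vs a b (f : R -> R) : (a < length vs)%nat -> (b < length vs)%nat ->
  E (map_prog (sketch t r) vs) (fun us => E (map_prog (sketch t r) vs) (fun ws =>
    f (estimate M r us ws a b)))
  = E (rep r (walk t (nth a vs 0%nat))) (fun us => E (rep r (walk t (nth b vs 0%nat))) (fun ws =>
    f (collision_mean M r us ws))).
Proof.
  intros Ha Hb. unfold estimate.
  rewrite (expect_map_prog n adj Hn (sketch t r) vs 0%nat [] a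
    (fun us => E (map_prog (sketch t r) vs) (fun ws => f (collision_mean M r us (nth b ws []))))) by auto.
  apply expect_ext. intros us.
  apply (expect_map_prog n adj Hn (sketch t r) vs 0%nat [] b (fun ws => f (collision_mean M r us ws))); auto.
Qed.

Lemma expect_frob t r vs N om :
  (forall v, In v vs -> (v < n)%nat /\ gram n adj t v v <= N) ->
  (0 < r)%nat -> 1 <= N -> 1 <= om -> om * sqrt M <= INR r ->
  E (map_prog (sketch t r) vs) (fun us => E (map_prog (sketch t r) vs) (fun ws =>
    frob (fun a b => estimate M r us ws a b - sgram n adj t vs a b) (length vs)))
  <= INR (length vs) * INR (length vs) * (3 * (N * N) / om).
Proof.
  intros Hvs Hr HN Hom Hrom. unfold frob. set (L := length vs).
  rewrite (expect_ext n adj _ _ (fun us => rsum (seq 0 L) (fun a => rsum (seq 0 L) (fun b =>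
    E (map_prog (sketch t r) vs) (fun ws => (estimate M r us ws a b - sgram n adj t vs a b)
      * (estimate M r us ws a b - sgram n adj t vs a b)))))).
  2: { intros us. rewrite (expect_rsum n adj Hn). apply rsum_ext. intros a _. apply (expect_rsum n adj Hn). }
  rewrite (expect_rsum n adj Hn).
  apply Rle_trans with (rsum (seq 0 L) (fun _ => rsum (seq 0 L) (fun _ => 3 * (N * N) / om))).
  - apply rsum_le. intros a Ha. apply in_seq in Ha. rewrite (expect_rsum n adj Hn).
    apply rsum_le. intros b Hb. apply in_seq in Hb.
    rewrite (expect_estimate t r vs a b (fun z => (z - sgram n adj t vs a b) * (z - sgram n adj t vs a b)))
      by (unfold L in *; lia).
    destruct (Hvs (nth a vs 0%nat)) as [Ha1 Ha2]; [apply nth_In; unfold L in *; lia|].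
    destruct (Hvs (nth b vs 0%nat)) as [Hb1 Hb2]; [apply nth_In; unfold L in *; lia|].
    apply collision_variance; auto.
  - rewrite !rsum_const, length_seq. lra.
Qed.

End Collisions.

(** * Sampling vertices roughly in proportion to their degrees *)

(* A vertex of degree at most [T] is returned with probability proportional to its degree.
   Few vertices have a larger degree, so most neighbours of such a vertex have degree at
   most [T], and it is reached by crossing a random edge out of a sampled vertex. *)
Definition trial (T : nat) : Prog (option nat) :=
  PRand (fun v => PDeg v (fun d =>
    if Nat.leb d T then
      bind (unif T) (fun i =>
        if Nat.ltb i d then
          PBern 1 (fun b => if b then Ret (Some v) else
            PNbr v (S i) (fun o =>
              match o with
              | Some u => PDeg u (fun e => Ret (if Nat.ltb T e then Some u else None))
              | None => Ret None
              end))
        else Ret None)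
    else Ret None)).

Fixpoint sampler (T Q : nat) : Prog (option nat) :=
  match Q with
  | O => Ret None
  | S Q' => bind (trial T) (fun o => match o with Some v => Ret (Some v) | None => sampler T Q' end)
  end.

Fixpoint somes (l : list (option nat)) : list nat :=
  match l with
  | [] => []
  | Some v :: l' => v :: somes l'
  | None :: l' => somes l'
  end.

Definition sample (T Q s : nat) : Prog (list nat) :=
  bind (rep s (sampler T Q)) (fun l => Ret (somes l)).

Lemma pspec_trial T : pspec 4 (fun _ => True) (trial T).
Proof.
  simpl. intros v d. destruct (Nat.leb d T); [|simpl; auto].
  apply (pspec_bind 0 2 (fun _ => True)); [apply pspec_unif|].
  intros i _. destruct (Nat.ltb i d); simpl; auto.
  intros []; simpl; auto. intros [u|]; simpl; auto.
Qed.

Lemma pspec_sampler T Q : pspec (Q * 4) (fun _ => True) (sampler T Q).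
Proof.
  induction Q as [|Q IH]; [simpl; auto|].
  cbn [sampler]. replace (S Q * 4)%nat with (4 + Q * 4)%nat by lia.
  apply (pspec_bind 4 (Q * 4) (fun _ => True)); [apply pspec_trial|].
  intros [v|] _; [|exact IH]. simpl. auto.
Qed.

Lemma length_somes l : (length (somes l) <= length l)%nat.
Proof. induction l as [|[v|] l IH]; simpl; lia. Qed.

Lemma in_somes l v : In v (somes l) -> In (Some v) l.
Proof. induction l as [|[u|] l IH]; simpl; [tauto| |auto]. intros [->|H]; auto. Qed.

Lemma rsum_somes l g :
  rsum (somes l) g = rsum l (fun o => match o with Some v => g v | None => 0 end).
Proof.
  induction l as [|[v|] l IH]; [reflexivity| |]; cbn [somes]; rewrite !rsum_cons, IH; lra.
Qed.

Lemma pspec_sample T Q s : pspec (s * (Q * 4)) (fun vs => (length vs <= s)%nat) (sample T Q s).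
Proof.
  rewrite <- (Nat.add_0_r (s * (Q * 4))).
  apply (pspec_bind _ 0 (fun l => length l = s)).
  - apply (pspec_rep (Q * 4) (fun _ => True)), pspec_sampler.
  - intros l <-. simpl. apply length_somes.
Qed.

Section Sampling.
Context (n : nat) (adj : nat -> list nat) (Hn : (0 < n)%nat).
Context (Hsg : simple_graph n adj).
Context (Hdeg : forall v, (v < n)%nat -> (1 <= deg adj v)%nat).
Local Notation d := (rdeg adj).
Local Notation V := (seq 0 n).
Local Notation M := (tvol n adj).
Local Notation E := (expect n adj).
Local Notation esum := (edge_sum n adj).
Context (T : nat) (HT : (0 < T)%nat).

Definition light_degree (v : nat) : R :=
  if Nat.leb (deg adj v) T then d v
  else rsum (adj v) (fun u => if Nat.leb (deg adj u) T then 1 else 0).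

Definition trial_weight (v : nat) : R := light_degree v / (2 * INR n * INR T).

(** [trial_weight v] is the probability that one trial returns [v]: a factor 1/n for the vertex, 1/T
    for the index and 1/2 for the coin, times the number of edges at [v] that lead to this
    outcome. *)
Lemma expect_trial h : h None = 0 ->
  E (trial T) h = rsum V (fun v => trial_weight v * h (Some v)).
Proof.
  intros Hh.
  assert (HnR : 0 < INR n) by (apply lt_0_INR; auto).
  assert (HTR : 0 < INR T) by (apply lt_0_INR; auto).
  set (hv := fun v => h (Some v)).
  assert (Hbody : forall v, (v < n)%nat ->
    E (PDeg v (fun e => if Nat.leb e T then bind (unif T) (fun i => if Nat.ltb i e then
          PBern 1 (fun b => if b then Ret (Some v) else PNbr v (S i) (fun o =>
              match o with Some u => PDeg u (fun e' => Ret (if Nat.ltb T e' then Some u else None))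
              | None => Ret None end)) else Ret None) else Ret None)) h
    = / (2 * INR T) * (if Nat.leb (deg adj v) T then d v * hv v
        + rsum (adj v) (fun u => if Nat.leb (deg adj u) T then 0 else hv u) else 0)).
  { intros v Hv. cbn [expect]. fold (deg adj v).
    destruct (Nat.leb_spec (deg adj v) T) as [Hle|Hgt]; [|cbn [expect]; rewrite Hh; ring].
    rewrite expect_bind, (expect_unif n adj Hn) by auto.
    assert (Hseq : seq 0 T = seq 0 (deg adj v) ++ seq (deg adj v) (T - deg adj v)).
    { replace T with (deg adj v + (T - deg adj v))%nat at 1 by lia. apply seq_app. }
    rewrite Hseq, rsum_app, (rsum_zero (seq (deg adj v) _)).
    2: { intros i Hi. apply in_seq in Hi. destruct (Nat.ltb_spec i (deg adj v)); [lia|]. exact Hh. }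
    rewrite (rsum_ext _ _ (fun i => / 2 * hv v + / 2 *
       (if Nat.leb (deg adj (nth i (adj v) 0%nat)) T then 0 else hv (nth i (adj v) 0%nat)))).
    - rewrite rsum_plus, rsum_const, rsum_scal, length_seq.
      unfold deg at 2. rewrite <- (rsum_nth (adj v) 0%nat (fun u => if Nat.leb (deg adj u) T then 0 else hv u)).
      fold (d v). field. lra.
    - intros i Hi. apply in_seq in Hi. destruct (Nat.ltb_spec i (deg adj v)); [|lia].
      cbn [expect]. unfold nbr_answer.
      replace (Nat.leb 1 (S i) && Nat.leb (S i) (length (adj v))) with true
        by (symmetry; apply andb_true_intro; split; apply Nat.leb_le; unfold deg in *; lia).
      replace (S i - 1)%nat with i by lia. cbn [expect]. fold (deg adj (nth i (adj v) 0%nat)).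
      unfold hv. destruct (Nat.leb_spec (deg adj (nth i (adj v) 0%nat)) T),
        (Nat.ltb_spec T (deg adj (nth i (adj v) 0%nat))); try lia; simpl (INR 2); rewrite ?Hh; field. }
  unfold trial. cbn [expect]. cbn [expect] in Hbody.
  rewrite (rsum_ext _ _ _ (fun v Hv => Hbody v (proj2 (proj1 (in_seq n 0 v) Hv)))).
  rewrite rsum_scal.
  (* Edges between light and heavy vertices, counted from the light end on the left and from the
     heavy end on the right. *)
  assert (Hcross : rsum V (fun v => if Nat.leb (deg adj v) T then
      rsum (adj v) (fun u => if Nat.leb (deg adj u) T then 0 else hv u) else 0)
    = rsum V (fun v => if Nat.leb (deg adj v) T then 0 else
        rsum (adj v) (fun u => if Nat.leb (deg adj u) T then 1 else 0) * hv v)).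
  { transitivity (esum (fun v u => if Nat.leb (deg adj v) T then
        (if Nat.leb (deg adj u) T then 0 else hv u) else 0)).
    - apply rsum_ext. intros v _. destruct (Nat.leb (deg adj v) T); [reflexivity|].
      symmetry. apply rsum_zero. reflexivity.
    - rewrite (esum_sym n adj Hsg). apply rsum_ext. intros v _.
      destruct (Nat.leb (deg adj v) T).
      + apply rsum_zero. intros u _. destruct (Nat.leb (deg adj u) T); reflexivity.
      + rewrite <- rsum_scal_r. apply rsum_ext. intros u _. destruct (Nat.leb (deg adj u) T); ring. }
  rewrite (rsum_ext V _ (fun v => (if Nat.leb (deg adj v) T then d v * hv v else 0) +
     (if Nat.leb (deg adj v) T then
      rsum (adj v) (fun u => if Nat.leb (deg adj u) T then 0 else hv u) else 0)))
    by (intros v _; destruct (Nat.leb (deg adj v) T); ring).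
  rewrite rsum_plus, Hcross, <- rsum_plus.
  unfold Rdiv. rewrite <- rsum_scal, <- rsum_scal_r. apply rsum_ext. intros v _.
  unfold trial_weight, light_degree. fold (hv v).
  destruct (Nat.leb (deg adj v) T); field; lra.
Qed.

(** At most M/T <= T/2 vertices have degree above [T]. A vertex of degree above [T] has distinct
    neighbours, so at least half of them are light. *)
Lemma light_degree_bounds v : (v < n)%nat -> 2 * M <= INR T * INR T ->
  d v / 2 <= light_degree v <= d v.
Proof.
  intros Hv HTM. unfold light_degree. pose proof (rdeg_ge1 n adj Hdeg v Hv) as Hd1.
  assert (HTR : 0 < INR T) by (apply lt_0_INR; auto).
  destruct (Nat.leb_spec (deg adj v) T) as [Hle|Hgt]; [lra|].
  apply lt_INR in Hgt. fold (d v) in Hgt.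
  set (hv := rsum (adj v) (fun u => if Nat.leb (deg adj u) T then 0 else 1)).
  assert (Hsum : rsum (adj v) (fun u => if Nat.leb (deg adj u) T then 1 else 0) + hv = d v).
  { unfold hv. rewrite <- rsum_plus, (rsum_ext _ _ (fun _ => 1)).
    - rewrite rsum_const. unfold rdeg, deg. ring.
    - intros u _. destruct (Nat.leb (deg adj u) T); ring. }
  assert (H0 : 0 <= hv) by (apply rsum_nonneg; intros u _; destruct (Nat.leb (deg adj u) T); lra).
  assert (Hheavy : hv * INR T <= M).
  { set (g := fun u => if Nat.leb (deg adj u) T then 0 else 1).
    assert (Hin : hv <= rsum V g).
    { unfold hv. fold g.
      rewrite (rsum_ext (adj v) g (fun u => rsum V (fun w => if Nat.eqb w u then g w else 0))).
      - rewrite rsum_swap. apply rsum_le. intros w Hw.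
        assert (Hgw : 0 <= g w) by (unfold g; destruct (Nat.leb (deg adj w) T); lra).
        destruct (in_dec Nat.eq_dec w (adj v)) as [Hi|Ho].
        + right. rewrite (rsum_ext _ _ (fun u => if Nat.eqb u w then g w else 0))
            by (intros; rewrite Nat.eqb_sym; reflexivity).
          apply (rsum_delta_nat (adj v) w (fun _ => g w)); [apply Hsg|exact Hi].
        + rewrite rsum_zero; [exact Hgw|]. intros u Hu. destruct (Nat.eqb_spec w u); [subst; tauto|reflexivity].
      - intros u Hu. symmetry. apply rsum_delta_nat; [apply seq_NoDup|].
        apply (adj_lt n adj Hsg) in Hu. apply in_seq; lia. }
    apply Rle_trans with (rsum V g * INR T); [apply Rmult_le_compat_r; lra|].
    rewrite <- rsum_scal_r. apply rsum_le. intros u _. unfold g.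
    destruct (Nat.leb_spec (deg adj u) T) as [|H]; [rewrite Rmult_0_l; apply pos_INR|].
    apply lt_INR in H. fold (d u) in H. lra. }
  assert (hv <= INR T / 2) by (apply Rmult_le_reg_r with (INR T); [auto|lra]).
  lra.
Qed.

Lemma always_trial : always n adj (fun o => forall v, o = Some v -> (v < n)%nat) (trial T).
Proof.
  simpl. intros v Hv. destruct (Nat.leb (length (adj v)) T); [|simpl; congruence].
  eapply always_bind; [apply always_true|]. intros i _.
  destruct (Nat.ltb i (length (adj v))); [|simpl; congruence].
  simpl. intros [|]; simpl; [congruence|].
  unfold nbr_answer. destruct (_ && _) eqn:E; simpl; [|congruence].
  intros u Hu. destruct (Nat.ltb T _); [|congruence]. injection Hu as <-.
  apply (adj_lt n adj Hsg v). apply nth_In. apply andb_prop in E as [_ E]. apply Nat.leb_le in E. lia.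
Qed.

Lemma always_sampler Q : always n adj (fun o => forall v, o = Some v -> (v < n)%nat) (sampler T Q).
Proof.
  induction Q as [|Q IH]; [simpl; congruence|]. cbn [sampler].
  eapply always_bind; [apply always_trial|]. intros [v|] H; [exact H|exact IH].
Qed.

Lemma always_sample Q s : always n adj (fun vs => (length vs <= s)%nat /\ forall v, In v vs -> (v < n)%nat)
  (sample T Q s).
Proof.
  unfold sample. eapply always_bind; [apply (always_rep n adj Hn), always_sampler|].
  intros l [Hl HP]. simpl. split; [rewrite <- Hl; apply length_somes|].
  intros v Hv. apply in_somes in Hv. eapply HP; eauto.
Qed.

(** The lower bound on [sigma] limits the importance weights in the unclusterable case; the upper
    bound makes heavy-collision vertices rare in the sample of a clusterable graph. *)
Lemma sampler_weights : 2 * M <= INR T * INR T ->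
  exists sigma : nat -> R,
    (forall v, (v < n)%nat -> 0 < sigma v /\ d v / sigma v <= 4 * M /\ sigma v <= 2 * d v / M) /\
    forall h, h None = 0 -> E (sampler T (4 * T)) h = rsum V (fun v => sigma v * h (Some v)).
Proof.
  intros HTM.
  assert (HnR : 0 < INR n) by (apply lt_0_INR; auto).
  assert (HTR : 0 < INR T) by (apply lt_0_INR; auto).
  pose proof (tvol_pos n adj Hn Hdeg) as HM.
  set (p := rsum V trial_weight).
  assert (Hp1 : p <= 1).
  { rewrite <- (expect_const n adj Hn (trial T) 1).
    apply Rle_trans with (E (trial T) (fun o => match o with Some _ => 1 | None => 0 end)).
    - rewrite expect_trial by reflexivity. right. apply rsum_ext. intros; ring.
    - apply (expect_le n adj Hn). intros [|]; lra. }
  assert (Hw : forall v, (v < n)%nat ->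
    d v / (4 * INR n * INR T) <= trial_weight v <= d v / (2 * INR n * INR T)).
  { intros v Hv. pose proof (light_degree_bounds v Hv HTM). unfold trial_weight.
    assert (0 < / (2 * INR n * INR T)) by (apply Rinv_0_lt_compat, Rmult_lt_0_compat; lra).
    replace (d v / (4 * INR n * INR T)) with (d v / 2 * / (2 * INR n * INR T)) by (field; lra).
    unfold Rdiv in *. split; apply Rmult_le_compat_r; lra. }
  assert (Hp4 : M / (4 * INR n * INR T) <= p).
  { unfold p, tvol, Rdiv. rewrite <- rsum_scal_r. apply rsum_le. intros v Hv. apply in_seq in Hv.
    apply Hw. lia. }
  assert (HnM : INR n <= M).
  { rewrite <- (Rmult_1_r (INR n)). replace (INR n) with (INR (length V)) by (rewrite length_seq; reflexivity).
    rewrite <- rsum_const. apply rsum_le. intros v Hv. apply in_seq in Hv. apply (rdeg_ge1 n adj Hdeg). lia. }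
  (* This fixes the number of trials: p >= M / (4 n T), and M >= n as all degrees are positive. *)
  assert (HpT : 1 <= p * INR (4 * T)).
  { rewrite mult_INR. simpl (INR 4).
    apply Rle_trans with (M / (4 * INR n * INR T) * (4 * INR T)).
    - replace (M / (4 * INR n * INR T) * (4 * INR T)) with (M / INR n) by (field; lra).
      apply Rmult_le_reg_r with (INR n); [auto|]. unfold Rdiv. rewrite Rmult_assoc, Rinv_l by lra. lra.
    - replace ((1 + 1 + 1 + 1) * INR T) with (4 * INR T) by ring. apply Rmult_le_compat_r; lra. }
  assert (Hp0 : 0 < p).
  { eapply Rlt_le_trans; [|exact Hp4]. apply Rdiv_lt_0_compat; [lra|].
    apply Rmult_lt_0_compat; lra. }
  (* Repetition multiplies all trial weights by a common factor [g], leaving the law of a success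
     unchanged. *)
  assert (Hloop : forall Q, exists g, g * p = 1 - (1 - p) ^ Q /\
    forall h, h None = 0 -> E (sampler T Q) h = g * rsum V (fun v => trial_weight v * h (Some v))).
  { induction Q as [|Q [g [Hg IH]]].
    - exists 0. split; [simpl; ring|]. intros h Hh. simpl. rewrite Hh. ring.
    - exists (1 + (1 - p) * g). split; [simpl; rewrite Rmult_plus_distr_r, Rmult_assoc, Hg; ring|].
      intros h Hh. cbn [sampler]. rewrite expect_bind.
      set (z := E (sampler T Q) h).
      rewrite (expect_ext n adj _ _ (fun o => z + match o with Some v => h (Some v) - z | None => 0 end))
        by (intros [v|]; simpl; unfold z; ring).
      rewrite expect_plus, (expect_const n adj Hn), expect_trial by reflexivity.
      rewrite (rsum_ext _ _ (fun v => trial_weight v * h (Some v) - trial_weight v * z)) by (intros; ring).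
      rewrite rsum_minus, rsum_scal_r. fold p. unfold z. rewrite IH by auto. ring. }
  destruct (Hloop (4 * T)%nat) as [g [Hg Hexp]].
  (* At Q = 4T this makes total failure at most 1/(1 + pQ) <= 1/2. *)
  assert (Hbern : forall Q, (1 - p) ^ Q * (1 + p * INR Q) <= 1).
  { induction Q as [|Q IH]; [simpl; lra|]. rewrite S_INR. simpl.
    pose proof (pos_INR Q). assert (0 <= (1 - p) ^ Q) by (apply pow_le; lra).
    apply Rle_trans with ((1 - p) ^ Q * (1 + p * INR Q)); [|exact IH].
    replace ((1 - p) * (1 - p) ^ Q * (1 + p * (INR Q + 1)))
      with ((1 - p) ^ Q * ((1 - p) * (1 + p * (INR Q + 1)))) by ring.
    apply Rmult_le_compat_l; [auto|]. nra. }
  assert (Hhalf : 0 <= (1 - p) ^ (4 * T) <= 1 / 2).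
  { assert (0 <= (1 - p) ^ (4 * T)) by (apply pow_le; lra). split; [auto|].
    specialize (Hbern (4 * T)%nat). nra. }
  assert (Hg0 : 0 < g) by nra.
  assert (HgM : g * M <= 4 * INR n * INR T).
  { apply Rmult_le_reg_r with (/ (4 * INR n * INR T)); [apply Rinv_0_lt_compat, Rmult_lt_0_compat; lra|].
    rewrite Rinv_r, Rmult_assoc by (apply Rgt_not_eq, Rmult_lt_0_compat; lra).
    unfold Rdiv in Hp4. apply Rle_trans with (g * p); [apply Rmult_le_compat_l; lra|]. lra. }
  assert (Hp2 : p <= M / (2 * INR n * INR T)).
  { unfold p, tvol, Rdiv. rewrite <- rsum_scal_r. apply rsum_le. intros v Hv. apply in_seq in Hv.
    apply Hw. lia. }
  assert (HgM2 : INR n * INR T <= g * M).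
  { apply Rmult_le_reg_r with (/ (2 * INR n * INR T)); [apply Rinv_0_lt_compat, Rmult_lt_0_compat; lra|].
    replace (INR n * INR T * / (2 * INR n * INR T)) with (1 / 2) by (field; lra).
    unfold Rdiv in Hp2. rewrite Rmult_assoc.
    apply Rle_trans with (g * p); [lra|]. apply Rmult_le_compat_l; lra. }
  exists (fun v => g * trial_weight v). split.
  - intros v Hv. pose proof (rdeg_ge1 n adj Hdeg v Hv) as Hd1. specialize (Hw v Hv).
    assert (HnT : 0 < INR n * INR T) by (apply Rmult_lt_0_compat; auto).
    assert (Hw0 : 0 < trial_weight v).
    { eapply Rlt_le_trans; [|apply Hw]. apply Rdiv_lt_0_compat; [lra|]. lra. }
    assert (Hs0 : 0 < g * trial_weight v) by (apply Rmult_lt_0_compat; auto).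
    split; [exact Hs0|]. split.
    + apply Rmult_le_reg_r with (g * trial_weight v); [exact Hs0|].
      unfold Rdiv. rewrite Rmult_assoc, Rinv_l, Rmult_1_r by lra.
      destruct Hw as [Hw _]. apply Rmult_le_compat_l with (r := 4 * (g * M)) in Hw; [|nra].
      replace (4 * M * (g * trial_weight v)) with (4 * (g * M) * trial_weight v) by ring.
      eapply Rle_trans; [|exact Hw].
      replace (4 * (g * M) * (d v / (4 * INR n * INR T))) with (g * M * (d v / (INR n * INR T))) by (field; lra).
      apply Rle_trans with (INR n * INR T * (d v / (INR n * INR T))); [right; field; lra|].
      apply Rmult_le_compat_r; [|exact HgM2]. left. apply Rdiv_lt_0_compat; lra.
    + destruct Hw as [_ Hw].
      apply Rle_trans with (g * (d v / (2 * INR n * INR T))); [apply Rmult_le_compat_l; lra|].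
      apply Rmult_le_reg_r with M; [exact HM|].
      replace (2 * d v / M * M) with (4 * INR n * INR T * (d v / (2 * INR n * INR T))) by (field; lra).
      replace (g * (d v / (2 * INR n * INR T)) * M) with (g * M * (d v / (2 * INR n * INR T))) by ring.
      apply Rmult_le_compat_r; [|exact HgM]. left. apply Rdiv_lt_0_compat; lra.
  - intros h Hh. rewrite Hexp by auto. rewrite <- rsum_scal. apply rsum_ext. intros; ring.
Qed.

Lemma expect_sample_sum Q sigma s g :
  (forall h, h None = 0 -> E (sampler T Q) h = rsum V (fun v => sigma v * h (Some v))) ->
  E (sample T Q s) (fun vs => rsum vs g) = INR s * rsum V (fun v => sigma v * g v).
Proof.
  intros Hs. unfold sample. rewrite expect_bind. cbn [expect].
  rewrite (expect_ext n adj _ _ (fun l => rsum l (fun o => match o with Some v => g v | None => 0 end)))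
    by (intros; apply rsum_somes).
  rewrite (expect_rep_sum n adj Hn), Hs; reflexivity.
Qed.

Lemma expect_sample_deviation Q sigma s g : (0 < s)%nat ->
  (forall h, h None = 0 -> E (sampler T Q) h = rsum V (fun v => sigma v * h (Some v))) ->
  let mean := rsum V (fun v => sigma v * g v) in
  E (sample T Q s) (fun vs => (/ INR s * rsum vs g - mean) * (/ INR s * rsum vs g - mean))
  <= rsum V (fun v => sigma v * (g v * g v)) / INR s.
Proof.
  intros Hs0 Hs mean. unfold sample. rewrite expect_bind. cbn [expect].
  set (g' := fun o : option nat => match o with Some v => g v | None => 0 end).
  rewrite (expect_ext n adj _ _ (fun l => (rsum l g' / INR s - mean) * (rsum l g' / INR s - mean)))
    by (intros; rewrite rsum_somes; unfold Rdiv; fold g'; rewrite (Rmult_comm (/ INR s)); reflexivity).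
  eapply Rle_trans; [apply (expect_rep_deviation n adj Hn); auto|].
  rewrite !Hs by (unfold g'; ring). unfold g', mean. right. ring.
Qed.

End Sampling.

(** * The tester *)

(** The strict inequality fails for the zero vector, so the second alternative forces the k+1
    vectors of [X] to be linearly independent on the sample. *)
Definition rejects (k : nat) (K theta : R) (G : nat -> nat -> R) (L : nat) : Prop :=
  (exists a, (a < L)%nat /\ 2 * K < G a a) \/
  (exists X, forall c, (exists j, (j < S k)%nat /\ c j <> 0) ->
     theta * sqn L (lincomb k X c) < qform G L (lincomb k X c)).

Definition verdict (k : nat) (K theta : R) (G : nat -> nat -> R) (L : nat) : bool :=
  if excluded_middle_informative (rejects k K theta G L) then false else true.

Definition tester (k : nat) (K theta M : R) (T s t r : nat) : Prog bool :=
  bind (sample T (4 * T) s) (fun vs =>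
  bind (map_prog (sketch t r) vs) (fun us =>
  bind (map_prog (sketch t r) vs) (fun ws =>
  Ret (verdict k K theta (estimate M r us ws) (length vs))))).

Lemma pspec_tester k K theta M T s t r :
  pspec (s * (4 * T * 4) + (s * (r * (2 * t + 1)) + s * (r * (2 * t + 1)))) (fun _ => True)
    (tester k K theta M T s t r).
Proof.
  assert (Hmap : forall vs, (length vs <= s)%nat ->
    pspec (s * (r * (2 * t + 1))) (fun _ => True) (map_prog (sketch t r) vs)).
  { intros vs Hvs. apply (pspec_weaken (length vs * (r * (2 * t + 1))) _ (fun _ => True)); auto.
    - apply Nat.mul_le_mono_r, Hvs.
    - apply (pspec_map _ (fun l => length l = r)). intros v.
      apply (pspec_rep _ (fun _ => True)), pspec_walk. }
  apply (pspec_bind _ _ (fun vs => (length vs <= s)%nat)); [apply pspec_sample|].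
  intros vs Hvs. apply (pspec_bind _ _ (fun _ => True)); [apply Hmap, Hvs|]. intros us _.
  rewrite <- (Nat.add_0_r (s * (r * (2 * t + 1)))).
  apply (pspec_bind _ 0 (fun _ => True)); [apply Hmap, Hvs|]. intros ws _. exact I.
Qed.

Lemma frob_ge_term D L a : (a < L)%nat -> D a a * D a a <= frob D L.
Proof.
  intros Ha.
  apply Rle_trans with (rsum (seq 0 L) (fun b => D a b * D a b)).
  - apply (rsum_ge_term (seq 0 L) (fun b => D a b * D a b)); [intros; apply Rle_0_sqr|apply in_seq; lia].
  - apply (rsum_ge_term (seq 0 L) (fun a => rsum (seq 0 L) (fun b => D a b * D a b)));
      [intros; apply rsum_nonneg; intros; apply Rle_0_sqr|apply in_seq; lia].
Qed.

Lemma frob_nonneg D L : 0 <= frob D L.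
Proof. apply rsum_nonneg. intros; apply rsum_nonneg; intros; apply Rle_0_sqr. Qed.

Lemma Rdiv_ge_one a b : 0 < b -> b <= a -> 1 <= a / b.
Proof.
  intros Hb H. apply Rmult_le_reg_r with b; [exact Hb|].
  unfold Rdiv. rewrite Rmult_assoc, Rinv_l by lra. lra.
Qed.

Lemma Rdiv_le_bound a b c : 0 < c -> a <= b * c -> a / c <= b.
Proof.
  intros Hc H. apply Rmult_le_reg_r with c; [exact Hc|].
  unfold Rdiv. rewrite Rmult_assoc, Rinv_l by lra. lra.
Qed.

Section Analysis.
Context (n : nat) (adj : nat -> list nat) (Hn : (0 < n)%nat).
Context (Hsg : simple_graph n adj).
Context (Hdeg : forall v, (v < n)%nat -> (1 <= deg adj v)%nat).
Local Notation d := (rdeg adj).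
Local Notation V := (seq 0 n).
Local Notation M := (tvol n adj).
Local Notation E := (expect n adj).
Context (k : nat) (Hk : (1 <= k)%nat) (tau om : R) (T s t r : nat).
Context (Htau : 0 < tau <= 1) (Hs : (0 < s)%nat) (Hr : (0 < r)%nat) (HT : (0 < T)%nat).
Context (HTM : 2 * M <= INR T * INR T).
(** In the clusterable case, the part 20 s k^2 of [K] makes the expected number of sampled vertices
    with diagonal entry above [K] at most 1/10. The threshold [theta] is twice the error [eta]:
    clusterable graphs have a direction with true form at most s tau / 32 = eta, unclusterable ones
    a subspace with at least s tau / 8 = 4 eta. *)
Local Notation K := (INR k + 1 + 20 * INR s * (INR k * INR k)).
Local Notation theta := (INR s * tau / 16).
Local Notation eta := (INR s * tau / 32).
Context (Hom : 491520 * (K * K) / (tau * tau) <= om) (Hrom : om * sqrt M <= INR r).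

Lemma threshold_ge : 1 <= INR s /\ 1 <= INR k /\ 1 <= K /\ INR s <= K.
Proof.
  assert (1 <= INR s) by (apply (le_INR 1); lia). assert (1 <= INR k) by (apply (le_INR 1); lia).
  assert (INR s * 1 <= INR s * (INR k * INR k)) by (apply Rmult_le_compat_l; nra).
  repeat split; nra.
Qed.

(** The constant is 48 * 10240: with diagonals up to 4K the error is at most 48 s^2 K^2 / om, to be
    compared with eta^2 / 10 = s^2 tau^2 / 10240. *)
Lemma precision_ge : 491520 <= om /\ 49152 * (K * K) / om <= tau * tau / 10.
Proof.
  destruct threshold_ge as [Hs1 [Hk1 [HK _]]].
  assert (Htt : 0 < tau * tau <= 1) by nra.
  set (q := K) in *.
  assert (H1 : 491520 * (q * q) <= om * (tau * tau)).
  { apply Rmult_le_reg_r with (/ (tau * tau)); [apply Rinv_0_lt_compat; lra|].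
    rewrite (Rmult_assoc om), Rinv_r, Rmult_1_r by lra. exact Hom. }
  assert (H2 : 491520 <= om) by nra.
  split; [exact H2|].
  apply Rmult_le_reg_r with om; [lra|]. unfold Rdiv. rewrite Rmult_assoc, Rinv_l by lra. nra.
Qed.

Lemma expect_tester h :
  E (tester k K theta M T s t r) h =
  E (sample T (4 * T) s) (fun vs => E (map_prog (sketch t r) vs) (fun us =>
    E (map_prog (sketch t r) vs) (fun ws => h (verdict k K theta (estimate M r us ws) (length vs))))).
Proof.
  unfold tester. rewrite expect_bind. apply expect_ext. intros vs.
  rewrite expect_bind. apply expect_ext. intros us. rewrite expect_bind. reflexivity.
Qed.

(** Prepared for Markov's inequality: the integrand is at least 1 whenever the Frobenius error
    reaches [eta]. *)
Lemma expect_frob_small vs N : (forall v, In v vs -> (v < n)%nat /\ gram n adj t v v <= N) ->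
  (length vs <= s)%nat -> 1 <= N <= 4 * K ->
  E (map_prog (sketch t r) vs) (fun us => E (map_prog (sketch t r) vs) (fun ws =>
    frob (fun a b => estimate M r us ws a b - sgram n adj t vs a b) (length vs) / (eta * eta)))
  <= / 10.
Proof.
  intros Hvs HL HN.
  destruct threshold_ge as [Hs1 [Hk1 [HK _]]]. destruct precision_ge as [Hom1 Hom2].
  set (q := K) in *.
  rewrite (expect_ext n adj _ _ (fun us => / (eta * eta) * E (map_prog (sketch t r) vs) (fun ws =>
    frob (fun a b => estimate M r us ws a b - sgram n adj t vs a b) (length vs)))).
  2: { intros us. rewrite <- expect_scal. apply expect_ext. intros ws. unfold Rdiv. apply Rmult_comm. }
  rewrite expect_scal.
  assert (Hlen : 0 <= INR (length vs) <= INR s) by (split; [apply pos_INR|apply le_INR, HL]).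
  assert (He : 0 < eta * eta) by (apply Rmult_lt_0_compat; apply Rdiv_lt_0_compat; nra).
  apply Rmult_le_reg_l with (eta * eta); [exact He|].
  rewrite <- Rmult_assoc, Rinv_r, Rmult_1_l by lra.
  eapply Rle_trans; [apply (expect_frob n adj Hn Hsg Hdeg t r vs N om); auto; lra|].
  apply Rle_trans with (INR s * INR s * (48 * (q * q) / om)).
  - apply Rmult_le_compat; [nra| |nra|].
    + apply Rle_mult_inv_pos; nra.
    + apply Rmult_le_compat_r; [left; apply Rinv_0_lt_compat; lra|].
      assert (N * N <= (4 * q) * (4 * q)) by nra. nra.
  - replace (eta * eta * / 10) with (INR s * INR s * (tau * tau / 10 / 1024)) by field.
    apply Rmult_le_compat_l; [nra|]. lra.
Qed.

Lemma tester_complete phi : 0 < phi <= 1 -> clusterable n adj k phi ->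
  M * (1 - phi * phi / 4) ^ (2 * t) <= tau / 32 ->
  4 / 5 <= E (tester k K theta M T s t r) (fun b : bool => if b then 1 else 0).
Proof.
  intros Hphi Hcl Hdecay. pose proof (tvol_pos n adj Hn Hdeg) as HM.
  destruct threshold_ge as [Hs1 [Hk1 [HK HsK]]].
  assert (Hrej : E (tester k K theta M T s t r) (fun b : bool => if b then 0 else 1) <= 1 / 5).
  2: { assert (Hsum : E (tester k K theta M T s t r) (fun b : bool => if b then 1 else 0) +
         E (tester k K theta M T s t r) (fun b : bool => if b then 0 else 1) = 1).
       { eapply eq_trans; [|apply (expect_const n adj Hn (tester k K theta M T s t r) 1)].
         rewrite <- expect_plus. apply expect_ext. intros []; lra. } lra. }
  rewrite expect_tester.
  destruct (sampler_weights n adj Hn Hsg Hdeg T HT HTM) as [sigma [Hsig Hsamp]].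
  set (heavy := fun v => if Rltb K (gram n adj t v v) then 1 else 0).
  assert (Hh0 : forall v, 0 <= heavy v) by (intros v; unfold heavy; destruct (Rltb _ _); lra).
  (* Union bound in expectation: the number of heavy vertices in the sample dominates the indicator
     that there is one. *)
  apply Rle_trans with (E (sample T (4 * T) s) (fun vs => rsum vs heavy + / 10)).
  - apply (expect_le_always n adj Hn (fun vs => (length vs <= s)%nat /\ forall v, In v vs -> (v < n)%nat));
      [apply (always_sample n adj Hn Hsg T HT)|].
    intros vs [HL Hvs].
    destruct (classic (exists v, In v vs /\ K < gram n adj t v v)) as [[v [Hv HKv]]|Hnone].
    + apply Rle_trans with 1.
      * apply (expect_le_const n adj Hn). intros us. apply (expect_le_const n adj Hn). intros ws. destruct (verdict _ _ _ _ _); lra.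
      * assert (heavy v <= rsum vs heavy) by (apply rsum_ge_term; auto).
        unfold heavy at 1 in H. apply Rltb_true in HKv. rewrite HKv in H. lra.
    + apply Rle_trans with (/ 10); [|pose proof (rsum_nonneg vs heavy (fun v _ => Hh0 v)); lra].
      assert (Hvs' : forall v, In v vs -> (v < n)%nat /\ gram n adj t v v <= K).
      { intros v Hv. split; [auto|]. apply Rnot_lt_le. intros Hlt. apply Hnone; eauto. }
      eapply Rle_trans; [|apply (expect_frob_small vs K Hvs' HL); lra].
      apply (expect_le n adj Hn). intros us. apply (expect_le n adj Hn). intros ws.
      set (L := length vs) in *. set (Gh := estimate M r us ws).
      set (D := fun a b => Gh a b - sgram n adj t vs a b).
      assert (He : 0 < eta * eta) by (apply Rmult_lt_0_compat; apply Rdiv_lt_0_compat; nra).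
      assert (He0 : 0 < eta) by (apply Rdiv_lt_0_compat; nra).
      (* A small error forces acceptance: diagonal estimates stay below K + eta <= 2K, and every
         family [X] has a combination with estimated form at most eta + eta = theta times its square
         norm. *)
      destruct (Rle_lt_dec (frob D L) (eta * eta)) as [Hsmall|Hlarge].
      * replace (verdict k K theta Gh L) with true.
        { apply Rle_mult_inv_pos; [apply frob_nonneg|auto]. }
        unfold verdict. destruct (excluded_middle_informative _) as [Hrej|]; [|reflexivity].
        exfalso. destruct Hrej as [[a [Ha HaK]]|[X HX]].
        -- pose proof (frob_ge_term D L a Ha) as Hdd.
           assert (HD : D a a <= eta) by (apply sq_le_bound; lra).
           unfold D, sgram in HD. destruct (Hvs' (nth a vs 0%nat)) as [_ HaN]; [apply nth_In; exact Ha|].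
           assert (eta <= INR s) by nra. lra.
        -- destruct (gram_small_direction n adj Hsg Hdeg k phi Hphi Hcl t vs X Hvs) as [c [Hc Hle]].
           specialize (HX c Hc). fold L in Hle. set (x := lincomb k X c) in *.
           pose proof (qform_bound D L eta x ltac:(lra) Hsmall) as [_ Hb].
           unfold D in Hb. rewrite (qform_minus Gh (sgram n adj t vs)) in Hb.
           pose proof (sqn_nonneg L x) as Hx0.
           assert (Hc1 : M * INR L * (1 - phi * phi / 4) ^ (2 * t) <= INR s * (tau / 32)).
           { replace (M * INR L * (1 - phi * phi / 4) ^ (2 * t)) with
               (INR L * (M * (1 - phi * phi / 4) ^ (2 * t))) by ring.
             apply Rmult_le_compat; auto using pos_INR.
             - apply Rmult_le_pos; [lra|apply pow_le; nra].
             - apply le_INR, HL. }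
           assert (M * INR L * (1 - phi * phi / 4) ^ (2 * t) * sqn L x <= INR s * (tau / 32) * sqn L x)
             by (apply Rmult_le_compat_r; auto).
           lra.
      * apply Rle_trans with 1; [destruct (verdict _ _ _ _ _); lra|].
        apply Rdiv_ge_one; [exact He|]. unfold D in *. lra.
  - rewrite expect_plus, (expect_const n adj Hn),
      (expect_sample_sum n adj Hn T (4 * T) sigma s heavy Hsamp).
    assert (Hb : rsum V (fun v => sigma v * heavy v)
        <= 2 / M * rsum V (fun v => if Rltb K (gram n adj t v v) then d v else 0)).
    { rewrite <- rsum_scal. apply rsum_le. intros v Hv. apply in_seq in Hv.
      destruct (Hsig v ltac:(lia)) as [_ [_ Hsv]]. unfold heavy.
      destruct (Rltb K (gram n adj t v v)); [|lra].
      replace (2 / M * d v) with (2 * d v / M) by (field; lra). lra. }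
    pose proof (heavy_collision_vol n adj Hsg Hdeg k phi Hphi Hcl t K Hk) as Hv.
    specialize (Hv ltac:(nra) ltac:(lra)).
    set (b := rsum V (fun v => if Rltb K (gram n adj t v v) then d v else 0)) in *.
    replace (K - INR k - 1) with (20 * INR s * (INR k * INR k)) in Hv by ring.
    assert (Hkk : 1 <= INR k * INR k) by nra.
    assert (Hb2 : INR s * b <= M / 20).
    { apply Rmult_le_reg_r with (20 * (INR k * INR k)); [nra|].
      replace (INR s * b * (20 * (INR k * INR k))) with (b * (20 * INR s * (INR k * INR k))) by ring.
      replace (M / 20 * (20 * (INR k * INR k))) with (INR k * INR k * M) by field. exact Hv. }
    assert (Hb3 : INR s * rsum V (fun v => sigma v * heavy v) <= 2 / M * (M / 20)).
    { apply Rle_trans with (INR s * (2 / M * b)); [apply Rmult_le_compat_l; lra|].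
      replace (INR s * (2 / M * b)) with (2 / M * (INR s * b)) by ring.
      apply Rmult_le_compat_l; [left; apply Rdiv_lt_0_compat; lra|exact Hb2]. }
    replace (2 / M * (M / 20)) with (/ 10) in Hb3 by (field; lra). lra.
Qed.

(** Two failures of probability at most 1/10 each: a poor vertex sample, measured by [Z], and poor
    collision counts on a good sample. *)
Lemma tester_sound phi beta : 0 < phi < 1 -> 0 < beta ->
  unclusterable n adj k phi beta ->
  tau <= (1 - phi) ^ (2 * t) ->
  160 * (INR (S k) * INR (S k) * INR (S k)) / (beta * (tau * tau)) <= INR s ->
  E (tester k K theta M T s t r) (fun b : bool => if b then 1 else 0) <= 1 / 5.
Proof.
  intros Hphi Hbeta [Cs [Hdisj HCs]] Htp Hss. pose proof (tvol_pos n adj Hn Hdeg) as HM.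
  destruct threshold_ge as [Hs1 [Hk1 [HK HsK]]]. destruct precision_ge as [Hom1 Hom2].
  assert (HSk : 0 < INR (S k)) by (apply lt_0_INR; lia).
  assert (Hall : INR (vol n adj all_vertices) = M) by (rewrite INR_vol; reflexivity).
  assert (Hvolge : forall i, (i < S k)%nat -> beta * M / INR (S k) <= INR (vol n adj (Cs i))).
  { intros i Hi. destruct (HCs i Hi) as [Hv _]. rewrite Hall in Hv. lra. }
  assert (Hb0 : 0 < beta * M / INR (S k)) by (apply Rdiv_lt_0_compat; [apply Rmult_lt_0_compat|]; lra).
  assert (Hvol : forall i, (i < S k)%nat -> 0 < INR (vol n adj (Cs i)))
    by (intros i Hi; specialize (Hvolge i Hi); lra).
  assert (Hcut : forall i, (i < S k)%nat -> cond_within n adj all_vertices (Cs i) <= phi)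
    by (intros i Hi; apply HCs, Hi).
  destruct (sampler_weights n adj Hn Hsg Hdeg T HT HTM) as [sigma [Hsig Hsamp]].
  set (Z := fun vs => frob (fun i j => empirical n adj Cs sigma (INR s) t vs i j
                               - exact_form n adj Cs t i j) (S k)).
  assert (Htt : 0 < tau / 2 * (tau / 2)) by nra.
  rewrite expect_tester.
  apply Rle_trans with (E (sample T (4 * T) s) (fun vs => / (tau / 2 * (tau / 2)) * Z vs + / 10)).
  - apply (expect_le_always n adj Hn (fun vs => (length vs <= s)%nat /\ forall v, In v vs -> (v < n)%nat));
      [apply (always_sample n adj Hn Hsg T HT)|].
    intros vs [HL Hvs].
    assert (HZ0 : 0 <= Z vs) by apply frob_nonneg.
    assert (HZ1 : 0 <= / (tau / 2 * (tau / 2)) * Z vs)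
      by (apply Rmult_le_pos; [left; apply Rinv_0_lt_compat; lra|exact HZ0]).
    destruct (Rle_lt_dec (Z vs) (tau / 2 * (tau / 2))) as [HZ|HZ].
    2: { apply Rle_trans with 1.
         - apply (expect_le_const n adj Hn). intros us. apply (expect_le_const n adj Hn). intros ws. destruct (verdict _ _ _ _ _); lra.
         - assert (1 <= / (tau / 2 * (tau / 2)) * Z vs); [|lra].
           apply Rmult_le_reg_l with (tau / 2 * (tau / 2)); [lra|].
           rewrite <- Rmult_assoc, Rinv_r by lra. lra. }
    apply Rle_trans with (/ 10); [|lra].
    set (L := length vs) in *.
    (* A diagonal entry above 4K would ruin the Frobenius estimate, but then that entry alone causes
       rejection: acceptance needs an estimate at most 2K < g/2, and by Chebyshev this has
       probability at most 12/om. *)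
    destruct (classic (exists v, In v vs /\ 4 * K < gram n adj t v v)) as [[v [Hv HKv]]|Hnone].
    + destruct (In_nth vs v 0%nat Hv) as [a [Ha Hav]].
      set (g := gram n adj t v v) in *.
      assert (Hg : 0 < g / 2 * (g / 2)) by nra.
      apply Rle_trans with (E (map_prog (sketch t r) vs) (fun us => E (map_prog (sketch t r) vs) (fun ws =>
        / (g / 2 * (g / 2)) * ((estimate M r us ws a a - g) * (estimate M r us ws a a - g))))).
      * apply (expect_le n adj Hn). intros us. apply (expect_le n adj Hn). intros ws.
        set (e := estimate M r us ws a a).
        assert (Hnn : 0 <= / (g / 2 * (g / 2)) * ((e - g) * (e - g)))
          by (apply Rmult_le_pos; [left; apply Rinv_0_lt_compat; auto|apply Rle_0_sqr]).
        unfold verdict. destruct (excluded_middle_informative _) as [|Hacc]; [exact Hnn|].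
        assert (He : e <= 2 * K).
        { apply Rnot_lt_le. intros Hlt. apply Hacc. left. exists a. split; [exact Ha|exact Hlt]. }
        apply Rmult_le_reg_l with (g / 2 * (g / 2)); [exact Hg|].
        rewrite <- Rmult_assoc, Rinv_r by lra. nra.
      * rewrite (expect_estimate n adj Hn t r vs a a (fun z => / (g / 2 * (g / 2)) * ((z - g) * (z - g)))) by auto.
        rewrite Hav.
        rewrite (expect_ext n adj _ _ (fun us => / (g / 2 * (g / 2)) * E (rep r (walk t v)) (fun ws =>
           (collision_mean M r us ws - g) * (collision_mean M r us ws - g))))
          by (intros; apply expect_scal).
        rewrite expect_scal.
        apply Rmult_le_reg_l with (g / 2 * (g / 2)); [exact Hg|].
        rewrite <- Rmult_assoc, Rinv_r, Rmult_1_l by lra.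
        eapply Rle_trans.
        { apply (collision_variance n adj Hn Hsg Hdeg t v v r g om); auto; try lra; fold g; lra. }
        apply Rdiv_le_bound; [lra|]. nra.
    + assert (Hvs' : forall v, In v vs -> (v < n)%nat /\ gram n adj t v v <= 4 * K).
      { intros v Hv. split; [auto|]. apply Rnot_lt_le. intros Hlt. apply Hnone; eauto. }
      eapply Rle_trans; [|apply (expect_frob_small vs (4 * K) Hvs' HL); lra].
      apply (expect_le n adj Hn). intros us. apply (expect_le n adj Hn). intros ws.
      fold L. set (Gh := estimate M r us ws).
      set (D := fun a b => Gh a b - sgram n adj t vs a b).
      assert (He0 : 0 < eta) by (apply Rdiv_lt_0_compat; nra).
      assert (He : 0 < eta * eta) by nra.
      assert (Hfn : 0 <= frob D L / (eta * eta)) by (apply Rle_mult_inv_pos; [apply frob_nonneg|auto]).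
      unfold verdict. destruct (excluded_middle_informative _) as [|Hacc]; [exact Hfn|].
      apply Rdiv_ge_one; [exact He|].
      apply Rnot_lt_le. intros Hfrob. apply Hacc. right.
      exists (fun i a => lazy_iter adj t (cluster_fun n adj Cs i) (nth a vs 0%nat)). intros c Hc.
      destruct (gram_large_subspace n adj Hsg Hdeg k phi Cs Hdisj Hvol Hcut Hphi sigma (INR s) tau t vs
        ltac:(lra) (conj (proj1 Htau) Htp) HM) with (c := c) as [Hx1 Hx2]; auto.
      { intros v Hv. split; [auto|]. destruct (Hsig v (Hvs v Hv)) as [Hp [Hq _]]. split; [|exact Hq].
        apply Rle_mult_inv_pos; [apply pos_INR|exact Hp]. }
      fold L in Hx1, Hx2. cbv zeta in Hx1, Hx2.
      set (x := lincomb k _ c) in *.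
      pose proof (qform_bound D L eta x ltac:(lra) (Rlt_le _ _ Hfrob)) as [Hb _].
      unfold D in Hb. rewrite (qform_minus Gh (sgram n adj t vs)) in Hb.
      assert (0 < INR s * tau * sqn L x) by (apply Rmult_lt_0_compat; nra).
      lra.
  - rewrite expect_plus, (expect_const n adj Hn), expect_scal.
    (* Each of the (k+1)^2 entries has variance at most 4 (k+1) / (beta s): weights up to 4M, one
       factor bounded pointwise by (k+1) / (beta M), the other of norm at most 1. The condition on
       [s] turns the total into a tenth of (tau/2)^2. *)
    assert (HEZ : E (sample T (4 * T) s) Z <= 4 * (INR (S k) * INR (S k) * INR (S k)) / (beta * INR s)).
    { unfold Z, frob. rewrite (expect_rsum n adj Hn).
      apply Rle_trans with (rsum (seq 0 (S k)) (fun _ => rsum (seq 0 (S k)) (fun _ => 4 * INR (S k) / (beta * INR s)))).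
      2: { rewrite !rsum_const, length_seq. right. field. lra. }
      apply rsum_le. intros i Hi. apply in_seq in Hi. rewrite (expect_rsum n adj Hn).
      apply rsum_le. intros j Hj. apply in_seq in Hj.
      set (F := fun i => lazy_iter adj t (cluster_fun n adj Cs i)).
      set (g := fun v => d v / sigma v * (F i v * F j v)).
      assert (Hmean : exact_form n adj Cs t i j = rsum V (fun v => sigma v * g v)).
      { apply rsum_ext. intros v Hv. apply in_seq in Hv. destruct (Hsig v ltac:(lia)) as [Hp _].
        unfold g. fold (F i) (F j). field. lra. }
      rewrite Hmean.
      eapply Rle_trans; [apply (expect_sample_deviation n adj Hn T (4 * T) sigma s g Hs Hsamp)|].
      apply Rmult_le_reg_r with (INR s); [lra|].
      unfold Rdiv. rewrite Rmult_assoc, Rinv_l, Rmult_1_r by lra.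
      replace (4 * INR (S k) * / (beta * INR s) * INR s) with (4 * INR (S k) / beta) by (field; lra).
      apply Rle_trans with (4 * INR (S k) / beta * deg_ip n adj (F j) (F j)).
      2: { rewrite <- (Rmult_1_r (4 * INR (S k) / beta)) at 2. apply Rmult_le_compat_l.
           - apply Rle_mult_inv_pos; lra.
           - apply (cluster_iter_norm n adj Hsg Hdeg k Cs Hdisj Hvol); auto. lia. }
      unfold deg_ip. rewrite <- rsum_scal. apply rsum_le. intros v Hv. apply in_seq in Hv.
      destruct (Hsig v ltac:(lia)) as [Hp [Hq _]]. unfold g.
      replace (sigma v * (d v / sigma v * (F i v * F j v) * (d v / sigma v * (F i v * F j v))))
        with (d v / sigma v * (F i v * F i v) * (d v * (F j v * F j v))) by (field; lra).
      apply Rmult_le_compat_r; [apply Rmult_le_pos; [apply pos_INR|apply Rle_0_sqr]|].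
      assert (HFi : F i v * F i v <= INR (S k) / (beta * M)).
      { eapply Rle_trans; [apply (cluster_iter_bound n adj Hsg Hdeg k Cs Hvol); lia|].
        replace (INR (S k) / (beta * M)) with (/ (beta * M / INR (S k))) by (field; split; [lra|split; lra] || (field; lra)).
        apply Rinv_le_contravar; [exact Hb0|apply Hvolge; lia]. }
      apply Rle_trans with (4 * M * (INR (S k) / (beta * M))).
      - apply Rmult_le_compat; [|apply Rle_0_sqr|exact Hq|exact HFi].
        apply Rle_mult_inv_pos; [apply pos_INR|exact Hp].
      - right. field. lra. }
    set (k3 := INR (S k) * INR (S k) * INR (S k)) in *.
    assert (Hbt : 0 < beta * (tau * tau)) by (apply Rmult_lt_0_compat; nra).
    assert (Hs3 : 160 * k3 <= INR s * (beta * (tau * tau))).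
    { apply Rmult_le_reg_r with (/ (beta * (tau * tau))); [apply Rinv_0_lt_compat; auto|].
      rewrite (Rmult_assoc (INR s)), Rinv_r, Rmult_1_r by lra. exact Hss. }
    assert (Hz : / (tau / 2 * (tau / 2)) * E (sample T (4 * T) s) Z <= / 10); [|lra].
    apply Rmult_le_reg_l with (tau / 2 * (tau / 2)); [exact Htt|].
    rewrite <- Rmult_assoc, Rinv_r, Rmult_1_l by lra.
    eapply Rle_trans; [exact HEZ|].
    apply Rdiv_le_bound; [apply Rmult_lt_0_compat; lra|]. lra.
Qed.

End Analysis.

(** * Choice of the sample sizes *)

Lemma nat_ceil x : 0 <= x -> exists N : nat, x <= INR N <= x + 1.
Proof.
  intros Hx. destruct (archimed x) as [H1 H2].
  destruct (IZN (up x)) as [N HN].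
  - apply le_IZR. simpl. lra.
  - exists N. rewrite INR_IZR_INZ, <- HN. lra.
Qed.

Lemma exp_pow_INR x N : exp x ^ N = exp (INR N * x).
Proof.
  induction N as [|N IH]; [simpl; rewrite Rmult_0_l, exp_0; reflexivity|].
  rewrite S_INR. simpl. rewrite IH, <- exp_plus. f_equal. ring.
Qed.

Lemma exp_le_compat x y : x <= y -> exp x <= exp y.
Proof. intros [H| ->]; [left; apply exp_increasing, H|lra]. Qed.

Lemma ln_le_compat x y : 0 < x -> x <= y -> ln x <= ln y.
Proof. intros Hx [H| ->]; [left; apply ln_increasing; auto|lra]. Qed.

Lemma one_minus_le_exp x : 1 - x <= exp (- x).
Proof. pose proof (exp_ineq1_le (- x)). lra. Qed.

Lemma exp_le_one_minus x : 0 <= x <= 1 / 2 -> exp (- (2 * x)) <= 1 - x.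
Proof.
  intros Hx. rewrite exp_Ropp. pose proof (exp_ineq1_le (2 * x)) as H.
  apply Rmult_le_reg_r with (exp (2 * x)); [apply exp_pos|].
  rewrite Rinv_l by (apply Rgt_not_eq, exp_pos).
  apply Rle_trans with ((1 - x) * (1 + 2 * x)); [nra|]. apply Rmult_le_compat_l; lra.
Qed.

Lemma ln_64_le : ln 64 <= 63.
Proof.
  rewrite <- (ln_exp 63). apply ln_le_compat; [lra|]. pose proof (exp_ineq1_le 63). lra.
Qed.

(** The choice t ~ 4 ln(64 m) / phi_in^2 makes exp(-phi_in^2 t / 2) at most (64 m)^-2, while the gap
    hypothesis bounds 4 phi_out t by phi_in^2 t / 120. The number 507 is 8 * 63 + 3, where 63 bounds
    ln 64. *)
Lemma walk_length_exists (m : nat) (phi_in phi_out : R) :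
  (1 <= m)%nat -> 0 < phi_in <= 1 -> 0 < phi_out <= phi_in ^ 2 / 480 ->
  exists t : nat,
    INR (2 * m) * (1 - phi_in * phi_in / 4) ^ (2 * t) <= exp (- (4 * phi_out * INR t)) / 32 /\
    exp (- (4 * phi_out * INR t)) <= (1 - phi_out) ^ (2 * t) /\
    exp (4 * phi_out * INR t) <= 27 * Rpower (INR m) (16 * (phi_out / phi_in ^ 2)) /\
    INR (2 * t + 1) <= 507 * (1 + ln (INR m)) * (1 + 1 / phi_in) ^ 2.
Proof.
  intros Hm Hpi Hpo.
  assert (Hm1 : 1 <= INR m) by (apply (le_INR 1); auto).
  assert (Hlm : 0 <= ln (INR m)) by (rewrite <- ln_1; apply ln_le_compat; lra).
  assert (Hl : ln (64 * INR m) = ln 64 + ln (INR m)) by (apply ln_mult; lra).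
  assert (H64 : 0 <= ln 64 <= 63).
  { split; [rewrite <- ln_1; apply ln_le_compat; lra|apply ln_64_le]. }
  set (lm := ln (64 * INR m)) in *.
  assert (Hp2 : 0 < phi_in ^ 2 <= 1) by (simpl; nra).
  destruct (nat_ceil (4 * lm / phi_in ^ 2)) as [t [Ht1 Ht2]].
  { apply Rle_mult_inv_pos; lra. }
  assert (Htlow : 4 * lm <= phi_in ^ 2 * INR t).
  { apply Rmult_le_compat_r with (r := phi_in ^ 2) in Ht1; [|lra].
    unfold Rdiv in Ht1. rewrite Rmult_assoc, Rinv_l in Ht1 by lra. lra. }
  assert (Ht0 : 0 <= INR t) by apply pos_INR.
  exists t. repeat split.
  - apply Rle_trans with (INR (2 * m) * exp (INR (2 * t) * - (phi_in * phi_in / 4))).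
    + apply Rmult_le_compat_l; [apply pos_INR|]. rewrite <- exp_pow_INR.
      apply pow_incr. split; [nra|apply one_minus_le_exp].
    + rewrite !mult_INR. simpl (INR 2).
      apply Rmult_le_reg_r with 32; [lra|].
      replace (exp (- (4 * phi_out * INR t)) / 32 * 32) with (exp (- (4 * phi_out * INR t))) by field.
      apply Rle_trans with (exp lm * exp ((1 + 1) * INR t * - (phi_in * phi_in / 4))).
      { unfold lm. rewrite exp_ln by lra. lra. }
      rewrite <- exp_plus. apply exp_le_compat.
      assert (phi_out * INR t <= phi_in ^ 2 / 480 * INR t) by (apply Rmult_le_compat_r; lra).
      simpl in *. lra.
  - replace (- (4 * phi_out * INR t)) with (INR (2 * t) * - (2 * phi_out))
      by (rewrite mult_INR; simpl (INR 2); ring).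
    rewrite <- exp_pow_INR. apply pow_incr. split; [left; apply exp_pos|].
    apply exp_le_one_minus. lra.
  - set (eps := phi_out / phi_in ^ 2).
    assert (Heps : 0 < eps <= 1 / 480).
    { unfold eps. split; [apply Rdiv_lt_0_compat; lra|]. apply Rdiv_le_bound; lra. }
    (* The constant part of the exponent is at most 16 * 63 / 480 + 4 / 480 < 3. *)
    apply Rle_trans with (exp (3 + 16 * eps * ln (INR m))).
    + apply exp_le_compat.
      assert (phi_out * INR t <= phi_out * (4 * lm / phi_in ^ 2 + 1)) by (apply Rmult_le_compat_l; lra).
      replace (phi_out * (4 * lm / phi_in ^ 2 + 1)) with (4 * eps * lm + phi_out) in H
        by (unfold eps; field; lra).
      rewrite Hl in H. assert (eps * ln 64 <= 1 / 480 * 63) by (apply Rmult_le_compat; lra).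
      nra.
    + rewrite exp_plus. unfold Rpower. apply Rmult_le_compat_r; [left; apply exp_pos|].
      replace 3 with (INR 3 * 1) by (simpl; ring). rewrite <- exp_pow_INR.
      replace 27 with (3 ^ 3) by (simpl; ring). apply pow_incr.
      split; [left; apply exp_pos|apply exp_le_3].
  - rewrite plus_INR, mult_INR. simpl (INR 2). simpl (INR 1).
    set (u := 1 + 1 / phi_in).
    assert (Hu : 1 <= u /\ 1 / phi_in ^ 2 <= u ^ 2).
    { assert (0 < 1 / phi_in) by (apply Rdiv_lt_0_compat; lra).
      assert (1 / phi_in ^ 2 = (1 / phi_in) ^ 2) by (field; lra).
      unfold u. split; [lra|]. rewrite H0. apply pow_incr. lra. }
    assert (Hlm2 : lm / phi_in ^ 2 <= 63 * (1 + ln (INR m)) * u ^ 2).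
    { unfold Rdiv. apply Rmult_le_compat; try lra.
      left; apply Rinv_0_lt_compat; lra. }
    assert (1 <= (1 + ln (INR m)) * u ^ 2).
    { assert (1 <= u ^ 2) by (simpl; nra). nra. }
    unfold Rdiv in *. lra.
Qed.

(** Read b = 1/beta, x = 1/tau, l = 1 + ln m, u = 1 + 1/phi_in, w = sqrt(m), w' = sqrt(2m), t2 =
    2t+1. Since s ~ k^3 b x^2 and om ~ s^2 k^4 x^2, the product s om has order k^13 b^3 x^8. The
    factor 3122 is 80 + 2 * 3 * 507. *)
Lemma query_count_bound (k b x l u w w' s om r T t2 : R) :
  1 <= k -> 1 <= b -> 1 <= x -> 1 <= l -> 1 <= u -> 1 <= w -> 0 <= w' <= 2 * w ->
  1 <= s <= 160 * ((k + 1) * (k + 1) * (k + 1)) * b * x ^ 2 + 1 ->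
  om = 491520 * ((k + 1 + 20 * s * (k * k)) * (k + 1 + 20 * s * (k * k))) * x ^ 2 ->
  0 <= r <= om * w' + 1 -> 0 <= T <= 2 * w' + 1 -> 0 <= t2 <= 507 * l * u ^ 2 ->
  s * (16 * T) + 2 * (s * (r * t2)) <=
  (3122 * (491520 * 484) * 1281 ^ 3) * (k ^ 13 * b ^ 3 * x ^ 8 * w * l * u ^ 2).
Proof.
  intros Hk Hb Hx Hl Hu Hw Hw' Hs Hom Hr HT Ht2.
  assert (Hpow : forall y N, 1 <= y -> 1 <= y ^ N) by (intros; apply pow_R1_Rle; auto).
  assert (Hprod : forall a c, 1 <= a -> 1 <= c -> 1 <= a * c) by (intros; nra).
  set (S1 := k ^ 3 * b * x ^ 2).
  assert (HS1 : 1 <= S1) by (unfold S1; auto).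
  assert (Hs1 : s <= 1281 * S1).
  { assert ((k + 1) * (k + 1) * (k + 1) <= 8 * k ^ 3).
    { replace (8 * k ^ 3) with ((2 * k) * (2 * k) * (2 * k)) by ring.
      apply Rmult_le_compat; nra. }
    assert (160 * ((k + 1) * (k + 1) * (k + 1)) * (b * x ^ 2) <= 160 * (8 * k ^ 3) * (b * x ^ 2)).
    { apply Rmult_le_compat_r; [|lra]. specialize (Hprod b (x ^ 2) Hb (Hpow x 2%nat Hx)). lra. }
    unfold S1 in *. lra. }
  set (K := k + 1 + 20 * s * (k * k)) in *.
  assert (HK : 1 <= K <= 22 * (s * k ^ 2)).
  { unfold K. assert (k <= k * k) by nra. assert (k * k <= s * (k * k)) by nra.
    simpl. split; nra. }
  assert (Hom1 : om <= 491520 * 484 * (s ^ 2 * k ^ 4 * x ^ 2)).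
  { rewrite Hom. replace (491520 * 484 * (s ^ 2 * k ^ 4 * x ^ 2))
      with (491520 * ((22 * (s * k ^ 2)) * (22 * (s * k ^ 2))) * x ^ 2) by ring.
    apply Rmult_le_compat_r; [apply pow_le; lra|]. apply Rmult_le_compat_l; [lra|].
    apply Rmult_le_compat; lra. }
  assert (Hom0 : 1 <= om).
  { rewrite Hom. apply Hprod; [|auto]. apply Rle_trans with (491520 * (1 * 1)); [lra|].
    apply Rmult_le_compat_l; [lra|]. apply Rmult_le_compat; lra. }
  assert (Hrw : r <= 3 * (om * w)).
  { assert (om * w' <= om * (2 * w)) by (apply Rmult_le_compat_l; lra).
    specialize (Hprod om w Hom0 Hw). lra. }
  set (z := l * u ^ 2) in *.
  assert (Hz : 1 <= z) by (unfold z; auto).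
  assert (Hrt : r * t2 <= 3 * (om * w) * (507 * z)).
  { apply Rmult_le_compat; unfold z; lra. }
  assert (HTw : T <= 5 * (om * w * z)).
  { apply Rle_trans with (5 * w); [lra|]. apply Rmult_le_compat_l; [lra|].
    rewrite <- (Rmult_1_l w) at 1. rewrite <- (Rmult_1_r (1 * w)).
    apply Rmult_le_compat; [nra|lra| |exact Hz]. apply Rmult_le_compat_r; lra. }
  assert (Hsom : s * om <= 491520 * 484 * 1281 ^ 3 * (k ^ 13 * b ^ 3 * x ^ 8)).
  { apply Rle_trans with (s * (491520 * 484 * (s ^ 2 * k ^ 4 * x ^ 2))).
    - apply Rmult_le_compat_l; lra.
    - replace (s * (491520 * 484 * (s ^ 2 * k ^ 4 * x ^ 2)))
        with (491520 * 484 * (k ^ 4 * x ^ 2) * s ^ 3) by ring.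
      replace (491520 * 484 * 1281 ^ 3 * (k ^ 13 * b ^ 3 * x ^ 8))
        with (491520 * 484 * (k ^ 4 * x ^ 2) * (1281 * S1) ^ 3) by (unfold S1; ring).
      apply Rmult_le_compat_l; [|apply pow_incr; lra].
      specialize (Hprod (k ^ 4) (x ^ 2) (Hpow k 4%nat Hk) (Hpow x 2%nat Hx)). lra. }
  apply Rle_trans with (3122 * (s * om) * (w * z)).
  - assert (s * (16 * T) <= s * (80 * (om * w * z))) by (apply Rmult_le_compat_l; lra).
    assert (s * (r * t2) <= s * (3 * (om * w) * (507 * z))) by (apply Rmult_le_compat_l; lra).
    lra.
  - replace (3122 * (491520 * 484) * 1281 ^ 3 * (k ^ 13 * b ^ 3 * x ^ 8 * w * l * u ^ 2))
      with (3122 * (491520 * 484 * 1281 ^ 3 * (k ^ 13 * b ^ 3 * x ^ 8)) * (w * z)) by (unfold z; ring).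
    apply Rmult_le_compat_r; [specialize (Hprod w z Hw Hz); lra|].
    apply Rmult_le_compat_l; [lra|exact Hsom].
Qed.

Lemma pow_le_Rpower y N c : 1 <= y -> INR N <= c -> y ^ N <= Rpower y c.
Proof.
  intros Hy HN. rewrite <- Rpower_pow by lra. apply Rle_Rpower; auto.
Qed.

(** In a cluster with at least two vertices, a vertex of minimum degree carries at most half of the
    volume, and its conductance is at most 1. *)
Lemma clusterable_le_one n adj k phi :
  (0 < n)%nat -> (forall v, (v < n)%nat -> (1 <= deg adj v)%nat) ->
  clusterable n adj k phi -> phi <= 1.
Proof.
  intros Hn Hdeg [h [P [Hh [HP Hcond]]]].
  specialize (Hcond (P 0%nat) (HP 0%nat Hn)). set (C := fun v => Nat.eqb (P v) (P 0%nat)) in *.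
  unfold internal_conductance_ge in Hcond.
  destruct (Nat.ltb_spec 1 (card n C)) as [Hcard|_]; [|exact Hcond].
  destruct (argmin_exists (seq 0 n) (fun v => C v = true) (rdeg adj)) as [a [Ha [HCa Hmin]]].
  { exists 0%nat. split; [apply in_seq; lia|apply Nat.eqb_refl]. }
  pose proof (rdeg_ge1 n adj Hdeg a) as Hd. apply in_seq in Ha. specialize (Hd ltac:(lia)).
  set (S := fun v => Nat.eqb v a).
  assert (Hvol : INR (vol n adj S) = rdeg adj a).
  { rewrite INR_vol. apply rsum_delta_nat; [apply seq_NoDup|apply in_seq; lia]. }
  assert (Hother : exists b, (b < n)%nat /\ b <> a /\ C b = true).
  { apply NNPP. intros Hno.
    assert (INR (card n C) <= 1); [|apply lt_INR in Hcard; simpl in Hcard; lra].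
    rewrite INR_card. apply Rle_trans with (rsum (seq 0 n) (fun v => if Nat.eqb v a then 1 else 0));
      [|right; apply (rsum_delta_nat (seq 0 n) a (fun _ => 1)); [apply seq_NoDup|apply in_seq; lia]].
    apply rsum_le. intros v Hv. apply in_seq in Hv. destruct (Nat.eqb_spec v a) as [->|Hne].
    - destruct (C a); lra.
    - destruct (C v) eqn:E; [|lra]. exfalso. apply Hno. exists v. split; [lia|auto]. }
  destruct Hother as [b [Hb [Hne HCb]]].
  apply Rle_trans with (cond_within n adj C S).
  - apply Hcond.
    + intros v _ Hv. apply Nat.eqb_eq in Hv. subst. exact HCa.
    + apply INR_lt. rewrite Hvol. simpl. lra.
    + apply INR_le. rewrite mult_INR, Hvol, INR_vol. simpl (INR 2).
      specialize (Hmin b ltac:(apply in_seq; lia) HCb).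
      apply Rle_trans with (rsum (seq 0 n) (fun v => if Nat.eqb v a then rdeg adj v else 0)
        + rsum (seq 0 n) (fun v => if Nat.eqb v b then rdeg adj v else 0)).
      * rewrite !rsum_delta_nat by (apply seq_NoDup || (apply in_seq; lia)). lra.
      * rewrite <- rsum_plus. apply rsum_le. intros v _.
        destruct (Nat.eqb_spec v a) as [E1|], (Nat.eqb_spec v b) as [E2|];
          [congruence|rewrite E1, HCa; lra|rewrite E2, HCb; lra|].
        pose proof (pos_INR (deg adj v)) as Hp. fold (rdeg adj v) in Hp. destruct (C v); lra.
  - unfold cond_within. apply Rdiv_le_bound; [lra|]. rewrite Rmult_1_l, INR_vol.
    unfold cut, vsum. rewrite INR_list_sum. apply rsum_le. intros v _.
    destruct (S v); [|simpl; lra]. apply le_INR, filter_length_le.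
Qed.

Lemma tvol_edges n adj m : (2 * m)%nat = vsum n (deg adj) -> tvol n adj = INR (2 * m).
Proof. intros ->. unfold vsum. rewrite INR_list_sum. reflexivity. Qed.

Theorem theorem1p1 :
  exists (Cst c : R), 0 < Cst /\ 0 < c /\
  forall (k : nat) (beta phi_in phi_out : R),
    (1 <= k)%nat -> 0 < beta < 1 -> 0 < phi_in -> 0 < phi_out ->
    phi_out <= phi_in ^ 2 / 480 ->
    forall n m : nat,
    exists (A : Alg) (q : nat),
      queries_le q A /\
      INR q <= Cst * Rpower (1 + 1 / phi_in) c * Rpower (INR k) c
                   * Rpower (1 / beta) c * Rpower (1 + ln (INR m)) c
                   * Rpower (INR m) (1 / 2 + c * (phi_out / phi_in ^ 2)) /\
      forall adj : nat -> list nat,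
        simple_graph n adj -> (0 < n)%nat ->
        (2 * m)%nat = vsum n (deg adj) ->
        (forall v, (v < n)%nat -> (1 <= deg adj v)%nat) ->
        (clusterable n adj k phi_in -> accept_prob n adj A >= 2 / 3) /\
        (unclusterable n adj k phi_out beta -> 1 - accept_prob n adj A >= 2 / 3).
Proof.
  set (C0 := 3122 * (491520 * 484) * 1281 ^ 3 * 27 ^ 8).
  assert (HC0 : 0 < C0) by (unfold C0; repeat apply Rmult_lt_0_compat; try apply pow_lt; lra).
  (* The count contains x^8 with x <= 27 m^(16 phi_out / phi_in^2): hence 27^8 in the constant and
     the exponent 8 * 16 = 128, which exceeds all other exponents. *)
  exists C0, 128. split; [exact HC0|]. split; [lra|].
  intros k beta phi_in phi_out Hk Hbeta Hpi Hpo Hgap n m.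
  assert (Hpos : forall y z, 0 < Rpower y z) by (intros; apply exp_pos).
  assert (Htriv : INR 0 <= C0 * Rpower (1 + 1 / phi_in) 128 * Rpower (INR k) 128
                   * Rpower (1 / beta) 128 * Rpower (1 + ln (INR m)) 128
                   * Rpower (INR m) (1 / 2 + 128 * (phi_out / phi_in ^ 2)))
    by (left; do 5 (apply Rmult_lt_0_compat; [|apply Hpos]); exact HC0).
  (* A nonempty graph of minimum degree at least 1 has an edge, so the claim is vacuous. *)
  destruct (Nat.eq_dec m 0) as [->|Hm].
  { exists Accept, 0%nat. split; [exact I|]. split; [exact Htriv|].
    intros adj Hsg Hn Hm Hdeg. pose proof (tvol_pos n adj Hn Hdeg) as Ht.
    rewrite (tvol_edges n adj 0 Hm) in Ht. simpl in Ht. lra. }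
  (* No graph under consideration is clusterable for such [phi_in], so rejecting is correct. *)
  destruct (Rlt_le_dec 1 phi_in) as [Hbig|Hle1].
  { exists Reject, 0%nat. split; [exact I|]. split; [exact Htriv|].
    intros adj Hsg Hn Hm' Hdeg. split.
    - intros Hcl. pose proof (clusterable_le_one n adj k phi_in Hn Hdeg Hcl). lra.
    - intros _. simpl. lra. }
  clear Htriv.
  destruct (walk_length_exists m phi_in phi_out) as [t [Hdecay [Htau [Hx Ht2]]]]; [lia|lra|lra|].
  assert (Hm1 : 1 <= INR m) by (apply (le_INR 1); lia).
  assert (Hk1 : 1 <= INR k) by (apply (le_INR 1); auto).
  set (tau := exp (- (4 * phi_out * INR t))) in *.
  set (x := exp (4 * phi_out * INR t)) in *.
  assert (Hxt : / tau = x) by (unfold tau, x; rewrite exp_Ropp, Rinv_inv; reflexivity).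
  assert (Htau0 : 0 < tau) by apply exp_pos.
  assert (Hx1 : 1 <= x).
  { unfold x. rewrite <- exp_0. apply exp_le_compat. apply Rmult_le_pos; [lra|apply pos_INR]. }
  assert (Htau1 : tau <= 1).
  { unfold tau. rewrite <- exp_0. apply exp_le_compat.
    assert (0 <= 4 * phi_out * INR t) by (apply Rmult_le_pos; [lra|apply pos_INR]). lra. }
  assert (Hb1 : 1 <= 1 / beta) by (apply Rdiv_ge_one; lra).
  set (k3 := INR (S k) * INR (S k) * INR (S k)).
  destruct (nat_ceil (160 * k3 / (beta * (tau * tau)))) as [s [Hs1 Hs2]].
  { apply Rle_mult_inv_pos; [|apply Rmult_lt_0_compat; nra].
    unfold k3. repeat apply Rmult_le_pos; try apply pos_INR; lra. }
  assert (Hk3 : 8 <= k3).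
  { unfold k3. rewrite S_INR. assert (4 <= (INR k + 1) * (INR k + 1)) by nra. nra. }
  assert (Hs0 : 1 <= INR s).
  { eapply Rle_trans; [|exact Hs1]. apply Rdiv_ge_one; [apply Rmult_lt_0_compat; nra|].
    assert (beta * (tau * tau) <= 1 * 1) by (apply Rmult_le_compat; nra). lra. }
  set (K := INR k + 1 + 20 * INR s * (INR k * INR k)).
  set (om := 491520 * (K * K) / (tau * tau)).
  set (M := INR (2 * m)).
  assert (HM : M = 2 * INR m) by (unfold M; rewrite mult_INR; reflexivity).
  assert (HsM : 1 <= sqrt M <= 2 * sqrt (INR m)).
  { split.
    - rewrite <- sqrt_1. apply sqrt_le_1_alt. lra.
    - rewrite HM, sqrt_mult by lra. apply Rmult_le_compat_r; [apply sqrt_pos|].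
      rewrite <- (sqrt_square 2) by lra. rewrite sqrt_square by lra.
      rewrite <- (sqrt_square 2) at 2 by lra. apply sqrt_le_1_alt. lra. }
  assert (HK : 1 <= K) by (unfold K; nra).
  assert (Hom : 1 <= om).
  { apply Rdiv_ge_one; [nra|]. nra. }
  destruct (nat_ceil (om * sqrt M)) as [r [Hr1 Hr2]]; [nra|].
  destruct (nat_ceil (2 * sqrt M)) as [T [HT1 HT2]]; [lra|].
  assert (Hs : (0 < s)%nat) by (apply INR_lt; simpl; lra).
  assert (Hr : (0 < r)%nat) by (apply INR_lt; simpl; nra).
  assert (HT : (0 < T)%nat) by (apply INR_lt; simpl; lra).
  set (A := tester k K (INR s * tau / 16) M T s t r).
  (* Simulation error 1/16 suffices, since 4/5 - 1/16 > 2/3. *)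
  exists (to_alg 4 A), (s * (4 * T * 4) + (s * (r * (2 * t + 1)) + s * (r * (2 * t + 1))))%nat.
  split; [apply (to_alg_queries _ (fun _ => True)), pspec_tester|]. split.
  - set (u := 1 + 1 / phi_in) in *. set (l := 1 + ln (INR m)) in *.
    assert (Hu : 1 <= u).
    { unfold u. assert (0 < 1 / phi_in) by (apply Rdiv_lt_0_compat; lra). lra. }
    assert (Hl : 1 <= l).
    { unfold l. assert (0 <= ln (INR m)) by (rewrite <- ln_1; apply ln_le_compat; lra). lra. }
    assert (Hw : 1 <= sqrt (INR m)) by (rewrite <- sqrt_1; apply sqrt_le_1_alt; lra).
    pose proof (query_count_bound (INR k) (1 / beta) x l u (sqrt (INR m)) (sqrt M) (INR s) om
      (INR r) (INR T) (INR (2 * t + 1)) Hk1 Hb1 Hx1 Hl Hu Hw ltac:(lra)) as Hq.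
    assert (Hx2 : / (tau * tau) = x ^ 2) by (rewrite Rinv_mult, Hxt; ring).
    specialize (Hq ltac:(split; [exact Hs0|]; eapply Rle_trans; [exact Hs2|]; right;
      unfold k3; rewrite S_INR; unfold Rdiv; rewrite Rinv_mult, Hx2; ring)).
    specialize (Hq ltac:(unfold om, Rdiv; rewrite Hx2; reflexivity)).
    specialize (Hq (conj (pos_INR _) Hr2) (conj (pos_INR _) HT2) (conj (pos_INR _) Ht2)).
    rewrite !plus_INR, !(mult_INR s), !(mult_INR r), !(mult_INR _ 4), !(mult_INR 4).
    replace (INR 4) with 4 by (simpl; ring).
    apply Rle_trans with (INR s * (16 * INR T) + 2 * (INR s * (INR r * INR (2 * t + 1)))).
    { right. ring. }
    eapply Rle_trans; [exact Hq|].
    set (y := Rpower (INR m) (16 * (phi_out / phi_in ^ 2))) in *.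
    assert (Hy8 : sqrt (INR m) * y ^ 8 = Rpower (INR m) (1 / 2 + 128 * (phi_out / phi_in ^ 2))).
    { rewrite <- Rpower_sqrt by lra. rewrite <- Rpower_pow by apply Hpos.
      unfold y. rewrite Rpower_mult, <- Rpower_plus. f_equal. simpl. lra. }
    rewrite <- Hy8.
    set (P := Rpower u 128). set (Pk := Rpower (INR k) 128). set (Pb := Rpower (1 / beta) 128).
    set (Pl := Rpower l 128).
    assert (Hx8 : x ^ 8 <= 27 ^ 8 * y ^ 8).
    { rewrite <- Rpow_mult_distr. apply pow_incr. lra. }
    assert (E1 : INR k ^ 13 <= Pk) by (apply pow_le_Rpower; [auto|simpl; lra]).
    assert (E2 : (1 / beta) ^ 3 <= Pb) by (apply pow_le_Rpower; [auto|simpl; lra]).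
    assert (E3 : l <= Pl).
    { rewrite <- (pow_1 l). apply pow_le_Rpower; [auto|simpl; lra]. }
    assert (E4 : u ^ 2 <= P) by (apply pow_le_Rpower; [auto|simpl; lra]).
    assert (Hnn : forall z N, 1 <= z -> 0 <= z ^ N) by (intros; apply pow_le; lra).
    replace (C0 * P * Pk * Pb * Pl * (sqrt (INR m) * y ^ 8))
      with (3122 * (491520 * 484) * 1281 ^ 3 *
        (Pk * Pb * (27 ^ 8 * y ^ 8) * sqrt (INR m) * Pl * P)) by (unfold C0; ring).
    apply Rmult_le_compat_l; [apply Rmult_le_pos; [lra|apply pow_le; lra]|].
    apply Rmult_le_compat; auto; [repeat apply Rmult_le_pos; auto; lra|].
    apply Rmult_le_compat; auto; [repeat apply Rmult_le_pos; auto; lra|lra|].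
    apply Rmult_le_compat_r; [lra|].
    apply Rmult_le_compat; auto; [repeat apply Rmult_le_pos; auto; lra|].
    apply Rmult_le_compat; auto.
  - intros adj Hsg Hn Hedges Hdeg.
    pose proof (tvol_edges n adj m Hedges) as Htv. fold M in Htv.
    assert (HTM : 2 * tvol n adj <= INR T * INR T).
    { rewrite Htv. apply Rle_trans with (2 * sqrt M * (2 * sqrt M)).
      - replace (2 * sqrt M * (2 * sqrt M)) with (4 * (sqrt M * sqrt M)) by ring.
        rewrite sqrt_sqrt; lra.
      - apply Rmult_le_compat; lra. }
    pose proof (to_alg_prob n adj A 4 Hn) as Hsim. apply Rabs_le_inv in Hsim.
    replace ((1 / 2) ^ 4) with (1 / 16) in Hsim by field.
    assert (Hroots : om * sqrt (tvol n adj) <= INR r) by (rewrite Htv; exact Hr1).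
    split.
    + intros Hcl.
      pose proof (tester_complete n adj Hn Hsg Hdeg k Hk tau om T s t r (conj Htau0 Htau1) Hs Hr HT HTM
        (Rle_refl _) Hroots phi_in (conj Hpi Hle1) Hcl) as Hc.
      rewrite Htv in Hc. specialize (Hc Hdecay). fold K in Hc. fold A in Hc. lra.
    + intros Hun.
      assert (Hpo1 : 0 < phi_out < 1).
      { split; [exact Hpo|]. assert (phi_in ^ 2 <= 1) by (simpl; nra). lra. }
      pose proof (tester_sound n adj Hn Hsg Hdeg k Hk tau om T s t r (conj Htau0 Htau1) Hs Hr HT HTM
        (Rle_refl _) Hroots phi_out beta Hpo1 (proj1 Hbeta) Hun Htau Hs1) as Hc.
      rewrite Htv in Hc. fold K in Hc. fold A in Hc. lra.
Qed.
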